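(* Let $N\geq 1$ be an integer, $\alpha\in(0,2)$, $\lambda\in\mathbb{R}$, and let $p:\mathbb{R}^N\to(1,\infty)$ be a measurable function. Set $p^-:=\operatorname{ess\,inf}_{x\in\mathbb{R}^N}p(x)$ and $p^+:=\operatorname{ess\,sup}_{x\in\mathbb{R}^N}p(x)$, and assume $1<p^-\leq p^+<\infty$. Define $$p^*(N)=\begin{cases}\infty & \text{if } N\leq\alpha,\\ \dfrac{N}{N-\alpha} & \text{if } N>\alpha.\end{cases}$$ If $$1<p^-\leq p^+<p^*(N),$$ then the only weak solution $u\in L^2(\mathbb{R}^N)\cap L^{2p(\cdot)}(\mathbb{R}^N)$ to the inequality $$(-\Delta)^{\frac{\alpha}{2}}u+\lambda\,\Delta u\geq |u|^{p(x)},\quad x\in\mathbb{R}^N,$$ is the trivial one, i.e. $u=0$ almost everywhere in $\mathbb{R}^N$.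
   Context: All functions are real-valued; solutions may change sign. Fractional Laplacian: for $s\in(0,1)$, $$(-\Delta)^s f(x)=C_{N,s}\,\mathrm{P.V.}\int_{\mathbb{R}^N}\frac{f(x)-f(y)}{|x-y|^{N+2s}}\,dy,$$ where P.V. denotes Cauchy's principal value and $C_{N,s}>0$ is the usual normalization constant depending only on $N$ and $s$. For $f\in H^2(\mathbb{R}^N)$, $(-\Delta)^s f$ is understood in the usual sense as the $L^2(\mathbb{R}^N)$ function whose Fourier transform is $|\xi|^{2s}\hat f(\xi)$. Variable exponent Lebesgue space: for a measurable $r:\mathbb{R}^N\to(1,\infty)$ with $1<\operatorname{ess\,inf} r\leq\operatorname{ess\,sup} r<\infty$, $L^{r(\cdot)}(\mathbb{R}^N)$ is the set of measurable $f:\mathbb{R}^N\to\mathbb{R}$ such that $\int_{\mathbb{R}^N}|c f(x)|^{r(x)}\,dx<\infty$ for some $c>0$. The space $L^{2p(\cdot)}(\mathbb{R}^N)$ corresponds to the exponent $r(x)=2p(x)$. Weak solution: $u\in L^2(\mathbb{R}^N)\cap L^{2p(\cdot)}(\mathbb{R}^N)$ is a weak solution to $(-\Delta)^{\alpha/2}u+\lambda\Delta u\geq|u|^{p(x)}$ if $$\int_{\mathbb{R}^N}|u(x)|^{p(x)}\varphi(x)\,dx\leq\int_{\mathbb{R}^N}u(x)(-\Delta)^{\frac{\alpha}{2}}\varphi(x)\,dx+\lambda\int_{\mathbb{R}^N}u(x)\Delta\varphi(x)\,dx$$ for all $\varphi\in H^2(\mathbb{R}^N)$ with $\varphi\geq0$.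 *)

(* Defs.v *)
From HB Require Import structures.
From mathcomp Require Import all_boot all_order all_algebra.
From mathcomp Require Import all_classical all_reals all_analysis.
From mathcomp Require Import ess_sup_inf.
From mathcomp Require Import complex.

Set Implicit Arguments.
Unset Strict Implicit.
Unset Printing Implicit Defensive.

Import Order.TTheory GRing.Theory Num.Theory.
Import numFieldNormedType.Exports.

Local Open Scope classical_set_scope.
Local Open Scope ring_scope.

Definition rV_display : measure_display -> measure_display.
Proof. exact. Qed.

(* The sigma-algebra generated by the coordinates; over a realType it is the
   Borel sigma-algebra, 'rV[R]_n being second countable. *)
Section measurable_rV.
Context {d} {T : sigmaRingType d} (n : nat).

Let coord (i : 'I_n) (x : 'rV[T]_n) : T := x ord0 i.

Let rV_set0 : g_sigma_preimage coord set0.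
Proof. exact: sigma_algebra0. Qed.

Let rV_setC A : g_sigma_preimage coord A -> g_sigma_preimage coord (~` A).
Proof. exact: sigma_algebraC. Qed.

Let rV_bigcup (F : _^nat) : (forall i, g_sigma_preimage coord (F i)) ->
  g_sigma_preimage coord (\bigcup_i (F i)).
Proof. exact: sigma_algebra_bigcup. Qed.

HB.instance Definition _ := @isMeasurable.Build (rV_display d)
  'rV[T]_n (g_sigma_preimage coord) rV_set0 rV_setC rV_bigcup.

End measurable_rV.

Lemma measurable_coord_rV d (T : sigmaRingType d) n (i : 'I_n) :
  measurable_fun [set: 'rV[T]_n] (fun x => x ord0 i).
Proof.
move=> _ Y mY; rewrite setTI; apply: sub_sigma_algebra => /=.
rewrite -bigcup_seq/=; exists i => /=; first by rewrite mem_index_enum.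
by exists Y => //; rewrite setTI.
Qed.

Lemma measurable_fun_rVP d1 d2 (T1 : measurableType d1) (T2 : measurableType d2)
    n (f : T1 -> 'rV[T2]_n) :
  measurable_fun [set: T1] f <->
  forall i, measurable_fun [set: T1] (fun x => f x ord0 i).
Proof.
split=> [mf i|mf].
  exact: (measurableT_comp (measurable_coord_rV i) mf).
move=> _ A mA; rewrite setTI; move: A mA.
pose C (i : 'I_n) (x : 'rV[T2]_n) : T2 := x ord0 i.
suff : g_sigma_preimage C `<=` image_set_system setT f measurable.
  by move=> S A /S; rewrite /image_set_system/= setTI.
apply: smallest_sub.
  exact/sigma_algebra_image/sigma_algebra_measurable.
rewrite -bigcup_seq; apply: bigcup_sub => i _ _ [B mB <-].
by move: (mf i measurableT _ mB); rewrite /image_set_system/= !setTI.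
Qed.

Section rV_cons.
Context {R : realType} (n : nat).

Definition rV_cons (z : measurableTypeR R * 'rV[R]_n) : 'rV[R]_n.+1 :=
  \row_i oapp (z.2 ord0) z.1 (unlift ord0 i).

Definition rV_uncons (x : 'rV[R]_n.+1) : measurableTypeR R * 'rV[R]_n :=
  (x ord0 ord0, \row_i x ord0 (lift ord0 i)).

Lemma rV_cons0 z : rV_cons z ord0 ord0 = z.1.
Proof. by rewrite mxE unlift_none. Qed.

Lemma rV_consS z i : rV_cons z ord0 (lift ord0 i) = z.2 ord0 i.
Proof. by rewrite mxE liftK. Qed.

Lemma rV_consK : cancel rV_cons rV_uncons.
Proof.
move=> [a v]; rewrite /rV_uncons rV_cons0/=; congr pair.
by apply/rowP => i; rewrite mxE rV_consS.
Qed.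

Lemma rV_unconsK : cancel rV_uncons rV_cons.
Proof.
move=> x; apply/rowP => i; case: (unliftP ord0 i) => [j ->|->].
  by rewrite rV_consS/= mxE.
by rewrite rV_cons0.
Qed.

Lemma measurable_rV_cons : measurable_fun setT rV_cons.
Proof.
apply/measurable_fun_rVP => i; case: (unliftP ord0 i) => [j ->|->].
  under eq_fun do rewrite rV_consS.
  exact: (measurableT_comp (measurable_coord_rV j) measurable_snd).
under eq_fun do rewrite rV_cons0.
exact: measurable_fst.
Qed.

Lemma measurable_rV_uncons : measurable_fun setT rV_uncons.
Proof.
apply/measurable_fun_pair; first exact: measurable_coord_rV.
apply/measurable_fun_rVP => i; under eq_fun do rewrite mxE.
exact: measurable_coord_rV.
Qed.

End rV_cons.

Section lebesgue_rV_step.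
Context {R : realType} (n : nat).
Variable m : {sigma_finite_measure set 'rV[R]_n -> \bar R}.

Definition lebesgue_rV_step : set 'rV[R]_n.+1 -> \bar R :=
  pushforward (@lebesgue_measure R \x m)%E (@rV_cons R n).

Let step0 : lebesgue_rV_step set0 = 0%E.
Proof. by rewrite /lebesgue_rV_step /pushforward preimage_set0 measure0. Qed.

Let step_ge0 A : (0 <= lebesgue_rV_step A)%E.
Proof. by rewrite /lebesgue_rV_step /pushforward measure_ge0. Qed.

Let step_sigma_additive : semi_sigma_additive lebesgue_rV_step.
Proof.
move=> F mF tF mUF; rewrite /lebesgue_rV_step /pushforward preimage_bigcup.
have mcF k : measurable (@rV_cons R n @^-1` F k).
  by rewrite -[X in measurable X]setTI; exact: measurable_rV_cons.
apply: measure_semi_sigma_additive => //; last exact: bigcup_measurable.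
apply/trivIsetP => /= i j _ _ ij; rewrite -preimage_setI.
by move/trivIsetP : tF => /(_ _ _ _ _ ij) ->//; rewrite preimage_set0.
Qed.

HB.instance Definition _ := isMeasure.Build _ _ _
  lebesgue_rV_step step0 step_ge0 step_sigma_additive.

Let step_sigma_finite : sigma_finite setT lebesgue_rV_step.
Proof.
have /sigma_finiteP[F [TF ndF Foo]] := sigma_finiteT (@lebesgue_measure R).
have /sigma_finiteP[G [TG ndG Goo]] := sigma_finiteT m.
exists (fun k => (@rV_uncons R n) @^-1` (F k `*` G k)).
  rewrite -preimage_bigcup (_ : \bigcup_k _ = setT) ?preimage_setT//.
  rewrite -setXTT TF TG predeqE => -[x y]; split.
    by move=> [k _ []/= ? ?]; split; exists k.
  move=> [/= [k _ Fkx] [l _ Gly]]; exists (maxn k l) => //; split.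
  - by move: x Fkx; exact/subsetPset/ndF/leq_maxl.
  - by move: y Gly; exact/subsetPset/ndG/leq_maxr.
move=> k; have [mFk Fkoo] := Foo k; have [mGk Gkoo] := Goo k; split.
  rewrite -[X in measurable X]setTI; apply: measurable_rV_uncons => //.
  exact: measurableX.
rewrite /lebesgue_rV_step /pushforward -comp_preimage.
rewrite (_ : _ \o _ = id) ?preimage_id; last exact/funext/rV_consK.
by rewrite product_measure1E// lte_mul_pinfty// ge0_fin_numE.
Qed.

HB.instance Definition _ := Measure_isSigmaFinite.Build _ _ _
  lebesgue_rV_step step_sigma_finite.

End lebesgue_rV_step.

(* lebesgue_rV_box below determines this measure uniquely. *)
Fixpoint lebesgue_rV {R : realType} (n : nat) :
    {sigma_finite_measure set 'rV[R]_n -> \bar R} :=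
  match n with
  | 0 => dirac (0 : 'rV[R]_0)
  | m.+1 => lebesgue_rV_step (lebesgue_rV m)
  end.

Lemma lebesgue_rV_box {R : realType} (n : nat) (A : 'I_n -> set R) :
  (forall i, measurable (A i)) ->
  lebesgue_rV n [set x | forall i, A i (x ord0 i)] =
  (\prod_(i < n) lebesgue_measure (A i))%E.
Proof.
elim: n A => [|n IH] A mA.
  by rewrite big_ord0 /= diracE mem_set//= => -[].
rewrite big_ord_recl -IH//.
rewrite -[LHS]/((@lebesgue_measure R \x lebesgue_rV n)%E
  (@rV_cons R n @^-1` [set x | forall i, A i (x ord0 i)])).
have -> : @rV_cons R n @^-1` [set x | forall i, A i (x ord0 i)] =
    A ord0 `*` [set x : 'rV[R]_n | forall i, A (lift ord0 i) (x ord0 i)].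
  apply/seteqP; split=> [[a v]/= H|[a v]/= [H0 HS] i].
    by split=> [|i]; [move: (H ord0); rewrite rV_cons0|
      move: (H (lift ord0 i)); rewrite rV_consS].
  by case: (unliftP ord0 i) => [j ->|->]; rewrite ?rV_consS ?rV_cons0.
apply: product_measure1E; first exact: mA.
rewrite [X in measurable X](_ : _ = \bigcap_(i in [set: 'I_n])
    (fun x : 'rV[R]_n => x ord0 i) @^-1` A (lift ord0 i)); last first.
  by apply/seteqP; split=> x /= H i => [_|]; exact: H.
apply: fin_bigcap_measurable => // i _; rewrite -[X in measurable X]setTI.
exact: measurable_coord_rV.
Qed.

Section function_spaces.
Context {R : realType} {n : nat}.
Local Notation V := 'rV[R]_n.
Local Notation mu := (@lebesgue_rV R n).
Implicit Types (f g : V -> R) (s : seq 'I_n).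

(* Measurability is Lebesgue measurability: the measurable sets of V are the
   Borel sets, so f is only required to agree a.e. with a Borel function. *)
Definition lebesgue_measurable f :=
  exists2 g, measurable_fun setT g & f = g %[ae mu].

Definition in_Lp (p : \bar R) f :=
  exists2 g, g \in Lfun mu p & f = g %[ae mu].

Definition in_Lvar (r : V -> R) f :=
  lebesgue_measurable f /\
  exists2 c : R, 0 < c & (\int[mu]_x (`|c * f x| `^ r x)%:E < +oo)%E.

Definition partial (i : 'I_n) f : V -> R := 'D_(delta_mx ord0 i) f.

(* s lists the variables of differentiation, with repetitions. *)
Definition partials s f : V -> R := foldr partial f s.

Definition smooth f := forall s, continuous (partials s f) /\
  forall i x, derivable (partials s f) x (delta_mx ord0 i).

Definition test_function f :=
  smooth f /\ compact (closure [set x | f x != 0]).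

Definition weak_partials s f g := forall psi, test_function psi ->
  \int[mu]_x (f x * partials s psi x) =
  (-1) ^+ size s * \int[mu]_x (g x * psi x).

Definition in_H2 f := in_Lp 2%:E f /\
  forall s, (size s <= 2)%N -> exists2 g, in_Lp 2%:E g & weak_partials s f g.

Definition is_laplacian f l := exists h : 'I_n -> V -> R,
  [/\ forall i, in_Lp 2%:E (h i),
      forall i, weak_partials [:: i; i] f (h i) &
      l = (fun x => \sum_i h i x) %[ae mu]].

Definition dot (x y : V) : R := \sum_i x ord0 i * y ord0 i.

(* The library norm on 'rV[R]_n is the sup norm. *)
Definition enorm (x : V) : R := Num.sqrt (dot x x).

(* \int f(x) e^(-i x.xi) dx. The factor (2 pi)^(-n/2) of the unitary convention
   is irrelevant to Fourier multipliers and is omitted. *)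
Definition fourier_integral f (xi : V) : R[i] :=
  Complex (\int[mu]_x (f x * cos (dot x xi)))
          (- \int[mu]_x (f x * sin (dot x xi))).

(* F is the Fourier transform of f in the sense of L^2: the graph of the L^2
   transform is the closure, in L^2 x L^2, of that of the Fourier integral on
   L^1 `&` L^2. *)
Definition is_fourier f (F : V -> R[i]) :=
  [/\ in_Lp 2%:E f,
      in_Lp 2%:E (fun xi => complex.Re (F xi)),
      in_Lp 2%:E (fun xi => complex.Im (F xi)) &
      exists f_ : nat -> V -> R,
        [/\ forall k, in_Lp 1%:E (f_ k) /\ in_Lp 2%:E (f_ k),
            ('N[mu]_2%:E [EFin \o (f_ k \- f)%R])%E @[k --> \oo] --> 0%E &
            ('N[mu]_2%:E [EFin \o @Normc.normc R \o (fourier_integral (f_ k) \- F)%R])%E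
              @[k --> \oo] --> 0%E]].

(* g = (-Delta)^s f, as the Fourier multiplier |xi|^(2 s). *)
Definition is_fractional_laplacian (s : R) f g :=
  exists2 F, is_fourier f F &
    is_fourier g (fun xi => real_complex R (enorm xi `^ (2 * s)) * F xi).

(* (-Delta)^(alpha/2) phi and Delta phi are defined up to null sets; g and l
   range over their representatives. *)
Definition weak_solution (alpha lambda : R) (p u : V -> R) :=
  [/\ in_Lp 2%:E u, in_Lvar (fun x => 2 * p x) u &
    forall phi g l : V -> R,
      in_H2 phi -> (\forall x \ae mu, 0 <= phi x) ->
      is_fractional_laplacian (alpha / 2) phi g -> is_laplacian phi l ->
      (\int[mu]_x (`|u x| `^ p x * phi x)%:E <=
       \int[mu]_x (u x * g x)%:E + lambda%:E * \int[mu]_x (u x * l x)%:E)%E].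

End function_spaces.

Definition critical_exponent {R : realType} (N : nat) (alpha : R) : \bar R :=
  if N%:R <= alpha then +oo%E else (N%:R / (N%:R - alpha))%:E.

(* Main.v *)
(* Test the inequality against phi_T = \int weight(t) p_(T t) dt, a mixture of heat
   kernels p_t with weight(t) = t^(-1-s) (1 - 1/t) on t > 1, where s = alpha / 2.
   Subordination gives |xi|^(2 s) as a multiple of \int (1 - e^(- r |xi|^2)) r^(-1-s) dr;
   under the Laplace transform in t this moves the fractional Laplacian onto the
   weight, so (-Delta)^s phi_T is again a mixture of heat kernels, whose weight is
   O(T^(-s) t^(-1-s)).  Hence |(-Delta)^s phi_T| and |Delta phi_T| are both at most
   C T^(-s) phi_T pointwise, and a solution satisfies
     \int |u|^p phi_T <= A \int |u| phi_T   with A = O(T^(-s)).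
   Young's inequality absorbs the right-hand side, leaving
   \int |u|^p phi_T = O(T^(-s P / (P - 1))) with P = ess sup p.  As phi_T is at least
   c T^(-N/2) on the ball of radius sqrt T, and N / 2 < s P / (P - 1) below the critical
   exponent, T -> oo gives \int |u|^p = 0. *)

From HB Require Import structures.
Require Import Defs.
From mathcomp Require Import all_boot all_order all_algebra.
From mathcomp Require Import all_classical all_reals all_analysis.
From mathcomp Require Import ess_sup_inf measurable_realfun normal_distribution.
From mathcomp Require Import complex ring lra.

Set Implicit Arguments.
Unset Strict Implicit.
Unset Printing Implicit Defensive.

Import Order.TTheory GRing.Theory Num.Theory.
Import numFieldNormedType.Exports.

Local Open Scope classical_set_scope.
Local Open Scope ring_scope.

(** A compactly supported cutoff cannot serve as test function: outside its support its fractional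
    Laplacian is nonzero, with a tail of order |x|^(-N-2s), so no pointwise bound by the cutoff
    itself holds. The exponent -1-s of the weight answers this. The fractional operator acts on the
    weight through the integral of (w(t) - w(t-r)) r^(-1-s) over r > 0, and for large t this
    remembers the mass of w with size t^(-1-s); a weight decaying faster would be beaten by this
    term. Near t = 1 the weight vanishes like t - 1 while its image is only of order (t-1)^(1-s), so
    the two are not comparable there. The bounds therefore pass through the untapered tail and
    through heat kernels at doubled time: the substitution t -> t/2 moves the tail to t > 2, where
    the taper costs a factor 2 only. The same doubling absorbs the polynomial factors that
    differentiation of a Gaussian produces. All bounds are pointwise and in absolute value, which is
    why neither a sign of u nor a sign of lambda is asked for. *)

(** * Integrals of functions known only almost everywhere, and integrability by domination *)

Section integral_tools.
Context d (T : measurableType d) (R : realType).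
Variable mu : {measure set T -> \bar R}.

Import HBNNSimple.

(** The integral of a nonnegative function is a supremum over the simple functions below it,
    measurable or not. Cutting such a simple function off on the exceptional null set keeps its
    integral and puts it below [g]. *)
Lemma ae_le_ge0_integral (f g : T -> \bar R) :
  (forall x, 0 <= f x)%E -> (forall x, 0 <= g x)%E ->
  f = g %[ae mu] -> (\int[mu]_x f x <= \int[mu]_x g x)%E.
Proof.
move=> f0 g0 [N [mN N0 fgN]].
rewrite ge0_integralTE// [leRHS]ge0_integralTE//.
apply: ge_ereal_sup => _ [h /= hf <-].
pose h' : {nnsfun T >-> R} := mul_nnsfun h (indic_nnsfun R (measurableC mN)).
have h'E x : h' x = h x * \1_(~` N) x by [].
apply: le_ereal_sup_tmp; exists (sintegral mu h').
  exists h' => // x; rewrite h'E indicE.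
  have [xN|_] := boolP (x \in ~` N); last by rewrite mulr0.
  rewrite mulr1 (le_trans (hf x))//.
  have -> // : f x = g x.
  by apply: contrapT => H; apply: (set_mem xN); apply: fgN => /= /(_ Logic.I).
rewrite -!integralT_nnsfun le_eqVlt; apply/orP; left; apply/eqP.
apply: ge0_ae_eq_integral => //.
- exact/measurable_EFinP.
- exact/measurable_EFinP.
- by move=> x _; rewrite lee_fin.
- by move=> x _; rewrite lee_fin mulr_ge0.
exists N; split => //= x /= xh; apply: contrapT => xN; apply: xh => _.
by rewrite -[RHS]/((h' x)%:E) h'E indicE mem_set// mulr1.
Qed.

(** Serves where a function is controlled only up to a null set: the solution and the exponent,
    which merely agree almost everywhere with Borel functions, and the inner integrals of Fubini's
    theorem. *)
Lemma ae_eq_integral_nomeas (f g : T -> \bar R) :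
  f = g %[ae mu] -> (\int[mu]_x f x = \int[mu]_x g x)%E.
Proof.
move=> fg; have gf : g = f %[ae mu] by exact: ae_eq_sym.
have [/(_ fg) [fgp fgn] _] := ae_eq_funeposneg mu setT f g.
have [/(_ gf) [gfp gfn] _] := ae_eq_funeposneg mu setT g f.
rewrite integralE [RHS]integralE; congr (_ - _)%E.
  by apply/eqP; rewrite eq_le !ae_le_ge0_integral.
by apply/eqP; rewrite eq_le !ae_le_ge0_integral.
Qed.

Implicit Types f g : T -> R.

Lemma integrable_dom f g : measurable_fun setT f -> (forall x, `|f x| <= g x) ->
  mu.-integrable setT (EFin \o g) -> mu.-integrable setT (EFin \o f).
Proof.
move=> mf fg; apply: le_integrable => //; first exact/measurable_EFinP.
by move=> x _; rewrite /= lee_fin (le_trans (fg x))// ler_norm.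
Qed.

Lemma integrableZR (k : R) f : mu.-integrable setT (EFin \o f) ->
  mu.-integrable setT (EFin \o (fun x => k * f x)).
Proof.
move=> intf; rewrite [X in _.-integrable _ X](_ : _ = (fun x => k%:E * (EFin \o f) x)%E).
  exact: integrableZl.
by apply/funext => x /=; rewrite EFinM.
Qed.

Lemma integrableDR f g : mu.-integrable setT (EFin \o f) ->
  mu.-integrable setT (EFin \o g) -> mu.-integrable setT (EFin \o (fun x => f x + g x)).
Proof.
move=> intf intg.
rewrite [X in _.-integrable _ X](_ : _ = (EFin \o f) \+ (EFin \o g))%E//.
exact: integrableD.
Qed.

Lemma integrableBR f g : mu.-integrable setT (EFin \o f) ->
  mu.-integrable setT (EFin \o g) -> mu.-integrable setT (EFin \o (fun x => f x - g x)).
Proof.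
move=> intf intg.
rewrite [X in _.-integrable _ X](_ : _ = (EFin \o f) \- (EFin \o g))%E//.
exact: integrableB.
Qed.

Lemma integrable_normR f : mu.-integrable setT (EFin \o f) ->
  mu.-integrable setT (EFin \o (fun x => `|f x|)).
Proof. by move=> /integrable_abse. Qed.

Lemma EFin_Rintegral f : mu.-integrable setT (EFin \o f) ->
  (\int[mu]_x f x)%:E = (\int[mu]_x (f x)%:E)%E.
Proof. by move=> intf; rewrite /Rintegral fineK//; exact: integrable_fin_num intf. Qed.

Lemma integrable_ge0_fin f : measurable_fun setT f -> (forall x, 0 <= f x) ->
  (\int[mu]_x (f x)%:E < +oo)%E -> mu.-integrable setT (EFin \o f).
Proof.
move=> mf f0 foo; apply/integrableP; split; first exact/measurable_EFinP.
by rewrite (eq_integral (fun x => (f x)%:E))// => x _; rewrite /= ger0_norm.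
Qed.
End integral_tools.

(** * Affine changes of variable on the line *)

Section lebesgue_R.
Context {R : realType}.
Local Notation leb := (@lebesgue_measure R).

Definition affine (a c : R) : measurableTypeR R -> measurableTypeR R :=
  fun x => a * x + c.

Lemma measurable_affine a c : measurable_fun setT (affine a c).
Proof. by apply: measurable_funD => //; apply: measurable_funM. Qed.

(** The right-hand side is a measure that agrees with Lebesgue measure on half-open intervals, and
    these determine it. *)
Lemma lebesgue_measure_affine (a c : R) (A : set R) : 0 < a -> measurable A ->
  leb A = (a%:E * pushforward leb (affine a c) A)%E.
Proof.
move=> a0 mA; have a0' : 0 <= a by exact: ltW.
apply: (@lebesgue_measure_unique R
  (mscale (NngNum a0') (pushforward leb (affine a c)))) => //.
  exact: measurable_affine.
move=> mF _ [[x y]] _ <-.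
rewrite /= /mscale/= /pushforward.
have -> : affine a c @^-1` [set` `]x, y]] = [set` `](x - c) / a, (y - c) / a]].
  apply/seteqP; split => t; rewrite /= !in_itv/= /affine.
    by rewrite ltr_pdivrMr// ler_pdivlMr// ltrBlDr lerBrDr mulrC.
  by rewrite ltr_pdivrMr// ler_pdivlMr// ltrBlDr lerBrDr mulrC.
rewrite !lebesgue_measure_itv/= !lte_fin ltr_pM2r ?invr_gt0// ltrD2r.
case: ifPn => _; last by rewrite mule0.
by rewrite -!EFinD -EFinM; congr EFin; field; rewrite gt_eqF.
Qed.

Lemma ge0_integral_affine (a c : R) (f : R -> \bar R) : 0 < a ->
  measurable_fun setT f -> (forall x, 0 <= f x)%E ->
  (\int[leb]_x f x = a%:E * \int[leb]_x f (a * x + c)%R)%E.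
Proof.
move=> a0 mf f0; have a0' : 0 <= a by exact: ltW.
have -> : (\int[leb]_x f (a * x + c)%R =
           \int[pushforward leb (affine a c)]_x f x)%E.
  by rewrite (ge0_integral_pushforward (measurable_affine a c) leb measurableT mf).
rewrite -(@ge0_integral_mscale _ _ _ _ setT measurableT (NngNum a0'))//.
  exact: measurable_affine.
move=> mF; apply: eq_measure_integral => /= A mA _; exact: lebesgue_measure_affine.
Qed.

Lemma ge0_integral_opp (f : R -> \bar R) :
  measurable_fun setT f -> (forall x, 0 <= f x)%E ->
  (\int[leb]_x f x = \int[leb]_x f (- x)%R)%E.
Proof.
move=> mf f0.
transitivity (\int[pushforward leb (-%R : _ -> measurableTypeR R)]_x f x)%E.
  by apply: eq_measure_integral => /= A mA _; rewrite lebesgue_measureN.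
by rewrite ge0_integral_pushforward//.
Qed.

Lemma integral_opp (f : R -> \bar R) : measurable_fun setT f ->
  (\int[leb]_x f x = \int[leb]_x f (- x)%R)%E.
Proof.
move=> mf; rewrite integralE [RHS]integralE; congr (_ - _)%E.
  by rewrite (funepos_comp _ -%R) ge0_integral_opp//; exact: measurable_funepos.
by rewrite (funeneg_comp _ -%R) ge0_integral_opp//; exact: measurable_funeneg.
Qed.

End lebesgue_R.

(** * Fubini's theorem for real-valued integrals *)

Section fubini_R.
Context d1 d2 (X : measurableType d1) (Y : measurableType d2) (R : realType).
Variables (m1 : {sigma_finite_measure set X -> \bar R})
          (m2 : {sigma_finite_measure set Y -> \bar R}).

(** The inner real integral is the extended one wherever the section is integrable, that is, for
    almost every [x]; elsewhere [fine] may change the value, on a null set only. *)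
Lemma Rintegral12_prod (f : X * Y -> R) :
  (m1 \x m2)%E.-integrable setT (EFin \o f) ->
  \int[m1]_x \int[m2]_y f (x, y) = \int[(m1 \x m2)%E]_z f z.
Proof.
move=> imf; rewrite [RHS]/Rintegral -integral12_prod_meas1//.
rewrite /Rintegral; congr fine.
apply: ae_eq_integral_nomeas.
have := ae_integrable1 imf; apply: filterS => x /= ix _.
by rewrite fineK//; exact: integrable_fin_num ix.
Qed.

Lemma Rintegral21_prod (f : X * Y -> R) :
  (m1 \x m2)%E.-integrable setT (EFin \o f) ->
  \int[m2]_y \int[m1]_x f (x, y) = \int[(m1 \x m2)%E]_z f z.
Proof.
move=> imf; rewrite [RHS]/Rintegral -integral21_prod_meas1//.
rewrite /Rintegral; congr fine.
apply: ae_eq_integral_nomeas.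
have := ae_integrable2 imf; apply: filterS => x /= ix _.
by rewrite fineK//; exact: integrable_fin_num ix.
Qed.

Lemma RFubini (f : X * Y -> R) :
  (m1 \x m2)%E.-integrable setT (EFin \o f) ->
  \int[m1]_x \int[m2]_y f (x, y) = \int[m2]_y \int[m1]_x f (x, y).
Proof. by move=> imf; rewrite Rintegral12_prod// Rintegral21_prod. Qed.

End fubini_R.

(** * Splitting off the first coordinate in integrals over row vectors *)

Section rV_integral.
Context {R : realType} (n : nat).
Local Notation leb := (@lebesgue_measure R).

Lemma ge0_integral_rVS (f : 'rV[R]_n.+1 -> \bar R) :
  measurable_fun setT f -> (forall x, 0 <= f x)%E ->
  (\int[lebesgue_rV n.+1]_x f x =
   \int[leb]_a \int[lebesgue_rV n]_v f (rV_cons (a, v)))%E.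
Proof.
move=> mf f0.
have mfc : measurable_fun setT (f \o (@rV_cons R n)).
  by apply: measurableT_comp => //; exact: measurable_rV_cons.
rewrite -(@fubini_tonelli1 _ _ _ _ _ leb (lebesgue_rV n) (f \o (@rV_cons R n)))//; last first.
  by move=> x; exact: f0.
by rewrite -(ge0_integral_pushforward (@measurable_rV_cons R n) _ measurableT mf)// => x; exact: f0.
Qed.

Lemma integrable_rVS (f : 'rV[R]_n.+1 -> \bar R) : measurable_fun setT f ->
  (lebesgue_rV n.+1).-integrable setT f <->
  (leb \x lebesgue_rV n)%E.-integrable setT (f \o (@rV_cons R n)).
Proof.
move=> mf.
have mfc : measurable_fun setT (f \o (@rV_cons R n)).
  by apply: measurableT_comp => //; exact: measurable_rV_cons.
have E : (\int[lebesgue_rV n.+1]_x `|f x| =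
   \int[leb \x lebesgue_rV n]_z `|(f \o (@rV_cons R n)) z|)%E.
  rewrite -(ge0_integral_pushforward (@measurable_rV_cons R n) (leb \x lebesgue_rV n)%E measurableT (f := abse \o f))//.
    exact: measurableT_comp.
  by move=> y _; exact: abse_ge0.
split => /integrableP[_ foo]; apply/integrableP; split => //.
  by rewrite -E.
by rewrite E.
Qed.

Lemma Rintegral_rVS (f : 'rV[R]_n.+1 -> R) :
  (lebesgue_rV n.+1).-integrable setT (EFin \o f) ->
  \int[lebesgue_rV n.+1]_x f x =
  \int[(leb \x lebesgue_rV n)%E]_z f (rV_cons z).
Proof.
move=> intf; have mf := measurable_int _ intf.
rewrite /Rintegral; congr fine.
rewrite -(integral_pushforward (@measurable_rV_cons R n) (D := setT) (f := EFin \o f))//.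
exact/(integrable_rVS mf).
Qed.
End rV_integral.

(** * Open sets are measurable for the sigma-algebra of the coordinates *)

Section continuous_measurable.
Context {R : realType} (n : nat).

Let box (q : 'I_n -> rat) (k : nat) : set 'rV[R]_n :=
  [set x | forall i, x ord0 i \in `]ratr (q i) - k.+1%:R^-1, ratr (q i) + k.+1%:R^-1[].

Let measurable_box q k : measurable (box q k).
Proof.
have -> : box q k = \bigcap_(i in [set: 'I_n]) ((fun x : 'rV[R]_n => x ord0 i) @^-1`
    [set` `]ratr (q i) - k.+1%:R^-1, ratr (q i) + k.+1%:R^-1[]).
  by apply/seteqP; split => x /= H i; [move=> _|]; exact: H.
apply: fin_bigcap_measurable => // i _; rewrite -[X in measurable X]setTI.
exact: measurable_coord_rV.
Qed.

(** An open set is the union of the countably many boxes with rational centre and radius [1/(k+1)]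
    that it contains. *)
Lemma open_measurable_rV (U : set 'rV[R]_n) : open U -> measurable U.
Proof.
move=> oU.
have -> : U = \bigcup_(p in [set p : {ffun 'I_n -> rat} * nat | box p.1 p.2 `<=` U])
    box p.1 p.2.
  apply/seteqP; split => [x Ux|x [p /= pU] /pU//].
  have /nbhs_ballP[e /= e0 eU] := open_nbhs_nbhs (conj oU Ux).
  (* With [r = 1/(k+1) < e/2], a box whose rational centre is within [r] of [x] contains [x] and
     stays within [2 r < e] of it in the sup norm. *)
  have [k ke] : exists k : nat, k.+1%:R^-1 < e / 2.
    exists (Num.truncn (e / 2)^-1).
    by rewrite invf_plt ?posrE ?divr_gt0// ?ltr0n// truncnS_gt.
  have qP i : exists q : rat, x ord0 i - k.+1%:R^-1 < ratr q < x ord0 i + k.+1%:R^-1.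
    have [|q] := @rat_in_itvoo R (x ord0 i - k.+1%:R^-1) (x ord0 i + k.+1%:R^-1).
      by rewrite ltrD2l (@lt_trans _ _ 0)// ?oppr_lt0 invr_gt0 ltr0n.
    by exists q.
  have /choice[q Hq] := qP.
  exists ([ffun i => q i], k) => /=.
    move=> y /= Hy; apply: eU; rewrite -ball_normE/= /ball_/=.
    apply: (@le_lt_trans _ _ (2 * k.+1%:R^-1)); last by rewrite -ltr_pdivlMl// mulrC.
    rewrite [leLHS]mx_normrE; apply: bigmax_le => [|[i j] _].
      by rewrite mulr_ge0// invr_ge0.
    rewrite !mxE/= (ord1 i).
    have := Hy j; rewrite ffunE in_itv/= => /andP[y1 y2].
    have /andP[x1 x2] := Hq j.
    change (`|x ord0 j - y ord0 j| <= 2 * k.+1%:R^-1).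
    move: (k.+1%:R^-1) y1 y2 x1 x2 => r y1 y2 x1 x2.
    by rewrite ler_norml; apply/andP; split; lra.
  move=> i; rewrite ffunE in_itv/=.
  have /andP[x1 x2] := Hq i.
  move: (k.+1%:R^-1) x1 x2 => r x1 x2.
  by apply/andP; split; lra.
rewrite bigcup_mkcond; apply: countable_bigcupT_measurable => // p.
by case: ifP.
Qed.

Lemma continuous_measurable_rV (f : 'rV[R]_n -> R) :
  continuous f -> measurable_fun setT f.
Proof.
move=> cf; apply: (measurability _ (RGenOpens.measurableE R)) => _ [_ [a [b ->]] <-].
rewrite setTI; apply: open_measurable_rV; apply: open_comp => //.
Qed.
End continuous_measurable.

(** * The integral of a partial derivative vanishes *)

Section integral_partial.
Context {R : realType}.
Local Notation leb := (@lebesgue_measure R).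

Lemma integral_derive1_compact (F G : R -> R) (M : R) :
  (forall x : R, is_derive x 1 F (G x)) -> continuous G ->
  (forall x, M <= `|x| -> F x = 0) -> \int[leb]_x G x = 0.
Proof.
move=> dF cG F0.
wlog M0 : M F0 / 0 < M.
  move=> /(_ (Num.max M 1)); apply; last by rewrite lt_max ltr01 orbT.
  by move=> x; rewrite ge_max => /andP[/F0].
(* The margin 1 around [[-M, M]] leaves a whole neighbourhood of [x] on which [F] is zero, hence a
   zero derivative. *)
have G0 x : ~ [set` `[(- M - 1), M + 1]] x -> G x = 0.
  rewrite /= in_itv/= => /negP; rewrite negb_and -!ltNge => xM.
  have <- := @derive_val _ _ _ _ _ _ _ (dF x).
  rewrite (@near_eq_derive _ _ _ F (cst 0))//; first by rewrite derive_cst.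
  near=> y; apply: F0.
  have : `|x - y| < 1 by near: y; exact: cvgr_dist_lt.
  rewrite ltr_norml => /andP[? ?]; case/orP: xM => ?.
    by rewrite ler_normr; apply/orP; right; lra.
  by rewrite ler_normr; apply/orP; left; lra.
have MM : - M - 1 < M + 1 by lra.
rewrite /Rintegral.
have -> : (\int[leb]_x (G x)%:E = \int[leb]_(x in [set` `[(- M - 1)%R, (M + 1)%R]]) (G x)%:E)%E.
  rewrite [RHS]integral_mkcond; apply: eq_integral => x _.
  rewrite patchE; case: ifPn => //; rewrite notin_setE => /G0 ->//.
rewrite (@continuous_FTC2 _ G F)//.
- by rewrite !F0 ?subee//; rewrite ler_normr; apply/orP; [right|left]; lra.
- exact: continuous_subspaceT.
- have cF : continuous F.
    by move=> x; apply: differentiable_continuous; apply/derivable1_diffP; exact: ex_derive.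
  split.
  + by move=> x _; exact: ex_derive.
  + exact/cvg_at_right_filter/cF.
  + exact/cvg_at_left_filter/cF.
- by move=> x _; rewrite derive1E; exact: derive_val.
Unshelve. all: end_near. Qed.

(** A directional derivative sees the function along one line only, so lines in two different spaces
    can be matched. This carries derivatives from row vectors to slices and to the real line. *)
Lemma is_derive_congr (V W : normedModType R) (f : V -> R) (F : W -> R)
    (x e : V) (y e' : W) (d : R) :
  (forall h, f (h *: e + x) = F (h *: e' + y)) ->
  is_derive y e' F d -> is_derive x e f d.
Proof.
move=> fF [dF vF].
have fxFy : f x = F y by have := fF 0; rewrite !scale0r !add0r.
have E : (fun h : R => h^-1 *: (f (h *: e + x) - f x)) =
   (fun h : R => h^-1 *: (F (h *: e' + y) - F y)).
  by apply/funext => h; rewrite fF fxFy.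
apply: DeriveDef.
  by rewrite /derivable E.
by rewrite /derive E.
Qed.

Lemma rV_consE n a (v : 'rV[R]_n) :
  rV_cons (a, v) = rV_cons (0, v) + a *: delta_mx ord0 ord0.
Proof.
apply/rowP => i; rewrite !mxE /=; case: unliftP => [j ->|->] /=.
  by rewrite mulr0 addr0.
by rewrite add0r mulr1.
Qed.

Lemma rV_cons_lift n a (v : 'rV[R]_n) h j :
  rV_cons (a, v + h *: delta_mx ord0 j) =
  rV_cons (a, v) + h *: delta_mx ord0 (lift ord0 j).
Proof.
apply/rowP => i; rewrite !mxE /=; case: unliftP => [k ->|->] /=.
  by rewrite !mxE (inj_eq (@lift_inj _ _)).
by rewrite mulr0 addr0.
Qed.

(** Induction on the dimension with Fubini. If [i] is the first coordinate, it is integrated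
    innermost and the one-dimensional case applies; otherwise the first coordinate is frozen, and
    the induction hypothesis applies to the slices that are integrable, which almost all are. *)
Lemma integral_partial_eq0 n (i : 'I_n) (F G : 'rV[R]_n -> R) (M : R) :
  (lebesgue_rV n).-integrable setT (EFin \o G) ->
  (forall x, is_derive x (delta_mx ord0 i : 'rV[R]_n) F (G x)) ->
  (forall x, continuous (fun h : R => G (x + h *: delta_mx ord0 i))) ->
  (forall x : 'rV[R]_n, M <= `|x ord0 i| -> F x = 0) ->
  \int[lebesgue_rV n]_x G x = 0.
Proof.
elim: n i F G M => [[]//|n IH] i F G M intG dF cG F0.
rewrite Rintegral_rVS//.
have intG' : (leb \x lebesgue_rV n)%E.-integrable setT
    (EFin \o (fun z => G (rV_cons z))).
  exact/(integrable_rVS (measurable_int _ intG)).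
case: (unliftP ord0 i) => [j ij|i0]; subst i.
  rewrite -Rintegral12_prod//.
  rewrite /Rintegral (@ae_eq_integral_nomeas _ _ _ _ _ (cst 0%E)) ?integral0//.
  have := ae_integrable1 intG'; apply: filterS => a /= ia _.
  congr EFin; apply: (IH j (fun v => F (rV_cons (a, v))) _ M) => //.
  - move=> v; apply: is_derive_congr (dF (rV_cons (a, v))) => h /=.
    by rewrite addrC rV_cons_lift addrC.
  - move=> v; under eq_fun do rewrite rV_cons_lift.
    exact: cG.
  - by move=> v; rewrite -(rV_consS (a, v)); exact: F0.
rewrite -Rintegral21_prod//.
rewrite /Rintegral (eq_integral (cst 0%E)) ?integral0// => v _ /=.
congr EFin; apply: (@integral_derive1_compact (fun a => F (rV_cons (a, v))) _ M).
- move=> a; apply: is_derive_congr (dF (rV_cons (a, v))) => h /=.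
  rewrite rV_consE (rV_consE a) addrCA -scalerDl; congr (F (_ + _ *: _)).
  by rewrite [h *: 1]mulr1.
- by have := cG (rV_cons (0, v)); under eq_fun do rewrite -rV_consE.
- by move=> a; rewrite -[X in `|X|](rV_cons0 (a, v)); exact: F0.
Qed.
End integral_partial.

(** * The one-dimensional heat kernel and its Fourier transform *)

Section gauss1.
Context {R : realType}.
Local Notation leb := (@lebesgue_measure R).
Implicit Types t y xi : R.

Definition heat1 t y : R := (Num.sqrt (4 * pi * t))^-1 * expR (- (y ^+ 2 / (4 * t))).

Lemma heat1E t : 0 < t -> heat1 t = normal_pdf 0 (Num.sqrt (2 * t)).
Proof.
move=> t0; apply/funext => y.
rewrite normal_pdfE ?gt_eqF ?sqrtr_gt0 ?mulr_gt0//.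
rewrite -[RHS]/(normal_peak _ * normal_fun _ _ _) /normal_peak /normal_fun.
rewrite sqr_sqrtr ?mulr_ge0 ?ltW// /heat1 subr0; congr ((Num.sqrt _)^-1 * expR _).
  by rewrite -mulr_natr; ring.
by rewrite mulNr -mulr_natr; congr (- (_ / _)); ring.
Qed.

Lemma heat1_ge0 t y : 0 <= heat1 t y.
Proof. by rewrite mulr_ge0 ?invr_ge0 ?expR_ge0. Qed.

Lemma heat1N t y : heat1 t (- y) = heat1 t y.
Proof. by rewrite /heat1 sqrrN. Qed.

Lemma continuous_heat1 t : 0 < t -> continuous (heat1 t).
Proof.
by move=> t0; rewrite heat1E//; apply: continuous_normal_pdf; rewrite gt_eqF ?sqrtr_gt0 ?mulr_gt0.
Qed.

Lemma measurable_heat1 t : 0 < t -> measurable_fun setT (heat1 t).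
Proof. by move=> t0; apply: continuous_measurable_fun; exact: continuous_heat1. Qed.

Lemma integral_heat1 t : 0 < t -> (\int[leb]_y (heat1 t y)%:E = 1)%E.
Proof. by move=> t0; rewrite heat1E// integral_normal_pdf. Qed.

Lemma integrable_heat1 t : 0 < t -> leb.-integrable setT (EFin \o heat1 t).
Proof. by move=> t0; rewrite heat1E//; exact: integrable_normal_pdf. Qed.

(** Half of the Gaussian exponent is split off and absorbs [1 + y^2] through [1 + z <= e^z] with
    [z = y^2/(8 t)]; [sqrt 2] is the ratio of the two normalisations. *)
Lemma heat1_bound t y : 0 < t ->
  (1 + y ^+ 2) * heat1 t y <= (1 + 8 * t) * Num.sqrt 2 * heat1 (2 * t) y.
Proof.
move=> t0; rewrite /heat1.
have -> : 4 * pi * (2 * t) = 2 * (4 * pi * t) by ring.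
have -> : - (y ^+ 2 / (4 * t)) = - (y ^+ 2 / (4 * (2 * t))) - (y ^+ 2 / (8 * t)).
  by field; rewrite gt_eqF.
rewrite [Num.sqrt (2 * _)]sqrtrM// expRD (expRN (y ^+ 2 / (8 * t))).
set S := Num.sqrt (4 * pi * t); set E1 := expR _; set E := expR (_ / _).
have S2 : Num.sqrt 2 != 0 :> R by rewrite sqrtr_eq0 -ltNge.
have S0 : 0 < S by rewrite sqrtr_gt0 !mulr_gt0// pi_gt0.
have E10 : 0 < E1 by exact: expR_gt0.
have E0 : 0 < E by exact: expR_gt0.
have HE : 1 + y ^+ 2 / (8 * t) <= E := expR_ge1Dx _.
have HE1 : 1 <= E by rewrite (le_trans _ HE)// lerDl divr_ge0 ?sqr_ge0// mulr_ge0// ltW.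
have HE2 : y ^+ 2 <= 8 * t * E.
  by rewrite -ler_pdivrMl ?mulr_gt0// (le_trans _ HE)// mulrC lerDr.
have -> : (1 + y ^+ 2) * (S^-1 * (E1 / E)) = (1 + y ^+ 2) / E * (S^-1 * E1) by ring.
have -> : (1 + 8 * t) * Num.sqrt 2 * ((Num.sqrt 2 * S)^-1 * E1) = (1 + 8 * t) * (S^-1 * E1).
  by rewrite invfM; field; rewrite S2 gt_eqF.
have SE : 0 <= S^-1 * E1 by rewrite mulr_ge0 ?invr_ge0 ?ltW.
rewrite ler_wpM2r// ler_pdivrMr//.
by rewrite mulrDl mul1r lerD.
Qed.

(** A crude decay at the integers, from [1 + z <= e^z]: the boundary terms of the fundamental
    theorem of calculus on [[-(n+1), n+1]] are then bounded by a multiple of the harmonic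
    sequence. *)
Lemma heat1_harmonic t (n : nat) : 0 < t ->
  heat1 t n.+1%:R <= (Num.sqrt (4 * pi * t))^-1 * (4 * t * n.+1%:R^-1).
Proof.
move=> t0; rewrite /heat1 ler_wpM2l ?invr_ge0// expRN.
have n0 : 0 < n.+1%:R :> R by rewrite ltr0n.
have n1 : 1 <= n.+1%:R :> R by rewrite ler1n.
rewrite -[4 * t / _]invrK lef_pV2 ?posrE ?expR_gt0 ?invr_gt0 ?divr_gt0 ?mulr_gt0//.
apply: le_trans (expR_ge1Dx _).
rewrite invf_div (@le_trans _ _ (n.+1%:R ^+ 2 / (4 * t)))//; last by rewrite lerDr.
by rewrite ler_pM2r ?invr_gt0 ?mulr_gt0// expr2 ler_peMr// ltW.
Qed.

Lemma is_derive_heat1 t y : 0 < t ->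
  is_derive (y : R) 1 (heat1 t) (- (y / (2 * t)) * heat1 t y).
Proof.
move=> t0.
have D : is_derive (y : R) 1 (fun y : R => - (y ^+ 2 / (4 * t))) (- (y / (2 * t))).
  have -> : (fun y : R => - (y ^+ 2 / (4 * t))) = (fun y : R => (- (4 * t)^-1) *: (y ^+ 2)).
    by apply/funext => z; rewrite /GRing.scale/=; ring.
  apply: is_derive_eq.
  by rewrite /GRing.scale/=; field; rewrite gt_eqF.
have D2 := @is_derive1_comp _ expR (fun y : R => - (y ^+ 2 / (4 * t))) y _ _ (is_derive_expR _) D.
have := is_deriveZ (Num.sqrt (4 * pi * t))^-1 D2.
rewrite [X in is_derive _ _ X _](_ : _ = heat1 t)//.
by move/is_derive_eq; apply; rewrite /GRing.scale/= /heat1; ring.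
Qed.

Lemma integrable_poly_heat1 t (f : R -> R) (C : R) : 0 < t -> measurable_fun setT f ->
  (forall y, `|f y| <= C * (1 + y ^+ 2)) ->
  leb.-integrable setT (EFin \o (fun y => f y * heat1 t y)).
Proof.
move=> t0 mf fC.
have C0 : 0 <= C by have := fC 0; rewrite expr0n addr0 mulr1; apply: le_trans.
have t20 : 0 < 2 * t by rewrite mulr_gt0.
apply: (@le_integrable _ _ _ leb setT measurableT _
   (EFin \o (fun y => C * ((1 + 8 * t) * Num.sqrt 2) * heat1 (2 * t) y))).
- by apply/measurable_EFinP; apply: measurable_funM => //; exact: measurable_heat1.
- move=> y _; rewrite /= !lee_fin normrM (ger0_norm (heat1_ge0 _ _)).
  apply: le_trans (ler_norm _).
  rewrite (@le_trans _ _ (C * (1 + y ^+ 2) * heat1 t y))//.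
    by rewrite ler_wpM2r ?heat1_ge0.
  by have := ler_wpM2l C0 (heat1_bound y t0); rewrite !mulrA.
- by apply: integrableZR; exact: integrable_heat1.
Qed.

(** The fundamental theorem of calculus on growing intervals: the boundary terms vanish by the
    Gaussian bound on [F], the integrals converge by dominated convergence. *)
Lemma integral_derive_heat1 t (F f : R -> R) (C : R) : 0 < t ->
  (forall y, `|F y| <= C * heat1 t y) ->
  (forall y, is_derive (y : R) 1 F (f y)) -> continuous f ->
  leb.-integrable setT (EFin \o f) -> \int[leb]_y f y = 0.
Proof.
move=> t0 FC dF cf intf.
have C0 : 0 <= C.
  have := FC 0; rewrite /heat1 expr0n mul0r oppr0 expR0 mulr1.
  by move/(le_trans (normr_ge0 _)); rewrite pmulr_lge0// invr_gt0 sqrtr_gt0 !mulr_gt0// pi_gt0.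
have mf : measurable_fun setT f by exact: continuous_measurable_fun.
have cF : continuous F.
  by move=> x; apply: differentiable_continuous; apply/derivable1_diffP; exact: ex_derive.
pose I (n : nat) : set R := [set` `[- n.+1%:R, n.+1%:R]].
pose f_ n : R -> \bar R := (EFin \o f) \_ (I n).
have fI n : (\int[leb]_x f_ n x = (F n.+1%:R - F (- n.+1%:R))%:E)%E.
  rewrite -integral_mkcond (@continuous_FTC2 _ f F)//.
  - by rewrite ltrNl (@lt_trans _ _ 0)// ?oppr_lt0 ltr0n.
  - exact: continuous_subspaceT.
  - split; first by move=> x _; exact: ex_derive.
    + exact/cvg_at_right_filter/cF.
    + exact/cvg_at_left_filter/cF.
  - by move=> x _; rewrite derive1E; exact: derive_val.
have [] := @dominated_convergence _ _ _ leb setT measurableT f_ (EFin \o f) (abse \o (EFin \o f)).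
- move=> n; apply/(measurable_restrictT _ _).1; first exact: measurable_itv.
  apply: measurable_funTS.
  exact/measurable_EFinP.
- exact/measurable_EFinP.
- apply: aeW => x _; apply: cvg_near_cst; near=> n.
  rewrite /f_ patchE mem_set//=; rewrite /I /= in_itv/=.
  rewrite -ler_norml (@le_trans _ _ n%:R) ?ler_nat//.
  by near: n; exact: nbhs_infty_ger.
- exact: integrable_abse.
- apply: aeW => x n _; rewrite /f_ patchE; case: ifPn => // _.
  by rewrite abse0 abse_ge0.
move=> _ _ cv.
have cv0 : (\int[leb]_x f_ n x)%E @[n --> \oo] --> 0%E.
  under eq_fun do rewrite fI.
  apply: cvg_EFin; first exact: nearW.
  apply: norm_cvg0.
  pose B := C * (Num.sqrt (4 * pi * t))^-1 * (4 * t) *+ 2.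
  apply: (@squeeze_cvgr _ _ _ _ (cst 0) (fun n => B * n.+1%:R^-1)).
  - apply: nearW => n.
    have HB : C * heat1 t n.+1%:R <=
        C * (Num.sqrt (4 * pi * t))^-1 * (4 * t) * n.+1%:R^-1.
      by have := ler_wpM2l C0 (heat1_harmonic n t0); rewrite !mulrA.
    rewrite /= normr_ge0/= (le_trans (ler_normB _ _))//.
    rewrite /B mulr2n mulrDl lerD//.
    + by rewrite (le_trans (FC _)).
    + by rewrite (le_trans (FC _))// heat1N.
  - exact: cvg_cst.
  - rewrite -(mulr0 B); apply: cvgMr; exact: cvg_harmonic.
have := cvg_unique _ cv0 cv.
by rewrite /Rintegral => <-.
Unshelve. all: end_near. Qed.

Lemma integrable_heat1_bounded t (f : R -> R) : 0 < t -> measurable_fun setT f ->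
  (forall y, `|f y| <= 1) -> leb.-integrable setT (EFin \o (fun y => f y * heat1 t y)).
Proof.
move=> t0 mf f1; apply: (@integrable_poly_heat1 _ _ 1) => // y.
by rewrite mul1r (le_trans (f1 y))// lerDl sqr_ge0.
Qed.

Lemma ler_norm_1sqr (y : R) : `|y| <= 1 + y ^+ 2.
Proof.
by rewrite ler_norml; apply/andP; split; nra.
Qed.

Lemma integral_sin_heat1 t xi : 0 < t -> \int[leb]_y (sin (y * xi) * heat1 t y) = 0.
Proof.
move=> t0.
have mf : measurable_fun setT (fun y : R => sin (y * xi) * heat1 t y).
  apply: measurable_funM; last exact: measurable_heat1.
  by apply: measurableT_comp (continuous_measurable_fun (@continuous_sin R)) _; exact: measurable_funM.
have intf := @integrable_heat1_bounded t (fun y => sin (y * xi)) t0.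
have H : \int[leb]_y (sin (y * xi) * heat1 t y) = - \int[leb]_y (sin (y * xi) * heat1 t y).
  rewrite {1}/Rintegral integral_opp; last exact/measurable_EFinP.
  have -> : (\int[leb]_x (sin (- x * xi) * heat1 t (- x))%:E =
     \int[leb]_x ((-1)%:E * (sin (x * xi) * heat1 t x)%:E))%E.
    by apply: eq_integral => y _; rewrite mulNr sinN heat1N mulNr mulN1e.
  rewrite integralZl//; last first.
    apply: integrable_heat1_bounded => //; last by move=> y; rewrite ler_norml sin_geN1 sin_le1.
    by apply: measurableT_comp (continuous_measurable_fun (@continuous_sin R)) _; exact: measurable_funM.
  rewrite fineM// ?mulN1r//.
  apply: integrable_fin_num => //.
  apply: integrable_heat1_bounded => //; last by move=> y; rewrite ler_norml sin_geN1 sin_le1.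
  by apply: measurableT_comp (continuous_measurable_fun (@continuous_sin R)) _; exact: measurable_funM.
by move: H; move: (Rintegral _ _ _) => I; clear => H; lra.
Qed.

(** The transform [H] solves an ordinary differential equation. Differentiation under the integral
    and an integration by parts give [H'(z) = - 2 t z H(z)], so [H(z) e^(t z^2)] is constant, with
    value [H(0) = 1]. *)
Lemma integral_cos_heat1 t xi : 0 < t ->
  \int[leb]_y (cos (y * xi) * heat1 t y) = expR (- (t * xi ^+ 2)).
Proof.
move=> t0.
pose H (z : R) := \int[leb]_y (cos (y * z) * heat1 t y).
have mlin z : measurable_fun setT (fun y : R => y * z) by exact: measurable_funM.
have msin z : measurable_fun setT (fun y : R => sin (y * z)).
  exact: measurableT_comp (continuous_measurable_fun (@continuous_sin R)) (mlin z).
have mcos z : measurable_fun setT (fun y : R => cos (y * z)).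
  exact: measurableT_comp (continuous_measurable_fun (@continuous_cos R)) (mlin z).
have bcos z y : `|cos (y * z)| <= 1 by rewrite ler_norml cos_geN1 cos_le1.
have bsin z y : `|sin (y * z)| <= 1 by rewrite ler_norml sin_geN1 sin_le1.
have icos z := integrable_heat1_bounded t0 (mcos z) (bcos z).
have dcos z y : is_derive (z : R) 1 (fun z => cos (y * z) * heat1 t y) (- y * sin (y * z) * heat1 t y).
  have -> : (fun z => cos (y * z) * heat1 t y) = (fun z => heat1 t y *: cos (y * z)).
    by apply/funext => r; rewrite /GRing.scale/= mulrC.
  have D0 : is_derive (z : R) 1 (fun z : R => y * z) y.
    have := is_deriveZ y (is_derive_id (z : R) 1).
    by move/is_derive_eq; apply; rewrite /GRing.scale/= mulr1.
  have := is_deriveZ (heat1 t y) (@is_derive1_comp _ cos _ z _ _ (is_derive_cos _) D0).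
  by move/is_derive_eq; apply; rewrite /GRing.scale/=; ring.
have iysin z : leb.-integrable setT (EFin \o (fun y : R => y * sin (y * z) * heat1 t y)).
  apply: (@integrable_poly_heat1 _ (fun y => y * sin (y * z)) 1) => //; first exact: measurable_funM.
  move=> y; rewrite mul1r normrM (@le_trans _ _ (`|y| * 1))//; first by rewrite ler_wpM2l.
  by rewrite mulr1 ler_norm_1sqr.
have dH z : is_derive (z : R) 1 H (- \int[leb]_y (y * sin (y * z) * heat1 t y)).
  pose f (z y : R) := cos (y * z) * heat1 t y.
  have d1f r y : partial1of2 f r y = - y * sin (y * r) * heat1 t y.
    by rewrite partial1of2E; apply: derive_val.
  have zI : (z \in `]z - 1, z + 1[) by rewrite in_itv/=; apply/andP; split; lra.
  have i1 : leb.-integrable setT (EFin \o (fun y : R => `|y| * heat1 t y)).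
    apply: (@integrable_poly_heat1 _ (fun y => `|y|) 1) => //.
    by move=> y; rewrite mul1r normr_id ler_norm_1sqr.
  have b1 r y : `|partial1of2 f r y| <= `|y| * heat1 t y.
    rewrite d1f normrM normrM normrN (ger0_norm (heat1_ge0 _ _)) -mulrA ler_wpM2l//.
    by rewrite -[leRHS]mul1r ler_wpM2r ?heat1_ge0.
  have g0 y : 0 <= `|y| * heat1 t y by rewrite mulr_ge0 ?heat1_ge0.
  have A1 := @derivable_under_integral _ _ _ leb f setT measurableT z (z-1) (z+1) zI
     (fun r _ => icos r) (fun r y _ _ => @ex_derive _ _ _ _ _ _ _ (dcos r y)) _ g0 i1 (fun r y _ _ => b1 r y).
  have A2 := @differentiation_under_integral _ _ _ leb f setT measurableT z (z-1) (z+1) zI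
     (fun r _ => icos r) (fun r y _ _ => @ex_derive _ _ _ _ _ _ _ (dcos r y)) _ g0 i1 (fun r y _ _ => b1 r y).
  apply: DeriveDef; first exact: A1.
  rewrite -derive1E A2.
  under eq_Rintegral do rewrite d1f mulNr mulNr -mulN1r.
  by rewrite RintegralZl// mulN1r.
(* Integration by parts, read off from the vanishing integral of the derivative of
   [sin(y z) heat1(y)]. *)
have ibp z : \int[leb]_y (y * sin (y * z) * heat1 t y) = 2 * t * z * H z.
  have i3 : leb.-integrable setT (EFin \o (fun y : R => z * (cos (y * z) * heat1 t y))).
    exact: integrableZR.
  have i4 : leb.-integrable setT (EFin \o (fun y : R => (2 * t)^-1 * (y * sin (y * z) * heat1 t y))).
    exact: integrableZR.
  have : \int[leb]_y (z * (cos (y * z) * heat1 t y) - (2 * t)^-1 * (y * sin (y * z) * heat1 t y)) = 0.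
    apply: (@integral_derive_heat1 t (fun y => sin (y * z) * heat1 t y) _ 1) => //.
    - by move=> y; rewrite normrM (ger0_norm (heat1_ge0 _ _)) ler_wpM2r ?heat1_ge0.
    - move=> y.
      have D0 : is_derive (y : R) 1 (fun y : R => y * z) z.
        have := is_deriveZ z (is_derive_id (y : R) 1).
        rewrite (_ : z \*: id = fun y => y * z); last by apply/funext => r; rewrite /= /GRing.scale/= mulrC.
        by move/is_derive_eq; apply; rewrite /GRing.scale/= mulr1.
      have D1 := @is_derive1_comp _ sin _ y _ _ (is_derive_sin _) D0.
      have := is_deriveM D1 (is_derive_heat1 y t0).
      by move/is_derive_eq; apply; rewrite /GRing.scale/=; ring.
    - move=> y; apply: cvgB; (apply: cvgM; first exact: cvg_cst); apply: cvgM;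
        [|exact: continuous_heat1| |exact: continuous_heat1].
      + apply: (@cvg_comp _ _ _ (fun x : R => x * z) (@cos R)); last exact: continuous_cos.
        by apply: cvgM; [exact: cvg_id|exact: cvg_cst].
      + apply: cvgM; first exact: cvg_id.
        apply: (@cvg_comp _ _ _ (fun x : R => x * z) (@sin R)); last exact: continuous_sin.
        by apply: cvgM; [exact: cvg_id|exact: cvg_cst].
    - exact: integrableBR.
  rewrite RintegralB// RintegralZl// RintegralZl// => /eqP.
  rewrite subr_eq0 => /eqP HH.
  have t2 : 2 * t != 0 by rewrite gt_eqF ?mulr_gt0.
  apply: (@mulfI _ (2 * t)^-1); first by rewrite invr_eq0.
  by rewrite -HH /H; field; rewrite gt_eqF.
have dK z : is_derive (z : R) 1 (fun z => H z * expR (t * z ^+ 2)) 0.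
  have D0 : is_derive (z : R) 1 (fun z : R => t *: z ^+ 2) (2 * t * z).
    by apply: is_derive_eq; rewrite /GRing.scale/= /GRing.scale/=; ring.
  have := is_deriveM (dH z) (@is_derive1_comp _ expR _ z _ _ (is_derive_expR _) D0).
  move/is_derive_eq; apply; rewrite ibp /GRing.scale/=; ring.
have := @is_derive_0_is_cst _ _ xi 0 dK.
rewrite expr0n mulr0 expR0 mulr1 {2}/H.
rewrite (_ : (\int[leb]_y (cos (y * 0) * heat1 t y)) = 1); last first.
  under eq_Rintegral do rewrite mulr0 cos0 mul1r.
  by rewrite /Rintegral integral_heat1.
move=> /eqP; rewrite expRN -/(H xi) => /eqP HK.
by apply: (@mulIf _ (expR (t * xi ^+ 2))); rewrite ?gt_eqF ?expR_gt0// HK mulVf// gt_eqF ?expR_gt0.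
Qed.
End gauss1.

Lemma measurable_inv (R : realType) : measurable_fun setT (fun x : R => x^-1).
Proof.
have -> : [set: R] = [set 0] `|` [set~ 0] by rewrite setUv.
apply/(measurable_funU _ (measurable_set1 0) (measurableC (measurable_set1 0))); split.
  exact: measurable_fun_set1.
apply: open_continuous_measurable_fun; first by apply: closed_openC; exact: closed_eq.
by move=> x; rewrite inE/= => /eqP x0; exact: inv_continuous.
Qed.

(** * The Euclidean inner product: measurability and derivatives *)

Section dot.
Context {R : realType} {n : nat}.
Implicit Types x y z : 'rV[R]_n.

Lemma dot_ge0 x : 0 <= dot x x.
Proof. by apply: sumr_ge0 => i _; rewrite -expr2 sqr_ge0. Qed.

Lemma sqr_le_dot x i : x ord0 i ^+ 2 <= dot x x.
Proof.
rewrite /dot (bigD1 i)//= -expr2 lerDl.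
by apply: sumr_ge0 => j _; rewrite -expr2 sqr_ge0.
Qed.

Lemma measurable_dotr xi : measurable_fun setT (fun x : 'rV[R]_n => dot x xi).
Proof.
apply: measurable_sum => i; apply: measurable_funM => //.
exact: measurable_coord_rV.
Qed.

Lemma measurable_dot : measurable_fun setT (fun x : 'rV[R]_n => dot x x).
Proof.
by apply: measurable_sum => i; apply: measurable_funM; exact: measurable_coord_rV.
Qed.

Lemma is_derive_coord x (e : 'rV[R]_n) i :
  is_derive x e (fun z : 'rV[R]_n => z ord0 i) (e ord0 i).
Proof.
apply: (@is_derive_congr _ _ _ (fun z : 'rV[R]_n => z ord0 i) (fun h : R => h *: e ord0 i + x ord0 i) x e 0 1).
  by move=> h; rewrite !mxE [h *: 1]mulr1 addr0.
have := is_deriveD (is_deriveZ (e ord0 i) (is_derive_id (0 : R) 1)) (is_derive_cst (x ord0 i) (0 : R) 1).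
rewrite (_ : _ + _ = (fun h : R => h *: e ord0 i + x ord0 i)); last first.
  by apply/funext => h /=; rewrite /GRing.scale/= mulrC.
by move/is_derive_eq; apply; rewrite /GRing.scale/= mulr1 addr0.
Qed.

Lemma is_derive_dot x j :
  is_derive x (delta_mx ord0 j : 'rV[R]_n) (fun z : 'rV[R]_n => dot z z) (2 * x ord0 j).
Proof.
rewrite /dot.
have D i := is_deriveM (is_derive_coord x (delta_mx ord0 j) i) (is_derive_coord x (delta_mx ord0 j) i).
have := is_derive_sum D.
rewrite (_ : \sum_(i < n) _ = (fun z : 'rV[R]_n => \sum_i z ord0 i * z ord0 i)); last first.
  by apply/funext => z; rewrite fct_sumE.
move/is_derive_eq; apply.
rewrite (bigD1 j)//= !mxE !eqxx big1 ?addr0.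
  by rewrite /GRing.scale/=; ring.
by move=> i ij; rewrite !mxE (negbTE ij) andbF scaler0 addr0.
Qed.
End dot.

(** * The heat kernel on row vectors: mass, Fourier transform, derivatives *)

Section heat.
Context {R : realType}.
Local Notation leb := (@lebesgue_measure R).

Definition heat n (t : R) (x : 'rV[R]_n) : R :=
  (Num.sqrt (4 * pi * t))^-1 ^+ n * expR (- (dot x x / (4 * t))).

Lemma heat_ge0 n t (x : 'rV[R]_n) : 0 <= heat t x.
Proof. by rewrite mulr_ge0 ?exprn_ge0 ?invr_ge0 ?expR_ge0. Qed.

Lemma dot_cons n (a b : R) (v w : 'rV[R]_n) :
  dot (rV_cons (a, v)) (rV_cons (b, w)) = a * b + dot v w.
Proof.
rewrite /dot big_ord_recl !rV_cons0; congr (_ + _).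
by apply: eq_bigr => i _; rewrite !rV_consS.
Qed.

Lemma dot_consr n (a : R) (v : 'rV[R]_n) xi :
  dot (rV_cons (a, v)) xi = a * xi ord0 ord0 + dot v (rV_uncons xi).2.
Proof. by rewrite -{1}(rV_unconsK xi) [rV_uncons xi]surjective_pairing dot_cons. Qed.

Lemma heat_cons n t a (v : 'rV[R]_n) : heat t (rV_cons (a, v)) = heat1 t a * heat t v.
Proof.
rewrite /heat /heat1 dot_cons exprS.
have -> : - ((a * a + dot v v) / (4 * t)) = - (a ^+ 2 / (4 * t)) + - (dot v v / (4 * t)).
  by rewrite expr2 mulrDl opprD.
by rewrite expRD; ring.
Qed.

Lemma measurable_heat2 n :
  measurable_fun setT (fun z : measurableTypeR R * 'rV[R]_n => heat z.1 z.2).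
Proof.
have m4 (c : R) : measurable_fun setT (fun z : measurableTypeR R * 'rV[R]_n => c * z.1).
  by apply: measurable_funM => //; exact: measurable_fst.
apply: measurable_funM.
  apply: measurable_funX.
  apply: (measurableT_comp (@measurable_inv R)).
  exact: (measurableT_comp (continuous_measurable_fun (@sqrt_continuous R))).
apply: measurableT_comp => //; apply: measurableT_comp => //.
apply: measurable_funM.
  by apply: measurableT_comp (@measurable_dot R n) _; exact: measurable_snd.
exact: (measurableT_comp (@measurable_inv R)).
Qed.

Lemma measurable_heat n t : measurable_fun setT (@heat n t).
Proof.
apply: (measurableT_comp (@measurable_heat2 n) (_ : measurable_fun setT (fun x : 'rV[R]_n => (t, x)))).
by apply/measurable_fun_pair.
Qed.

Lemma integral_heat n t : 0 < t -> (\int[lebesgue_rV n]_x (heat t x)%:E = 1)%E.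
Proof.
move=> t0; elim: n => [|n IH].
  have mh : measurable_fun setT (EFin \o @heat 0 t).
    by apply/measurable_EFinP; exact: measurable_heat.
  rewrite /= integral_dirac//.
  by rewrite diracE mem_set// mul1e /heat expr0 mul1r /dot big_ord0 mul0r oppr0 expR0.
rewrite ge0_integral_rVS; last 2 first.
- by apply/measurable_EFinP; exact: measurable_heat.
- by move=> x; rewrite lee_fin heat_ge0.
rewrite -(integral_heat1 t0); apply: eq_integral => a _.
under eq_integral do rewrite heat_cons EFinM.
rewrite ge0_integralZl//.
- by rewrite IH mule1.
- by apply/measurable_EFinP; exact: measurable_heat.
- by move=> x _; rewrite lee_fin heat_ge0.
- by rewrite lee_fin heat1_ge0.
Qed.

Lemma integrable_heat n t : 0 < t -> (lebesgue_rV n).-integrable setT (EFin \o @heat n t).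
Proof.
move=> t0; apply: integrable_ge0_fin; first exact: measurable_heat.
- by move=> x; exact: heat_ge0.
- by rewrite integral_heat// ltry.
Qed.

Lemma integrable_heat_bounded n t (f : 'rV[R]_n -> R) : 0 < t -> measurable_fun setT f ->
  (forall y, `|f y| <= 1) -> (lebesgue_rV n).-integrable setT (EFin \o (fun y => f y * heat t y)).
Proof.
move=> t0 mf f1; apply: integrable_dom (integrable_heat n t0).
  by apply: measurable_funM => //; exact: measurable_heat.
by move=> x; rewrite normrM (ger0_norm (heat_ge0 _ _))// ler_piMl ?heat_ge0.
Qed.

(** The cosine and sine parts are proved together because the addition formulas mix them when the
    first coordinate is split off; the sine factors then drop out. *)
Lemma fourier_heat n t (xi : 'rV[R]_n) : 0 < t ->
  \int[lebesgue_rV n]_x (cos (dot x xi) * heat t x) = expR (- (t * dot xi xi)) /\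
  \int[lebesgue_rV n]_x (sin (dot x xi) * heat t x) = 0.
Proof.
move=> t0; elim: n xi => [|n IH] xi.
  have d0 (x y : 'rV[R]_0) : dot x y = 0 by rewrite /dot big_ord0.
  have h0 (x : 'rV[R]_0) : heat t x = 1 by rewrite /heat expr0 mul1r d0 mul0r oppr0 expR0.
  have m0 : lebesgue_rV 0 [set: 'rV[R]_0] = 1%E by rewrite /= diracE mem_set.
  split.
    rewrite (@eq_Rintegral _ _ _ _ _ (cst 1)); last by move=> x _ /=; rewrite d0 h0 cos0 mulr1.
    have -> : \int[lebesgue_rV 0]_x cst 1 x = fine (lebesgue_rV 0 [set: 'rV[R]_0]).
      by rewrite Rintegral_cst// mul1r.
    by rewrite m0 d0 mulr0 oppr0 expR0.
  rewrite (@eq_Rintegral _ _ _ _ _ (cst 0)); last by move=> x _ /=; rewrite d0 sin0 mul0r.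
  by rewrite Rintegral_cst// mul0r.
have mcosd m (z : 'rV[R]_m) : measurable_fun setT (fun x : 'rV[R]_m => cos (dot x z)).
  exact: measurableT_comp (continuous_measurable_fun (@continuous_cos R)) (measurable_dotr z).
have msind m (z : 'rV[R]_m) : measurable_fun setT (fun x : 'rV[R]_m => sin (dot x z)).
  exact: measurableT_comp (continuous_measurable_fun (@continuous_sin R)) (measurable_dotr z).
have bcos z : `|cos z| <= 1 :> R by rewrite ler_norml cos_geN1 cos_le1.
have bsin z : `|sin z| <= 1 :> R by rewrite ler_norml sin_geN1 sin_le1.
have icos m (z : 'rV[R]_m) := integrable_heat_bounded t0 (mcosd m z) (fun x => bcos _).
have isin m (z : 'rV[R]_m) := integrable_heat_bounded t0 (msind m z) (fun x => bsin _).
have mlin z : measurable_fun setT (fun y : R => y * z) by exact: measurable_funM.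
have mc1 z : measurable_fun setT (fun y : R => cos (y * z)).
  exact: measurableT_comp (continuous_measurable_fun (@continuous_cos R)) (mlin z).
have ic1 z := integrable_heat1_bounded t0 (mc1 z) (fun x => bcos _).
have ms1 z : measurable_fun setT (fun y : R => sin (y * z)).
  exact: measurableT_comp (continuous_measurable_fun (@continuous_sin R)) (mlin z).
have is1 z := integrable_heat1_bounded t0 (ms1 z) (fun x => bsin _).
set a0 := xi ord0 ord0; set w := (rV_uncons xi).2.
have dxi : dot xi xi = a0 ^+ 2 + dot w w.
  by rewrite -[in LHS](rV_unconsK xi) [rV_uncons xi]surjective_pairing dot_cons.
have [IC IS] := IH w.
split.
  have I1 := icos _ xi.
  rewrite Rintegral_rVS// -Rintegral12_prod; last first.
    exact/(integrable_rVS (measurable_int _ I1)).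
  transitivity (\int[leb]_a (expR (- (t * dot w w)) * (cos (a * a0) * heat1 t a))).
    apply: eq_Rintegral => a _.
    rewrite (@eq_Rintegral _ _ _ _ _ (fun v => (cos (a * a0) * heat1 t a) * (cos (dot v w) * heat t v)
       - (sin (a * a0) * heat1 t a) * (sin (dot v w) * heat t v))); last first.
      by move=> v _; rewrite dot_consr heat_cons cosD; ring.
    rewrite RintegralB//; [|exact: integrableZR|exact: integrableZR].
    by rewrite !RintegralZl// IC IS mulr0 subr0 mulrC.
  by rewrite RintegralZl// integral_cos_heat1// -expRD dxi; congr expR; ring.
have I1 := isin _ xi.
rewrite Rintegral_rVS// -Rintegral12_prod; last first.
  exact/(integrable_rVS (measurable_int _ I1)).
transitivity (\int[leb]_a (expR (- (t * dot w w)) * (sin (a * a0) * heat1 t a))).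
  apply: eq_Rintegral => a _.
  rewrite (@eq_Rintegral _ _ _ _ _ (fun v => (sin (a * a0) * heat1 t a) * (cos (dot v w) * heat t v)
     + (cos (a * a0) * heat1 t a) * (sin (dot v w) * heat t v))); last first.
    by move=> v _; rewrite dot_consr heat_cons sinD; ring.
  rewrite RintegralD//; [|exact: integrableZR|exact: integrableZR].
  by rewrite !RintegralZl// IC IS mulr0 addr0 mulrC.
by rewrite RintegralZl// integral_sin_heat1// mulr0.
Qed.

(** As in one dimension, half of the exponent absorbs the polynomial factor. That factor depends on
    [|x|^2 / t] only, so the constant is uniform in [t]; this makes derivatives of the kernel
    comparable to the kernel at doubled time. *)
Lemma heat_bound n t (x : 'rV[R]_n) : 0 < t ->
  (1 + dot x x / (8 * t)) * heat t x <= Num.sqrt 2 ^+ n * heat (2 * t) x.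
Proof.
move=> t0; rewrite /heat.
have -> : 4 * pi * (2 * t) = 2 * (4 * pi * t) by ring.
have -> : - (dot x x / (4 * t)) = - (dot x x / (4 * (2 * t))) - (dot x x / (8 * t)).
  by field; rewrite gt_eqF.
have -> : (Num.sqrt (2 * (4 * pi * t)))^-1 ^+ n =
    (Num.sqrt 2)^-1 ^+ n * (Num.sqrt (4 * pi * t))^-1 ^+ n :> R.
  by rewrite sqrtrM// invfM exprMn.
rewrite expRD (expRN (dot x x / (8 * t))).
set S := _ ^+ n; set S' := (Num.sqrt 2)^-1 ^+ n; set E1 := expR _; set E := expR (_ / _).
have S2 : Num.sqrt 2 ^+ n * S' = 1.
  by rewrite -exprMn divff ?expr1n// sqrtr_eq0 -ltNge.
have -> : (1 + dot x x / (8 * t)) * (S * (E1 / E)) = (1 + dot x x / (8 * t)) / E * (S * E1).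
  by ring.
have -> : Num.sqrt 2 ^+ n * (S' * S * E1) = (Num.sqrt 2 ^+ n * S') * (S * E1) by ring.
have SE : 0 <= S * E1 by rewrite mulr_ge0 ?exprn_ge0 ?invr_ge0 ?expR_ge0.
by rewrite S2 ler_wpM2r// ler_pdivrMr ?expR_gt0// mul1r expR_ge1Dx.
Qed.

Lemma heat_double n t (x : 'rV[R]_n) : 0 < t ->
  heat t x <= Num.sqrt 2 ^+ n * heat (2 * t) x.
Proof.
move=> t0; apply: le_trans (heat_bound x t0).
by rewrite ler_peMl ?heat_ge0// lerDl divr_ge0 ?dot_ge0// mulr_ge0// ltW.
Qed.

Lemma heat_le1 n t (x : 'rV[R]_n) : 1 <= t -> heat t x <= 1.
Proof.
move=> t1; have t0 : 0 < t by rewrite (lt_le_trans ltr01).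
have t4 : 0 < 4 * t by rewrite mulr_gt0.
have pt : 1 <= 4 * pi * t by have := @pi_ge2 R => p2; nra.
rewrite /heat -[leRHS]mul1r ler_pM ?exprn_ge0 ?invr_ge0 ?expR_ge0//.
  rewrite exprn_ile1 ?invr_ge0// invf_le1 ?sqrtr_gt0 ?(lt_le_trans ltr01)//.
  by rewrite -[leLHS]sqrtr1 ler_sqrt// (le_trans ler01).
by rewrite -[leRHS]expR0 ler_expR oppr_le0 divr_ge0 ?dot_ge0// ltW.
Qed.

Definition dheat n (i : 'I_n) (t : R) (x : 'rV[R]_n) := - (x ord0 i / (2 * t)) * heat t x.

Definition ddheat n (i j : 'I_n) (t : R) (x : 'rV[R]_n) :=
  (x ord0 i * x ord0 j / (4 * t ^+ 2) - (i == j)%:R / (2 * t)) * heat t x.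

Lemma is_derive_comp (V : normedModType R) (f : R -> R) (g : V -> R) (x e : V) (a b : R) :
  is_derive (g x) 1 f a -> is_derive x e g b -> is_derive x e (f \o g) (a * b).
Proof.
move=> df dg.
have dg0 : is_derive (0 : R) 1 (fun h : R => g (h *: e + x)) b.
  apply: is_derive_congr dg => h /=; congr g.
  by rewrite [h *: 1]mulr1 addr0.
have := @is_derive1_comp _ f (fun h : R => g (h *: e + x)) 0 a b.
rewrite scale0r add0r => /(_ df dg0).
by apply: is_derive_congr => h /=; rewrite [h *: 1]mulr1 addr0.
Qed.

Lemma is_derive_heat n i t (x : 'rV[R]_n) : 0 < t ->
  is_derive x (delta_mx ord0 i : 'rV[R]_n) (heat t) (dheat i t x).
Proof.
move=> t0.
have D1 := is_deriveZ (- (4 * t)^-1) (is_derive_dot x i).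
have D2 := is_deriveZ ((Num.sqrt (4 * pi * t))^-1 ^+ n)
  (@is_derive_comp _ expR (fun z : 'rV[R]_n => - (4 * t)^-1 *: dot z z) x _ _ _
    (is_derive_expR (- (4 * t)^-1 * dot x x)) D1).
rewrite [X in is_derive _ _ X _](_ : _ = (heat t)) in D2; last first.
  apply/funext => z; rewrite /heat /= /GRing.scale/=; congr (_ * expR _).
  by rewrite mulNr mulrC.
apply: (is_derive_eq D2); rewrite /GRing.scale/= /dheat /heat.
rewrite (_ : - (4 * t)^-1 * dot x x = - (dot x x / (4 * t))); last by rewrite mulNr mulrC.
by field; rewrite gt_eqF.
Qed.

Lemma is_derive_dheat n i j t (x : 'rV[R]_n) : 0 < t ->
  is_derive x (delta_mx ord0 j : 'rV[R]_n) (dheat i t) (ddheat i j t x).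
Proof.
move=> t0.
have D1 := is_deriveZ (- (2 * t)^-1) (is_derive_coord x (delta_mx ord0 j) i).
have D2 := is_deriveM D1 (is_derive_heat j x t0).
rewrite [X in is_derive _ _ X _](_ : _ = (dheat i t)) in D2; last first.
  apply/funext => z; rewrite -[LHS]/(- (2 * t)^-1 * z ord0 i * heat t z) /dheat; congr (_ * _); ring.
apply: (is_derive_eq D2); rewrite /GRing.scale/= /GRing.scale/= /dheat /ddheat mxE eqxx/=.
by field; rewrite gt_eqF.
Qed.

Lemma dheat_bound n i t (x : 'rV[R]_n) : 1 <= t ->
  `|dheat i t x| <= 4 * Num.sqrt 2 ^+ n * heat (2 * t) x.
Proof.
move=> t1; have t0 : 0 < t by rewrite (lt_le_trans ltr01).
rewrite /dheat normrM (ger0_norm (heat_ge0 _ _)) normrN normf_div.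
rewrite -[leRHS]mulrA; apply: (@le_trans _ _ (4 * ((1 + dot x x / (8 * t)) * heat t x))); last first.
  by rewrite ler_wpM2l// heat_bound.
rewrite mulrA ler_wpM2r ?heat_ge0// (gtr0_norm (mulr_gt0 _ _))//.
rewrite ler_pdivrMr ?mulr_gt0//.
have := ler_norm_1sqr (x ord0 i); have := sqr_le_dot x i; have := dot_ge0 x.
set D := dot x x => D0 H1 H2.
have -> : 4 * (1 + D / (8 * t)) * (2 * t) = 8 * t + D by field; rewrite gt_eqF.
by clear -t1 H1 H2 D0; nra.
Qed.

(** The factor [1/t] is kept, in contrast to the bound on [dheat], which serves integrability only:
    here it becomes the decay [1/T] of the Laplacian of the test function. *)
Lemma ddheat_bound n i j t (x : 'rV[R]_n) : 0 < t ->
  `|ddheat i j t x| <= 2 / t * Num.sqrt 2 ^+ n * heat (2 * t) x.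
Proof.
move=> t0.
rewrite /ddheat normrM (ger0_norm (heat_ge0 _ _)).
rewrite -[leRHS]mulrA; apply: (@le_trans _ _ (2 / t * ((1 + dot x x / (8 * t)) * heat t x))); last first.
  by rewrite ler_wpM2l ?heat_bound// divr_ge0// ltW.
rewrite [leRHS]mulrA ler_wpM2r ?heat_ge0// (le_trans (ler_normB _ _))//.
rewrite !normf_div normrM (gtr0_norm (mulr_gt0 _ t0))// (gtr0_norm (mulr_gt0 _ (exprn_gt0 _ t0)))//.
have := sqr_le_dot x i; have := sqr_le_dot x j; have := dot_ge0 x.
rewrite -(real_normK (num_real (x ord0 i))) -(real_normK (num_real (x ord0 j))).
set D := dot x x; set a := `|x ord0 i|; set b := `|x ord0 j| => D0 H1 H2.
have H3 : a * b <= D by clear -H1 H2; nra.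
have -> : 2 / t * (1 + D / (8 * t)) = D / (4 * t ^+ 2) + 2 / t by field; rewrite gt_eqF.
rewrite lerD// ?ler_pM2r ?invr_gt0 ?mulr_gt0 ?exprn_gt0//.
rewrite ger0_norm; last by case: eqP.
rewrite invfM mulrA ler_pM2r ?invr_gt0//.
by rewrite (@le_trans _ _ 1)// ?ler1n// ler_pdivrMr// mul1r; case: eqP => _; rewrite ?ler1n.
Qed.

End heat.

(** * Real powers *)

Section powR_extra.
Context {R : realType}.
Implicit Types (a b x y : R).

Lemma sqr1D_le4 x : 0 <= x -> x <= 1 -> (1 + x) ^+ 2 <= 4.
Proof. by nra. Qed.

Lemma sqr1D_le4M x : 1 <= x -> (1 + x) ^+ 2 <= 4 * (x * x).
Proof. by nra. Qed.

Lemma powR_half a x : 0 < x -> (x / 2) `^ (- a) = 2 `^ a * x `^ (- a).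
Proof.
move=> x0; rewrite powRM ?invr_ge0// ?(ltW x0)// mulrC; congr (_ * _).
by rewrite -powR_inv1// -powRrM mulN1r opprK.
Qed.

Lemma powRDp a b x : 0 < x -> x `^ (a + b) = x `^ a * x `^ b.
Proof. by move=> x0; rewrite powRD// (gt_eqF x0) implybT. Qed.

Lemma mul_powR a x : 0 < x -> x * x `^ a = x `^ (1 + a).
Proof. by move=> x0; rewrite powRDp// powRr1// ltW. Qed.

Lemma ler_powRN a x y : 0 <= a -> 0 < x -> x <= y -> y `^ (- a) <= x `^ (- a).
Proof.
move=> a0 x0 xy; have y0 : 0 < y := lt_le_trans x0 xy.
rewrite !powRN lef_pV2 ?posrE ?powR_gt0//.
by apply: ge0_ler_powR; rewrite // nnegrE ltW.
Qed.

Lemma continuous_powR (a x : R) : 0 < x -> {for x, continuous (fun y : R => y `^ a)}.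
Proof.
move=> x0; apply: differentiable_continuous; apply/derivable1_diffP.
by have [] := is_derive1_powR a x0.
Qed.
End powR_extra.

(** * The jump kernel of subordination *)

Section levy_kernel.
Context {R : realType}.
Local Notation leb := (@lebesgue_measure R).
Variable sg : R.
Hypothesis sg01 : 0 < sg < 1.
Implicit Types (s t l : R).

Let sg0 : 0 < sg. Proof. by case/andP: sg01. Qed.
Let sg1 : sg < 1. Proof. by case/andP: sg01. Qed.

(** Up to a constant, the density of the Levy measure of the [sg]-stable subordinator. *)
Definition levy s : R := \1_([set` `]0, +oo[]) s * s `^ (- 1 - sg).

Lemma levy_gt0 s : 0 < s -> levy s = s `^ (- 1 - sg).
Proof. by move=> s0; rewrite /levy indicE mem_set ?mul1r//= in_itv/= s0. Qed.

Lemma levy_le0 s : s <= 0 -> levy s = 0.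
Proof. by move=> s0; rewrite /levy indicE memNset ?mul0r//= in_itv/= ltNge s0. Qed.

Lemma levy_ge0 s : 0 <= levy s.
Proof. by rewrite mulr_ge0 ?powR_ge0// indicE. Qed.

Lemma measurable_levy : measurable_fun setT levy.
Proof. by apply: measurable_funM => //; exact: measurable_powR. Qed.

Lemma levy_scale l s : 0 < l -> levy (l * s) = l `^ (- 1 - sg) * levy s.
Proof.
move=> l0; have [s0|s0] := leP s 0.
  by rewrite !levy_le0 ?mulr0// pmulr_rle0.
by rewrite !levy_gt0 ?mulr_gt0// powRM ?ltW.
Qed.

(* [x^a / (1 + x^a)], where [a = min(sg, 1 - sg)], is a bounded primitive of a function dominating [min(s,1) s^(-1-sg)] *)
Lemma integral_min_levy : (\int[leb]_s (Num.min s 1 * levy s)%:E < +oo)%E.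
Proof.
pose a := Num.min sg (1 - sg).
have a0 : 0 < a by rewrite lt_min sg0 subr_gt0.
have a1 : a <= sg by rewrite ge_min lexx.
have a2 : a <= 1 - sg by rewrite ge_min lexx orbT.
pose f s := 4 * s `^ (a - 1) / (1 + s `^ a) ^+ 2.
pose F s := - (4 / a) / (1 + s `^ a).
have p0 s : 0 < 1 + s `^ a by rewrite ltr_pwDl// powR_ge0.
have dF s : 0 < s -> is_derive (s : R) 1 F (f s).
  move=> s0.
  have D1 := is_deriveD (is_derive_cst (1 : R) (s : R) 1) (is_derive1_powR a s0).
  have D2 := is_deriveZ (- (4 / a)) (@is_deriveV _ (fun x : R => 1 + x `^ a) s _ 1 (lt0r_neq0 (p0 s)) D1).
  apply: (is_derive_eq D2); rewrite /f /GRing.scale/= /GRing.scale/= add0r.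
  by field; rewrite !gt_eqF// p0.
have cf s : 0 < s -> {for s, continuous f}.
  move=> s0; apply: cvgM.
    by apply: cvgM; [exact: cvg_cst|exact: continuous_powR].
  apply: cvgV; first by rewrite gt_eqF ?exprn_gt0.
  by rewrite expr2; apply: cvgM; (apply: cvgD; [exact: cvg_cst|exact: continuous_powR]).
have f0 s : 0 <= f s by rewrite divr_ge0 ?exprn_ge0 ?mulr_ge0 ?powR_ge0// ltW.
have mf : measurable_fun setT f.
  apply: measurable_funM; first by apply: measurable_funM => //; exact: measurable_powR.
  apply: (measurableT_comp (@measurable_inv R)); apply: measurable_funX.
  by apply: measurable_funD => //; exact: measurable_powR.
(* On [(0, 1]] the left side is [s^(-sg) <= s^(a-1)], by [a <= 1 - sg]; beyond 1 it is
   [s^(-1-sg) <= s^(-1-a)], by [a <= sg]. The 4 in [f] pays for the square of [1 + s^a], at most 4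
   in the first case and [4 s^(2a)] in the second. *)
have minf s : Num.min s 1 * levy s <= f s.
  have [s0|s0] := leP s 0.
    by rewrite levy_le0// mulr0.
  rewrite levy_gt0// /f ler_pdivlMr ?exprn_gt0//.
  have sa0 : 0 < s `^ a by rewrite powR_gt0.
  have [s1|s1] := leP s 1.
    have sa1 : s `^ a <= 1.
      by rewrite -(powRr0 s) ger_powR ?s0//; exact: ltW.
    have -> : s * s `^ (-1 - sg) = s `^ (- sg).
      by rewrite mul_powR//; congr (_ `^ _); ring.
    rewrite mulrC ler_pM ?exprn_ge0 ?powR_ge0//; first exact: ltW.
      by rewrite sqr1D_le4// ltW.
    apply: ger_powR; first by rewrite s0.
    lra.
  have s1' := ltW s1.
  have sa1 : 1 <= s `^ a by rewrite -(powRr0 s) ler_powR// ltW.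
  rewrite mul1r (@le_trans _ _ (s `^ (-1 - sg) * (4 * s `^ (a + a))))//.
    rewrite ler_wpM2l ?powR_ge0// powRDp//.
    exact: sqr1D_le4M.
  rewrite mulrCA ler_wpM2l// -powRDp//.
  by rewrite ler_powR//; lra.
apply: (@le_lt_trans _ _ (\int[leb]_(s in [set` `]0%R, +oo[]) (f s)%:E)%E).
  rewrite [leRHS]integral_mkcond; apply: ge0_le_integral => //.
  - move=> s _; have [s0|s0] := leP s 0; first by rewrite levy_le0// mulr0.
    by rewrite lee_fin mulr_ge0 ?levy_ge0// le_min ltW/=.
  - apply/measurable_EFinP; apply: measurable_funM; last exact: measurable_levy.
    exact: measurable_minr.
  - by apply/(measurable_restrictT _ _).1 => //; apply: measurable_funTS; apply/measurable_EFinP.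
  - move=> s _; rewrite patchE; case: ifPn => [_|]; first by rewrite lee_fin.
    rewrite notin_setE/= in_itv/= andbT => /negP; rewrite -leNgt => s0.
    by rewrite levy_le0// mulr0.
(* The shift by 2 keeps the end points distinct, as the fundamental theorem requires; with a shift
   by 1 the interval for [n = 0] would be a point. *)
pose I (n : nat) : set R := [set` `[n.+2%:R^-1, n.+2%:R]].
have I0 n s : I n s -> 0 < s.
  by rewrite /I /= in_itv/= => /andP[+ _]; apply: lt_le_trans; rewrite invr_gt0.
have -> : [set` `]0, +oo[] = \bigcup_n I n.
  apply/seteqP; split => [s /=|s [n _ /I0]/=]; last by rewrite in_itv/= andbT.
  rewrite in_itv/= andbT => s0.
  pose m := maxn (Num.truncn s) (Num.truncn s^-1).
  exists m => //; rewrite /I /= in_itv/=; apply/andP; split.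
    rewrite invf_ple ?posrE ?ltr0n//; apply: (le_trans (ltW (truncnS_gt _))).
    by rewrite ler_nat ltnS leqW// leq_maxr.
  apply: (le_trans (ltW (truncnS_gt _))).
  by rewrite ler_nat ltnS leqW// leq_maxl.
have mI n : measurable (I n) by exact: measurable_itv.
apply: (@le_lt_trans _ _ (4 / a)%:E); last by rewrite ltry.
apply: (@cvge_le _ _ eventually_filter _ (fun n : nat => \int[leb]_(s in I n) (EFin \o f) s)%E _ (4 / a)%:E); last first.
  apply: ge0_nondecreasing_set_cvg_integral => //.
  - move=> m n mn; apply/subsetPset => s; rewrite /I /= !in_itv/= => /andP[h1 h2].
    apply/andP; split; last by rewrite (le_trans h2)// ler_nat.
    by rewrite (le_trans _ h1)// lef_pV2 ?posrE// ler_nat.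
  - by move=> n; apply: measurable_funTS; apply/measurable_EFinP.
  - by move=> n s _; rewrite lee_fin.
apply: nearW => n.
have n2 : n.+2%:R^-1 < n.+2%:R :> R.
  by rewrite (@lt_trans _ _ 1)// ?invf_lt1 ?ltr1n// ltr0n.
rewrite /I (@continuous_FTC2 _ f F)//.
- rewrite -EFinB lee_fin /F !mulNr opprK addrC.
  rewrite lerBlDr (@le_trans _ _ (4 / a))//.
    by rewrite ler_pdivrMr ?p0// ler_peMr ?divr_ge0// ?(ltW a0)// lerDl powR_ge0.
  by rewrite lerDl divr_ge0// ?divr_ge0// ltW.
- apply/continuous_in_subspaceT => s; rewrite inE => /I0; exact: cf.
- split.
  + move=> s; rewrite in_itv/= => /andP[sn _].
    have s0 : 0 < s by apply: lt_trans sn; rewrite invr_gt0.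
    by have [] := dF s s0.
  + apply: cvg_at_right_filter.
    have s0 : 0 < n.+2%:R^-1 :> R by rewrite invr_gt0.
    by apply: differentiable_continuous; apply/derivable1_diffP; have [] := dF _ s0.
  + apply: cvg_at_left_filter.
    have s0 : 0 < n.+2%:R :> R by [].
    by apply: differentiable_continuous; apply/derivable1_diffP; have [] := dF _ s0.
- move=> s; rewrite in_itv/= => /andP[sn _].
  have s0 : 0 < s by apply: lt_trans sn; rewrite invr_gt0.
  by rewrite derive1E; have [_] := dF s s0.
Qed.
End levy_kernel.

(** * The time weight, its fractional derivative, and their Laplace transforms *)

Section time_weights.
Context {R : realType}.
Local Notation leb := (@lebesgue_measure R).
Variable sg : R.
Hypothesis sg01 : 0 < sg < 1.
Implicit Types (s t l : R).

Let sg0 : 0 < sg. Proof. by case/andP: sg01. Qed.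
Let sg1 : sg < 1. Proof. by case/andP: sg01. Qed.

(** The weight without its taper at 1. It dominates [weight], and [dweight] up to a constant, and is
    itself at most [2 weight] from [t = 2] on. *)
Definition tailw t : R := \1_([set` `]1, +oo[]) t * levy sg t.
(* The factor [1 - t^-1] removes the jump at 1, so that the integral in [dweight]
   converges at [s = 0]. *)
Definition weight t : R := tailw t * (1 - t^-1).

Lemma tailw_gt1 t : 1 < t -> tailw t = t `^ (- 1 - sg).
Proof.
move=> t1; rewrite /tailw indicE mem_set ?mul1r//= ?in_itv/= ?t1// levy_gt0//.
by rewrite (lt_trans ltr01).
Qed.

Lemma tailw_le1 t : t <= 1 -> tailw t = 0.
Proof. by move=> t1; rewrite /tailw indicE memNset ?mul0r//= in_itv/= ltNge t1. Qed.

Lemma tailw_ge0 t : 0 <= tailw t.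
Proof. by rewrite mulr_ge0 ?levy_ge0// indicE. Qed.

Lemma weight_le1 t : t <= 1 -> weight t = 0.
Proof. by move=> t1; rewrite /weight tailw_le1// mul0r. Qed.

Lemma weight_gt1 t : 1 < t -> weight t = t `^ (- 1 - sg) - t `^ (- 2 - sg).
Proof.
move=> t1; have t0 : 0 < t := lt_trans ltr01 t1.
rewrite /weight tailw_gt1// mulrBr mulr1 -powR_inv1 ?(ltW t0)// -powRDp//.
by congr (_ - _ `^ _); ring.
Qed.

Lemma weight_ge0 t : 0 <= weight t.
Proof.
have [t1|t1] := leP t 1; first by rewrite weight_le1.
by rewrite mulr_ge0 ?tailw_ge0// subr_ge0 invf_le1 ?(lt_trans ltr01)// ltW.
Qed.

Lemma weight_le_tailw t : weight t <= tailw t.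
Proof.
have [t1|t1] := leP t 1; first by rewrite weight_le1// tailw_ge0.
by rewrite ler_piMr ?tailw_ge0// gerBl invr_ge0 ltW// (lt_trans ltr01).
Qed.

Lemma tailw_le_weight t : 2 <= t -> tailw t <= 2 * weight t.
Proof.
move=> t2; rewrite /weight mulrCA ler_peMr ?tailw_ge0//.
have t0 : 0 < t := lt_le_trans (ltr0n _ 2) t2.
have : t^-1 <= 2^-1 by rewrite lef_pV2 ?posrE.
by lra.
Qed.

Lemma measurable_tailw : measurable_fun setT tailw.
Proof. by apply: measurable_funM => //; exact: measurable_levy. Qed.

Lemma measurable_weight : measurable_fun setT weight.
Proof.
apply: measurable_funM; first exact: measurable_tailw.
by apply: measurable_funB => //; exact: measurable_inv.
Qed.

Lemma integrable_min_levy : leb.-integrable setT (EFin \o (fun s => Num.min s 1 * levy sg s)).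
Proof.
apply: integrable_ge0_fin; last exact: integral_min_levy.
- by apply: measurable_funM; [exact: measurable_minr|exact: measurable_levy].
- move=> s; have [s0|s0] := leP s 0; first by rewrite levy_le0// mulr0.
  by rewrite mulr_ge0 ?levy_ge0// le_min ltW/=.
Qed.

Lemma integrable_tailw : leb.-integrable setT (EFin \o tailw).
Proof.
apply: integrable_dom integrable_min_levy; first exact: measurable_tailw.
move=> t; rewrite ger0_norm ?tailw_ge0//; have [t1|t1] := leP t 1.
  rewrite tailw_le1//; have [s0|s0] := leP t 0; first by rewrite levy_le0// mulr0.
  by rewrite mulr_ge0 ?levy_ge0// ltW.
by rewrite mul1r tailw_gt1// levy_gt0// (lt_trans ltr01).
Qed.

Lemma integrable_weight : leb.-integrable setT (EFin \o weight).
Proof.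
apply: integrable_dom integrable_tailw; first exact: measurable_weight.
by move=> t; rewrite ger0_norm ?weight_ge0// weight_le_tailw.
Qed.

(** The mean value theorem: as [s <= t/2], the intermediate point is at least [t/2], where the
    derivative has size [t^(-2-sg)]. The constant is [40 = 5 * 8], with [(1 + sg) + (2 + sg) <= 5]
    from the derivative and [2^(2+sg) <= 8] from halving [t]. *)
Lemma weight_lipschitz t s : 1 < t -> 0 < s -> s <= t / 2 ->
  `|weight t - weight (t - s)| <= 40 * s * t `^ (- (2 + sg)).
Proof.
move=> t1 s0 st.
pose p x := x `^ (- 1 - sg) - x `^ (- 2 - sg) : R.
pose dp x := (- 1 - sg) * x `^ (- 1 - sg - 1) - (- 2 - sg) * x `^ (- 2 - sg - 1) : R.
(* The formula [p] vanishes at 1, so it can stand for [weight] with [t - s] clamped at 1, even where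
   [weight] is zero; the mean value theorem then runs inside [[1, t]], where [p] is smooth. *)
pose a := Num.max (t - s) 1.
have a1 : 1 <= a by rewrite le_max lexx orbT.
have at_ : a < t by rewrite gt_max t1 gtrBl s0.
have ta : t - a <= s by rewrite lerBlDl -lerBlDr le_max lexx.
have t2a : t / 2 <= a.
  by rewrite le_max; apply/orP; left; lra.
have -> : weight t = p t by rewrite weight_gt1.
have -> : weight (t - s) = p a.
  rewrite /a; have [ts|ts] := leP (t - s) 1; last by rewrite weight_gt1.
  by rewrite weight_le1// /p !powR1 subrr.
have dP x : 0 < x -> is_derive (x : R) 1 p (dp x).
  by move=> x0; exact: (is_deriveB (is_derive1_powR (- 1 - sg) x0) (is_derive1_powR (- 2 - sg) x0)).
have [||c] := @MVT _ p dp a t at_.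
- move=> x; rewrite in_itv/= => /andP[ax _]; apply: dP.
  by rewrite (lt_trans _ ax)// (lt_le_trans ltr01).
- apply/continuous_in_subspaceT => x; rewrite inE/= in_itv/= => /andP[ax _].
  apply: differentiable_continuous; apply/derivable1_diffP.
  by have [] := dP x (lt_le_trans ltr01 (le_trans a1 ax)).
rewrite in_itv/= => /andP[ac ct] ->.
have c1 : 1 <= c by rewrite (le_trans a1)// ltW.
have c0 : 0 < c := lt_le_trans ltr01 c1.
have t0 : 0 < t := lt_trans ltr01 t1.
have H1 : `|dp c| <= 5 * c `^ (- (2 + sg)).
  rewrite /dp (le_trans (ler_normB _ _))// !normrM.
  rewrite (ger0_norm (powR_ge0 _ _)) (ger0_norm (powR_ge0 _ _)).
  have -> : - 1 - sg - 1 = - (2 + sg) by ring.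
  have -> : - 2 - sg - 1 = - (3 + sg) by ring.
  have -> : `|- 1 - sg| = 1 + sg by rewrite -opprD normrN gtr0_norm// addr_gt0.
  have -> : `|- 2 - sg| = 2 + sg by rewrite -opprD normrN gtr0_norm// addr_gt0.
  have h : c `^ (- (3 + sg)) <= c `^ (- (2 + sg)).
    by rewrite ler_powR// lerN2 lerD2r ler_nat.
  have h0 : 0 <= c `^ (- (3 + sg)) by rewrite powR_ge0.
  rewrite (@le_trans _ _ ((1 + sg) * c `^ (- (2 + sg)) + (2 + sg) * c `^ (- (2 + sg))))//.
    by rewrite lerD2l ler_wpM2l// addr_ge0// ltW.
  have X0 : 0 <= c `^ (- (2 + sg)) * (1 - sg) by rewrite mulr_ge0 ?powR_ge0// subr_ge0 ltW.
  by lra.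
have H2 : c `^ (- (2 + sg)) <= 8 * t `^ (- (2 + sg)).
  apply: (@le_trans _ _ ((t / 2) `^ (- (2 + sg)))).
    by rewrite ler_powRN ?addr_ge0 ?(ltW sg0)// ?divr_gt0// (le_trans t2a)// ltW.
  rewrite powR_half// ler_wpM2r ?powR_ge0//.
  rewrite (@le_trans _ _ (2 `^ 3))//.
    by apply: ler_powR; [by rewrite ler1n|have := sg1; lra].
  by rewrite powR_mulrn// -natrX.
rewrite normrM (@ger0_norm _ (t - a)) ?subr_ge0 ?(ltW at_)//.
rewrite -mulrA mulrCA [leRHS]mulrC -!mulrA mulrC.
rewrite mulrC (@le_trans _ _ (5 * (8 * t `^ (- (2 + sg))) * s))//.
  rewrite ler_pM ?subr_ge0 ?(ltW at_)//.
  by rewrite (le_trans H1)// ler_wpM2l.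
by rewrite le_eqVlt; apply/orP; left; apply/eqP; ring.
Qed.

(** Split at [s = t/2]. Below, [weight] is Lipschitz. Above, [levy s] is at most [4 t^(-1-sg)] and
    multiplies [weight (t - s)], while the part with [weight t] goes into the first term because
    [t <= 2 min(s, t)]. *)
Lemma levy_difference_bound t s : 1 < t ->
  `|(weight t - weight (t - s)) * levy sg s| <=
  40 * t `^ (- (2 + sg)) * (Num.min s t * levy sg s) + 4 * t `^ (- (1 + sg)) * weight (t - s).
Proof.
move=> t1; have t0 : 0 < t := lt_trans ltr01 t1.
have T2 := powR_ge0 t (- (2 + sg)); have T1 := powR_ge0 t (- (1 + sg)).
have [s0|s0] := leP s 0.
  by rewrite levy_le0// !mulr0 normr0 add0r mulr_ge0 ?weight_ge0// mulr_ge0.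
rewrite normrM (ger0_norm (levy_ge0 _ _)).
have L := levy_ge0 sg s.
have [st|st] := leP s (t / 2).
  rewrite (@le_trans _ _ (40 * s * t `^ (- (2 + sg)) * levy sg s))//.
    by rewrite ler_wpM2r// weight_lipschitz.
  have -> : Num.min s t = s by apply/min_idPl; lra.
  rewrite -[leLHS]addr0 lerD//; last by rewrite mulr_ge0 ?weight_ge0// mulr_ge0.
  by rewrite le_eqVlt; apply/orP; left; apply/eqP; ring.
rewrite (@le_trans _ _ ((weight t + weight (t - s)) * levy sg s))//.
  rewrite ler_wpM2r// (le_trans (ler_normB _ _))//.
  by rewrite (ger0_norm (weight_ge0 _)) (ger0_norm (weight_ge0 _)).
rewrite mulrDl lerD//.
  rewrite [leRHS]mulrA ler_wpM2r//.
  apply: (@le_trans _ _ (t `^ (- (1 + sg)))).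
    by rewrite (le_trans (weight_le_tailw _))// tailw_gt1// opprD.
  have -> : t `^ (- (1 + sg)) = t `^ (- (2 + sg)) * t.
    by rewrite mulrC mul_powR//; congr (_ `^ _); ring.
  have tm : t <= 2 * Num.min s t.
    by rewrite -ler_pdivrMl// le_min; apply/andP; split; lra.
  have m0 : 0 <= t `^ (- (2 + sg)) * Num.min s t by rewrite mulr_ge0// le_min !ltW.
  by rewrite (@le_trans _ _ (t `^ (- (2 + sg)) * (2 * Num.min s t))) ?ler_wpM2l//; lra.
rewrite mulrC ler_wpM2r ?weight_ge0//.
rewrite levy_gt0// -opprD (@le_trans _ _ ((t / 2) `^ (- (1 + sg))))//.
  by rewrite ler_powRN ?addr_ge0 ?(ltW sg0)// ?divr_gt0// ltW.
rewrite powR_half// ler_wpM2r//.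
rewrite (@le_trans _ _ (2 `^ 2))//; last by rewrite powR_mulrn// -natrX.
by apply: ler_powR; [by rewrite ler1n|have := sg1; lra].
Qed.

Lemma integral_min_levy_scale t : 0 < t ->
  (\int[leb]_s (Num.min s t * levy sg s)%:E =
   (t `^ (1 - sg))%:E * \int[leb]_s (Num.min s 1 * levy sg s)%:E)%E.
Proof.
move=> t0; have ti0 : 0 < t^-1 by rewrite invr_gt0.
have mm : measurable_fun setT (fun s : R => (Num.min s 1 * levy sg s)%:E).
  apply/measurable_EFinP; apply: measurable_funM; last exact: measurable_levy.
  exact: measurable_minr.
have m0 u s : 0 < u -> (0 <= (Num.min s u * levy sg s)%:E)%E.
  move=> u0; rewrite lee_fin; have [s0|s0] := leP s 0; first by rewrite levy_le0// mulr0.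
  by rewrite mulr_ge0 ?levy_ge0// le_min !ltW.
rewrite [in RHS](ge0_integral_affine 0 ti0)//; last by move=> s; exact: m0.
rewrite muleA -EFinM -ge0_integralZl//.
- apply: eq_integral => s _; rewrite addr0 -EFinM; congr EFin.
  rewrite levy_scale//.
  have -> : Num.min (t^-1 * s) 1 = t^-1 * Num.min s t.
    by rewrite minr_pMr ?invr_ge0 ?(ltW t0)// mulVf ?gt_eqF.
  have -> : t^-1 `^ (-1 - sg) = t `^ (1 + sg).
    by rewrite -powR_inv1 ?(ltW t0)// -powRrM; congr (_ `^ _); ring.
  have E : t `^ (1 - sg) * t^-1 * (t^-1 * t `^ (1 + sg)) = 1.
    rewrite -powR_inv1 ?(ltW t0)// -!powRDp//.
    by rewrite (_ : _ + _ = 0) ?powRr0//; ring.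
  transitivity (t `^ (1 - sg) * t^-1 * (t^-1 * t `^ (1 + sg)) * (Num.min s t * levy sg s)).
    by rewrite E mul1r.
  by ring.
- by have := measurableT_comp mm (measurable_affine t^-1 0).
- by move=> s _; exact: m0.
- by rewrite lee_fin mulr_ge0 ?powR_ge0// ltW.
Qed.

Lemma integral_weight_reflect t :
  (\int[leb]_s (weight (t - s))%:E = \int[leb]_s (weight s)%:E)%E.
Proof.
have mw : measurable_fun setT (EFin \o weight).
  by apply/measurable_EFinP; exact: measurable_weight.
rewrite [RHS](ge0_integral_affine t ltr01)//; last by move=> s; rewrite lee_fin weight_ge0.
rewrite mul1e ge0_integral_opp//.
- by apply: eq_integral => s _; rewrite mul1r opprK addrC.
- apply: (measurableT_comp mw).
  by apply: measurable_funB.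
- by move=> s; rewrite lee_fin weight_ge0.
Qed.

Let A1 := fine (\int[leb]_s (Num.min s 1 * levy sg s)%:E)%E.
Let W1 := fine (\int[leb]_s (weight s)%:E)%E.

(** The first term of the pointwise bound scales to [t^(-2-sg) t^(1-sg) = t^(-1-2 sg)], smaller than
    the tail for [t > 1]. The second is the memory of the mass [W1] and has exactly the size of the
    tail. *)
Lemma integral_levy_difference t :
  (\int[leb]_s `|(weight t - weight (t - s)) * levy sg s|%:E <=
   ((40 * A1 + 4 * W1) * tailw t)%:E)%E.
Proof.
have mw (r : R) : measurable_fun setT (fun s => weight (r - s)).
  by apply: (measurableT_comp measurable_weight); apply: measurable_funB.
have [t1|t1] := leP t 1.
  rewrite tailw_le1// mulr0 (eq_integral (cst 0%E)) ?integral0// => s _ /=.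
  have [s0|s0] := leP s 0; first by rewrite levy_le0// mulr0 normr0.
  by rewrite !weight_le1 ?subrr ?mul0r ?normr0// lerBlDr (le_trans t1)// lerDl ltW.
have t0 : 0 < t := lt_trans ltr01 t1.
pose c1 := 40 * t `^ (- (2 + sg)); pose c2 := 4 * t `^ (- (1 + sg)).
have c10 : 0 <= c1 by rewrite mulr_ge0 ?powR_ge0.
have c20 : 0 <= c2 by rewrite mulr_ge0 ?powR_ge0.
have m0 s : 0 <= Num.min s t * levy sg s.
  have [s0|s0] := leP s 0; first by rewrite levy_le0// mulr0.
  by rewrite mulr_ge0 ?levy_ge0// le_min !ltW.
have mm : measurable_fun setT (fun s => Num.min s t * levy sg s).
  by apply: measurable_funM; [exact: measurable_minr|exact: measurable_levy].
have md : measurable_fun setT (fun s => `|(weight t - weight (t - s)) * levy sg s|).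
  apply: measurableT_comp => //; apply: measurable_funM; last exact: measurable_levy.
  exact: measurable_funB.
apply: (@le_trans _ _ (\int[leb]_s (c1%:E * (Num.min s t * levy sg s)%:E + c2%:E * (weight (t - s))%:E))%E).
  apply: ge0_le_integral => //.
  - exact/measurable_EFinP.
  - by apply: emeasurable_funD; apply: measurable_funeM; apply/measurable_EFinP => //; exact: mw.
  - by move=> s _; rewrite -!EFinM -EFinD lee_fin levy_difference_bound.
rewrite ge0_integralD//; last 4 first.
- by move=> s _; rewrite mule_ge0// lee_fin.
- by apply: measurable_funeM; apply/measurable_EFinP.
- by move=> s _; rewrite mule_ge0// lee_fin weight_ge0.
- by apply: measurable_funeM; apply/measurable_EFinP; exact: mw.
rewrite ge0_integralZl//; [|exact/measurable_EFinP|by move=> s _; rewrite lee_fin].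
rewrite ge0_integralZl//; [|by apply/measurable_EFinP; exact: mw|by move=> s _; rewrite lee_fin weight_ge0].
rewrite integral_min_levy_scale// integral_weight_reflect.
rewrite -(fineK (integrable_fin_num measurableT integrable_min_levy)).
rewrite -(fineK (integrable_fin_num measurableT integrable_weight)).
rewrite -/A1 -/W1 -!EFinM -EFinD lee_fin tailw_gt1// mulrDl lerD//; last first.
  by rewrite /c2 opprD le_eqVlt; apply/orP; left; apply/eqP; ring.
have A0 : 0 <= A1.
  rewrite fine_ge0// integral_ge0// => s _; rewrite lee_fin.
  have [s0|s0] := leP s 0; first by rewrite levy_le0// mulr0.
  by rewrite mulr_ge0 ?levy_ge0// le_min ltW/=.
rewrite (_ : c1 * _ = 40 * A1 * (t `^ (- (2 + sg)) * t `^ (1 - sg))); last first.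
  by rewrite /c1; ring.
rewrite -powRDp// ler_wpM2l ?mulr_ge0//.
by apply: ler_powR; [exact: ltW|have := sg0; lra].
Qed.

(** The Marchaud fractional derivative of order [sg] of [weight], up to a constant; [levy] restricts
    the integral to the past, [s > 0]. *)
Definition dweight t : R := \int[leb]_s ((weight t - weight (t - s)) * levy sg s).

Let measurable_levy_difference t :
  measurable_fun setT (fun s => (weight t - weight (t - s)) * levy sg s).
Proof.
apply: measurable_funM; last exact: measurable_levy.
apply: measurable_funB => //; apply: (measurableT_comp measurable_weight).
exact: measurable_funB.
Qed.

Lemma integrable_levy_difference t :
  leb.-integrable setT (EFin \o (fun s => (weight t - weight (t - s)) * levy sg s)).
Proof.
apply/integrableP; split.
  by apply/measurable_EFinP; exact: measurable_levy_difference.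
by rewrite (le_lt_trans (integral_levy_difference t))// ltry.
Qed.

Lemma dweight_bound : exists2 C : R, 0 <= C & forall t, `|dweight t| <= C * tailw t.
Proof.
exists (40 * A1 + 4 * W1).
  rewrite addr_ge0// mulr_ge0// fine_ge0// integral_ge0// => s _; rewrite lee_fin ?weight_ge0//.
  have [s0|s0] := leP s 0; first by rewrite levy_le0// mulr0.
  by rewrite mulr_ge0 ?levy_ge0// le_min ltW/=.
move=> t; rewrite -lee_fin /dweight EFin_normr_Rintegral//; last exact: integrable_levy_difference.
apply: le_trans (integral_levy_difference t).
by apply: le_abse_integral => //; apply/measurable_EFinP; exact: measurable_levy_difference.
Qed.

Let diff2 (z : measurableTypeR R * measurableTypeR R) : R :=
  (weight z.1 - weight (z.1 - z.2)) * levy sg z.2.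

Let measurable_diff2 : measurable_fun setT diff2.
Proof.
apply: measurable_funM; last first.
  by apply: (measurableT_comp (measurable_levy sg)); exact: measurable_snd.
apply: measurable_funB; apply: (measurableT_comp measurable_weight).
  exact: measurable_fst.
by apply: measurable_funB; [exact: measurable_fst|exact: measurable_snd].
Qed.

Lemma integrable_diff2 : (leb \x leb)%E.-integrable setT (EFin \o diff2).
Proof.
apply/integrable12ltyP; first exact/measurable_EFinP.
apply: (@le_lt_trans _ _ (\int[leb]_t ((40 * A1 + 4 * W1) * tailw t)%:E)%E).
  apply: ge0_le_integral => //.
  - by move=> t _; exact: integral_ge0.
  - have mf2 : measurable_fun setT (fun z => `|(EFin \o diff2) z|%E).
      by apply: measurableT_comp => //; exact/measurable_EFinP.
    exact: (measurable_fun_fubini_tonelli_F (fun z => `|(EFin \o diff2) z|%E) mf2 (fun z => abse_ge0 _)).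
  - apply/measurable_EFinP; apply: measurable_funM => //; exact: measurable_tailw.
  - by move=> t _; exact: integral_levy_difference.
have := integrable_lty measurableT (integrableZR (40 * A1 + 4 * W1) integrable_tailw).
by [].
Qed.

Lemma measurable_dweight : measurable_fun setT dweight.
Proof.
have := measurable_fubini_F integrable_diff2.
move/(measurableT_comp (@fine_measurable R setT measurableT)) => H; exact: H.
Qed.

(** Its value is [Gamma(1 - sg) / sg]; it is divided out in the fractional Laplacian of the test
    function. *)
Definition levy_const : R := \int[leb]_s ((1 - expR (- s)) * levy sg s).

Let expm1_levy_bound l s : 0 <= l -> `|(1 - expR (- (s * l))) * levy sg s| <= Num.max l 1 * (Num.min s 1 * levy sg s).
Proof.
move=> l0; have [s0|s0] := leP s 0; first by rewrite levy_le0// !mulr0 normr0.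
have sl : 0 <= s * l by rewrite mulr_ge0// ltW.
have e1 : expR (- (s * l)) <= 1 by rewrite -expR0 ler_expR oppr_le0.
have e2 := expR_ge1Dx (- (s * l)).
have e3 := expR_ge0 (- (s * l)).
rewrite normrM (ger0_norm (levy_ge0 _ _)) mulrA ler_wpM2r ?levy_ge0//.
rewrite ger0_norm ?subr_ge0//.
have m1 : l <= Num.max l 1 by rewrite le_max lexx.
have m2 : 1 <= Num.max l 1 by rewrite le_max lexx orbT.
have [s1|s1] := leP s 1; last by rewrite mulr1; lra.
by nra.
Qed.

Lemma integrable_expm1_levy l : 0 <= l ->
  leb.-integrable setT (EFin \o (fun s => (1 - expR (- (s * l))) * levy sg s)).
Proof.
move=> l0; apply: integrable_dom (integrableZR (Num.max l 1) integrable_min_levy).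
  apply: measurable_funM; last exact: measurable_levy.
  apply: measurable_funB => //; apply: measurableT_comp => //.
  by apply: measurableT_comp => //; exact: measurable_funM.
by move=> s; exact: expm1_levy_bound.
Qed.

(** The Bernstein representation of [l^sg]: rescaling [s] by [l] brings out the power by homogeneity
    of [levy]. At [l = 0] both sides are zero. *)
Lemma levy_const_scale l : 0 <= l ->
  \int[leb]_s ((1 - expR (- (s * l))) * levy sg s) = levy_const * l `^ sg.
Proof.
rewrite le_eqVlt => /predU1P[<-|l0].
  rewrite powR0 ?gt_eqF// mulr0 (@eq_Rintegral _ _ _ _ _ (cst 0)).
    by rewrite Rintegral_cst// mul0r.
  by move=> s _; rewrite mulr0 oppr0 expR0 subrr mul0r.
have i1 : leb.-integrable setT (EFin \o (fun s => (1 - expR (- s)) * levy sg s)).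
  by have := integrable_expm1_levy ler01; under eq_fun do rewrite mulr1.
apply/EFin_inj; rewrite EFinM /levy_const EFin_Rintegral; last exact/integrable_expm1_levy/ltW.
rewrite EFin_Rintegral//.
have e0 s : 0 <= (1 - expR (- s)) * levy sg s.
  have [s0|s0] := leP s 0; first by rewrite levy_le0// mulr0.
  by rewrite mulr_ge0 ?levy_ge0// subr_ge0 -expR0 ler_expR oppr_le0 ltW.
have mi1 := measurable_int _ i1.
rewrite [in RHS](ge0_integral_affine 0 l0)//.
rewrite muleC muleA -EFinM -ge0_integralZl//.
- apply: eq_integral => s _; rewrite -EFinM addr0 levy_scale//; congr EFin.
  transitivity (l `^ sg * l * l `^ (-1 - sg) * ((1 - expR (- (s * l))) * levy sg s)); last first.
    by rewrite [s * l]mulrC; ring.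
  have -> : l `^ sg * l * l `^ (-1 - sg) = 1.
    rewrite -[X in _ * X * _](powRr1 (ltW l0)) -!powRDp//.
    by rewrite (_ : _ + _ = 0) ?powRr0//; ring.
  by rewrite mul1r.
- by have := measurableT_comp mi1 (measurable_affine l 0).
- by move=> s _; rewrite lee_fin.
- by rewrite lee_fin mulr_ge0 ?powR_ge0// ltW.
Qed.

Lemma levy_const_gt0 : 0 < levy_const.
Proof.
have i1 : leb.-integrable setT (EFin \o (fun s => (1 - expR (- s)) * levy sg s)).
  by have := integrable_expm1_levy ler01; under eq_fun do rewrite mulr1.
(* A lower bound of the integrand on [[1, 2]]: the increasing factor is taken at 1, the decreasing
   one at 2. *)
pose c := (1 - expR (- 1)) * 2 `^ (-1 - sg) : R.
have e1 : expR (- 1) < 1 :> R by rewrite -[ltRHS]expR0 ltr_expR oppr_lt0.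
have c0 : 0 < c by rewrite mulr_gt0 ?powR_gt0// subr_gt0.
apply: (lt_le_trans c0).
rewrite -lee_fin /levy_const EFin_Rintegral//.
apply: (@le_trans _ _ (\int[leb]_s (c * \1_([set` `[1, 2]]) s)%:E)%E).
  under eq_integral do rewrite EFinM.
  rewrite ge0_integralZl//; last first.
  - by rewrite lee_fin ltW.
  - exact/measurable_EFinP.
  rewrite integral_indic//= setIT lebesgue_measure_itv/= lte_fin ltr1n/= -EFinB.
  by rewrite -EFinM lee_fin; lra.
apply: ge0_le_integral => //.
- by move=> s _; rewrite lee_fin mulr_ge0 ?(ltW c0)// indicE.
- by apply/measurable_EFinP; exact: measurable_funM.
- exact: measurable_int i1.
- move=> s _; rewrite lee_fin indicE.
  have [/set_mem|_] := boolP (s \in _).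
    rewrite /= in_itv/= => /andP[s1 s2]; have s0 : 0 < s := lt_le_trans ltr01 s1.
    rewrite mulr1 levy_gt0// ler_pM ?powR_ge0//.
    + by rewrite lerD2l lerN2 ler_expR lerN2.
    + by rewrite -opprD ler_powRN// addr_ge0// ltW.
  rewrite mulr0; have [s0|s0] := leP s 0; first by rewrite levy_le0// mulr0.
  by rewrite mulr_ge0 ?levy_ge0// subr_ge0 -expR0 ler_expR oppr_le0 ltW.
Qed.

Lemma integrable_exp (f : R -> R) l : 0 <= l -> leb.-integrable setT (EFin \o f) ->
  (forall t, t <= 0 -> f t = 0) ->
  leb.-integrable setT (EFin \o (fun t => f t * expR (- (t * l)))).
Proof.
move=> l0 intf f0; apply: integrable_dom (integrable_normR intf).
  apply: measurable_funM; first by have /measurable_EFinP := measurable_int _ intf.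
  by apply: measurableT_comp => //; apply: measurableT_comp => //; exact: measurable_funM.
move=> t; have [t0|t0] := leP t 0; first by rewrite f0// mul0r.
rewrite normrM (ger0_norm (expR_ge0 _)) ler_piMr//.
by rewrite -expR0 ler_expR oppr_le0 mulr_ge0// ltW.
Qed.

Lemma integral_shift_weight l s :
  (\int[leb]_t (weight (t - s) * expR (- (t * l)))%:E =
  (expR (- (s * l)))%:E * \int[leb]_t (weight t * expR (- (t * l)))%:E)%E.
Proof.
have mf : measurable_fun setT (fun t => weight t * expR (- (t * l))).
  apply: measurable_funM; first exact: measurable_weight.
  by apply: measurableT_comp => //; apply: measurableT_comp => //; exact: measurable_funM.
have mwe : measurable_fun setT (fun t => weight (t - s) * expR (- (t * l))).
  apply: measurable_funM.
    by apply: (measurableT_comp measurable_weight); exact: measurable_funB.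
  by apply: measurableT_comp => //; apply: measurableT_comp => //; exact: measurable_funM.
rewrite (ge0_integral_affine s ltr01); last 2 first.
- exact/measurable_EFinP.
- by move=> t; rewrite lee_fin mulr_ge0 ?weight_ge0 ?expR_ge0.
rewrite mul1e -ge0_integralZl//.
- apply: eq_integral => t _; rewrite -EFinM mul1r addrK; congr EFin.
  by rewrite mulrCA -expRD; congr (_ * expR _); ring.
- exact/measurable_EFinP.
- by move=> t _; rewrite lee_fin mulr_ge0 ?weight_ge0 ?expR_ge0.
Qed.

(** After Fubini, shifting [weight] by [s] multiplies its Laplace transform by [e^(-s l)], so the
    transform of the difference factors and the [s]-integral left over is the Bernstein
    representation of [l^sg]. *)
Lemma laplace_dweight l : 0 <= l ->
  \int[leb]_t (dweight t * expR (- (t * l))) =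
  levy_const * l `^ sg * \int[leb]_t (weight t * expR (- (t * l))).
Proof.
move=> l0.
pose G (z : measurableTypeR R * measurableTypeR R) : R := diff2 z * expR (- (z.1 * l)).
have diff20 z : z.1 <= 0 -> diff2 z = 0.
  move=> z0; rewrite /diff2; have [s0|s0] := leP z.2 0; first by rewrite levy_le0// mulr0.
  by rewrite !weight_le1 ?subrr ?mul0r//; lra.
have iG : (leb \x leb)%E.-integrable setT (EFin \o G).
  apply: integrable_dom (integrable_normR integrable_diff2).
    apply: measurable_funM => //; apply: measurableT_comp => //; apply: measurableT_comp => //.
    by apply: measurable_funM => //; exact: measurable_fst.
  move=> z; have [t0|t0] := leP z.1 0; first by rewrite /G diff20// mul0r.
  rewrite normrM (ger0_norm (expR_ge0 _)) ler_piMr//.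
  by rewrite -expR0 ler_expR oppr_le0 mulr_ge0// ltW.
have iw := integrable_exp l0 integrable_weight (fun t (t0 : t <= 0) => weight_le1 (le_trans t0 ler01)).
transitivity (\int[leb]_t \int[leb]_s G (t, s)).
  apply: eq_Rintegral => t _; rewrite /dweight -RintegralZr//.
  exact: integrable_levy_difference.
rewrite RFubini//.
transitivity (\int[leb]_s ((\int[leb]_t (weight t * expR (- (t * l)))) * ((1 - expR (- (s * l))) * levy sg s))).
  apply: eq_Rintegral => s _.
  have iws : leb.-integrable setT (EFin \o (fun t => weight (t - s) * expR (- (t * l)))).
    apply/integrableP; split.
      apply/measurable_EFinP; apply: measurable_funM.
        by apply: (measurableT_comp measurable_weight); exact: measurable_funB.
      by apply: measurableT_comp => //; apply: measurableT_comp => //; exact: measurable_funM.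
    rewrite [X in (X < _)%E](_ : _ = \int[leb]_t (weight (t - s) * expR (- (t * l)))%:E)%E; last first.
      by apply: eq_integral => t _; rewrite /= ger0_norm// mulr_ge0 ?weight_ge0 ?expR_ge0.
    by rewrite integral_shift_weight -EFin_Rintegral// -EFinM ltry.
  transitivity (\int[leb]_t (levy sg s * (weight t * expR (- (t * l)) - weight (t - s) * expR (- (t * l))))).
    by apply: eq_Rintegral => t _; rewrite /G /diff2/=; ring.
  rewrite RintegralZl//; last exact: integrableBR.
  rewrite RintegralB// (_ : \int[leb]_t (weight (t - s) * expR (- (t * l))) =
    expR (- (s * l)) * \int[leb]_t (weight t * expR (- (t * l)))); first by ring.
  by apply/EFin_inj; rewrite EFinM !EFin_Rintegral// integral_shift_weight.
rewrite RintegralZl//; last exact: integrable_expm1_levy.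
by rewrite levy_const_scale// mulrC.
Qed.
End time_weights.

(** * Test functions and integration by parts against them *)

Section test_functions.
Context {R : realType} {n : nat}.
Local Notation V := 'rV[R]_n.
Local Notation mu := (@lebesgue_rV R n).
Implicit Types (psi : V -> R) (s : seq 'I_n).

Lemma ler_coord_norm (x : V) i : `|x ord0 i| <= `|x|.
Proof.
rewrite [leRHS](mx_normrE x).
exact: (@le_bigmax _ _ _ 0 (fun ij : 'I_1 * 'I_n => `|x ij.1 ij.2|) (ord0, i)).
Qed.

Lemma partials_eq0 psi s x : ~ closure [set y | psi y != 0] x -> partials s psi x = 0.
Proof.
set K := closure _; have oK : open (~` K) by apply: closed_openC; exact: closed_closure.
elim: s x => [|i s IH] x Kx /=.
  by apply: contrapT => /eqP px; apply: Kx; exact: subset_closure.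
rewrite /partial (@near_eq_derive _ _ _ _ (cst 0)) ?derive_cst//.
have : nbhs x (~` K) by exact: open_nbhs_nbhs.
by apply: filterS => y; exact: IH.
Qed.

Lemma partials_cat psi s1 s2 : partials (s1 ++ s2) psi = partials s1 (partials s2 psi).
Proof. by rewrite /partials foldr_cat. Qed.

Lemma test_function_partials psi s : test_function psi -> test_function (partials s psi).
Proof.
move=> [smpsi cpsi]; split.
  by move=> s'; rewrite -partials_cat; exact: smpsi.
apply: subclosed_compact cpsi _; first exact: closed_closure.
rewrite [X in _ `<=` X](closure_id _).1; last exact: closed_closure.
apply: closureS => x /=.
by apply: contraNP => /(partials_eq0 s) ->.
Qed.

Lemma test_function_continuous psi : test_function psi -> continuous psi.
Proof. by move=> [/(_ [::])[]]. Qed.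

Lemma test_function_bounded psi : test_function psi ->
  exists2 B : R, 0 <= B & forall x, `|psi x| <= B.
Proof.
move=> tpsi; have cpsi := test_function_continuous tpsi.
have [_ /= cK] := tpsi.
have : compact (psi @` closure [set x | psi x != 0]).
  by apply: continuous_compact => //; exact: continuous_subspaceT.
move/compact_bounded => [M [_ HM]].
exists (Num.max 0 (M + 1)); first by rewrite le_max lexx.
move=> x; have [/eqP ->|px] := boolP (psi x == 0); first by rewrite normr0 le_max lexx.
rewrite le_max; apply/orP; right; apply: (HM (M + 1)); first by rewrite ltrDl.
by exists x => //; exact: subset_closure.
Qed.

Lemma test_function_support psi : test_function psi ->
  exists M : R, forall (x : V) i, M <= `|x ord0 i| -> psi x = 0.
Proof.
move=> [_ /compact_bounded[M [_ HM]]]; exists (M + 2) => x i Mx.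
apply: contrapT => /eqP px.
have Kx : closure [set x | psi x != 0] x by exact: subset_closure.
have /= := HM (M + 1) _ x Kx; rewrite ltrDl ltr01 => /(_ isT).
by have := ler_coord_norm x i; move: `|x ord0 i| `|x| Mx => a b; lra.
Qed.

Lemma test_function_derive psi i x : test_function psi ->
  is_derive x (delta_mx ord0 i : V) psi (partial i psi x).
Proof. by move=> [/(_ [::])[_ d] _]; apply: DeriveDef => //; exact: d. Qed.

Lemma continuous_line (f : V -> R) (e x : V) : continuous f ->
  continuous (fun h : R => f (x + h *: e)).
Proof.
move=> cf h; apply: continuous_comp; last exact: cf.
by apply: cvgD; [exact: cvg_cst|apply: cvgZr_tmp; exact: cvg_id].
Qed.

Lemma derive_continuous_line (f f' : V -> R) (e x : V) :
  (forall y, is_derive y e f (f' y)) -> continuous (fun h : R => f (x + h *: e)).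
Proof.
move=> df h; apply: differentiable_continuous; apply/derivable1_diffP.
have : is_derive (h : R) 1 (fun h : R => f (x + h *: e)) (f' (x + h *: e)).
  apply: is_derive_congr (df (x + h *: e)) => k; congr f.
  by rewrite scalerDl [k *: 1]mulr1 addrCA.
by case.
Qed.

Lemma integrable_mul_bounded (k psi : V -> R) (B : R) : mu.-integrable setT (EFin \o k) ->
  measurable_fun setT psi -> (forall x, `|psi x| <= B) ->
  mu.-integrable setT (EFin \o (fun x => k x * psi x)).
Proof.
move=> ik mpsi bpsi; apply: integrable_dom (integrableZR B (integrable_normR ik)).
  by apply: measurable_funM => //; have /measurable_EFinP := measurable_int _ ik.
by move=> x; rewrite normrM mulrC ler_wpM2r.
Qed.

(** The product [k psi] vanishes for large coordinates, so its partial derivative, given by the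
    product rule, has integral zero. *)
Lemma integral_by_parts_test (k k' : V -> R) psi i : test_function psi ->
  mu.-integrable setT (EFin \o k) -> mu.-integrable setT (EFin \o k') ->
  (forall x, is_derive x (delta_mx ord0 i : V) k (k' x)) ->
  (forall x, continuous (fun h : R => k' (x + h *: delta_mx ord0 i))) ->
  \int[mu]_x (k x * partial i psi x) = - \int[mu]_x (k' x * psi x).
Proof.
move=> tpsi ik ik' dk ck'.
have tdpsi : test_function (partial i psi) := test_function_partials [:: i] tpsi.
have cpsi := test_function_continuous tpsi.
have cdpsi := test_function_continuous tdpsi.
have [B _ HB] := test_function_bounded tpsi.
have [B' _ HB'] := test_function_bounded tdpsi.
have [M HM] := test_function_support tpsi.
have i1 := integrable_mul_bounded ik (continuous_measurable_rV cdpsi) HB'.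
have i2 := integrable_mul_bounded ik' (continuous_measurable_rV cpsi) HB.
apply/eqP; rewrite -addr_eq0 -RintegralD//; apply/eqP.
apply: (@integral_partial_eq0 _ _ i (fun x => k x * psi x) _ M).
- exact: integrableDR.
- move=> x; have := is_deriveM (dk x) (test_function_derive i x tpsi).
  by move/is_derive_eq; apply; rewrite /GRing.scale/= [psi x * _]mulrC.
- move=> x h; apply: cvgD; apply: cvgM.
  + exact: (derive_continuous_line dk).
  + exact: (@continuous_line (partial i psi)).
  + exact: ck'.
  + exact: (@continuous_line psi).
- by move=> x /HM ->; rewrite mulr0.
Qed.
End test_functions.

(** * Membership in L^1 and L^2 by domination *)

Section Lfun_tools.
Context {R : realType} {n : nat}.
Local Notation V := 'rV[R]_n.
Local Notation mu := (@lebesgue_rV R n).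

Lemma Lfun2_sqr (f : V -> R) : measurable_fun setT f ->
  mu.-integrable setT (EFin \o (fun x => f x ^+ 2)) -> f \in Lfun mu 2%:E.
Proof.
move=> mf intf; rewrite inE; apply/andP; split; first by rewrite inE.
rewrite inE/= /finite_norm unlock/= poweR_lty//.
have := integrable_lty measurableT intf.
by under eq_integral do rewrite /= -(real_normK (num_real (f _))) -powR_mulrn//.
Qed.

Lemma in_L12_dom (f h : V -> R) (B : R) : measurable_fun setT f ->
  mu.-integrable setT (EFin \o h) -> (forall x, `|f x| <= h x) -> (forall x, h x <= B) ->
  in_Lp 1%:E f /\ in_Lp 2%:E f.
Proof.
move=> mf ih fh hB.
have ae_refl : f = f %[ae mu] by exact: ae_eq_refl.
split; exists f => //; first by apply/Lfun1_integrable; exact: integrable_dom mf fh ih.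
apply: Lfun2_sqr => //; apply: integrable_dom (integrableZR B ih).
  exact: measurable_funX.
move=> x; rewrite normrX expr2 ler_pM//.
exact: le_trans (hB x).
Qed.
End Lfun_tools.

(** * Mixtures over time of kernels dominated by the heat kernel at doubled time *)

Section mixtures.
Context {R : realType} {n : nat}.
Local Notation V := 'rV[R]_n.
Local Notation leb := (@lebesgue_measure R).
Local Notation mu := (@lebesgue_rV R n).
Variable sg : R.
Hypothesis sg01 : 0 < sg < 1.
Implicit Types (w : R -> R) (k : R -> V -> R) (b : V -> R).

Definition mix w k x : R := \int[leb]_t (w t * k t x).

Lemma measurable_heat_scale c :
  measurable_fun setT (fun z : measurableTypeR R * V => heat (c * z.1) z.2).
Proof.
apply: (measurableT_comp (@measurable_heat2 R n)
  (_ : measurable_fun setT (fun z : measurableTypeR R * V => (c * z.1, z.2)))).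
apply/measurable_fun_pair; last exact: measurable_snd.
by apply: measurable_funM => //; exact: measurable_fst.
Qed.

Lemma integrable_tailw_heat c : 1 <= c ->
  (leb \x mu)%E.-integrable setT
    (EFin \o (fun z : measurableTypeR R * V => tailw sg z.1 * heat (c * z.1) z.2)).
Proof.
move=> c1; apply/integrable12ltyP.
  apply/measurable_EFinP; apply: measurable_funM; last exact: measurable_heat_scale.
  by apply: (measurableT_comp (measurable_tailw sg)); exact: measurable_fst.
rewrite [X in (X < _)%E](_ : _ = \int[leb]_t (tailw sg t)%:E)%E; last first.
  apply: eq_integral => t _ /=; have [t1|t1] := leP t 1.
    by rewrite tailw_le1// (eq_integral (cst 0%E)) ?integral0// => x _; rewrite /= mul0r normr0.
  have ct0 : 0 < c * t by nra.
  rewrite -[RHS]mule1 -(integral_heat n ct0) -ge0_integralZl//.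
  - apply: eq_integral => x _; rewrite /= ger0_norm ?EFinM//.
    by rewrite mulr_ge0 ?tailw_ge0 ?heat_ge0.
  - by apply/measurable_EFinP; exact: measurable_heat.
  - by move=> x _; rewrite lee_fin heat_ge0.
  - by rewrite lee_fin tailw_ge0.
rewrite -EFin_Rintegral ?ltry//; exact: integrable_tailw.
Qed.

Section one_mixture.
Variables (w : R -> R) (k : R -> V -> R) (T C K : R).
Hypotheses (T1 : 1 <= T) (C0 : 0 <= C) (K0 : 0 <= K).
Hypothesis mw : measurable_fun setT w.
Hypothesis wC : forall t, `|w t| <= C * tailw sg t.
Hypothesis mk : measurable_fun setT (fun z : measurableTypeR R * V => k z.1 z.2).
Hypothesis kK : forall t x, 1 < t -> `|k t x| <= K * heat (2 * T * t) x.

Let T2 : 1 <= 2 * T.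
Proof. by have := T1; lra. Qed.

Let T2t t : 1 < t -> 1 <= 2 * T * t.
Proof. by have := T2; move: (2 * T) => a; nra. Qed.

Let w0 t : t <= 1 -> w t = 0.
Proof. by move=> t1; have := wC t; rewrite tailw_le1// mulr0 normr_le0 => /eqP. Qed.

Let wkCK t x : `|w t * k t x| <= C * K * (tailw sg t * heat (2 * T * t) x).
Proof.
have [t1|t1] := leP t 1; first by rewrite w0// tailw_le1// !mul0r normr0 mulr0.
by rewrite normrM mulrACA ler_pM// kK.
Qed.

Lemma integrable_mix2 : (leb \x mu)%E.-integrable setT
  (EFin \o (fun z : measurableTypeR R * V => w z.1 * k z.1 z.2)).
Proof.
apply: integrable_dom (integrableZR (C * K) (integrable_tailw_heat T2)).
  by apply: measurable_funM => //; apply: (measurableT_comp mw); exact: measurable_fst.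
by move=> z; exact: wkCK.
Qed.

Lemma integrable_mix_time x : leb.-integrable setT (EFin \o (fun t => w t * k t x)).
Proof.
have := integrableZR (C * K) (integrable_tailw sg01).
apply: integrable_dom.
  apply: measurable_funM => //.
  apply: (measurableT_comp mk (_ : measurable_fun setT (fun t : measurableTypeR R => (t, x)))).
  exact/measurable_fun_pair.
move=> t; apply: le_trans (wkCK t x) _.
rewrite ler_wpM2l ?mulr_ge0//.
have [t1|t1] := leP t 1; first by rewrite tailw_le1// mul0r.
by rewrite ler_piMr ?tailw_ge0// heat_le1// T2t.
Qed.

Lemma integrable_mix_space t : 1 < t -> mu.-integrable setT (EFin \o k t).
Proof.
move=> t1; have t0 : 0 < 2 * T * t := lt_le_trans ltr01 (T2t t1).
apply: integrable_dom (integrableZR K (integrable_heat n t0)).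
  apply: (measurableT_comp mk (_ : measurable_fun setT (fun x : V => (t, x)))).
  exact/measurable_fun_pair.
by move=> x; exact: kK.
Qed.

Lemma measurable_mix : measurable_fun setT (mix w k).
Proof.
have := measurable_fubini_G integrable_mix2.
move/(measurableT_comp (@fine_measurable R setT measurableT)) => H; exact: H.
Qed.

Lemma integral_mix b B : measurable_fun setT b -> (forall x, `|b x| <= B) ->
  \int[mu]_x (mix w k x * b x) = \int[leb]_t (w t * \int[mu]_x (k t x * b x)).
Proof.
move=> mb bB.
transitivity (\int[mu]_x \int[leb]_t (w t * k t x * b x)).
  apply: eq_Rintegral => x _; rewrite /mix -RintegralZr//.
  exact: integrable_mix_time.
have F := @RFubini _ _ _ _ _ leb mu (fun z : measurableTypeR R * V => w z.1 * k z.1 z.2 * b z.2).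
transitivity (\int[leb]_t \int[mu]_x (w t * k t x * b x)).
  apply/esym/F; apply: integrable_dom (integrableZR B (integrable_normR integrable_mix2)).
    apply: measurable_funM.
      by have /measurable_EFinP := measurable_int _ integrable_mix2.
    by apply: (measurableT_comp mb); exact: measurable_snd.
  by move=> z; rewrite normrM mulrC ler_wpM2r.
apply: eq_Rintegral => t _.
have [t1|t1] := leP t 1.
  rewrite w0// mul0r (@eq_Rintegral _ _ _ _ _ (cst 0)); last by move=> x _; rewrite /= !mul0r.
  by rewrite Rintegral_cst// mul0r.
rewrite -RintegralZl//; first by apply: eq_Rintegral => x _; rewrite mulrA.
exact: integrable_mul_bounded (integrable_mix_space t1) mb bB.
Qed.

Lemma mix_le_tail x :
  `|mix w k x| <= C * K * \int[leb]_t (tailw sg t * heat (2 * T * t) x).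
Proof.
have it : leb.-integrable setT (EFin \o (fun t => tailw sg t * heat (2 * T * t) x)).
  apply: integrable_dom (integrable_tailw sg01).
    apply: measurable_funM; first exact: measurable_tailw.
    apply: (measurableT_comp (measurable_heat_scale (2 * T))
      (_ : measurable_fun setT (fun t : measurableTypeR R => (t, x)))).
    exact/measurable_fun_pair.
  move=> t; rewrite normrM (ger0_norm (tailw_ge0 _ _)) (ger0_norm (heat_ge0 _ _)).
  have [t1|t1] := leP t 1; first by rewrite tailw_le1// mul0r.
  by rewrite ler_piMr ?tailw_ge0// heat_le1// T2t.
rewrite -RintegralZl//; apply: le_trans (le_normr_Rintegral _ (integrable_mix_time x)) _ => //.
apply: le_Rintegral => //.
- exact/integrable_normR/integrable_mix_time.
- exact: integrableZR.
Qed.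
End one_mixture.

End mixtures.
Lemma sqrt2X_ge0 (R : realType) n : 0 <= Num.sqrt 2 ^+ n :> R.
Proof. by rewrite exprn_ge0. Qed.

Lemma weight_dominated (R : realType) (sg t : R) : `|weight sg t| <= 1 * tailw sg t.
Proof. by rewrite ger0_norm ?weight_ge0// mul1r weight_le_tailw. Qed.

Lemma heat_dominated (R : realType) n (T : R) : 1 <= T -> forall t (x : 'rV[R]_n), 1 < t ->
  `|heat (T * t) x| <= Num.sqrt 2 ^+ n * heat (2 * T * t) x.
Proof.
move=> T1 t x t1; rewrite ger0_norm ?heat_ge0// -mulrA heat_double//.
by rewrite mulr_gt0// ?(lt_trans ltr01 t1)// (lt_le_trans ltr01 T1).
Qed.

(** * The test function, and domination by it *)

Section phi.
Context {R : realType} {n : nat}.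
Local Notation V := 'rV[R]_n.
Local Notation leb := (@lebesgue_measure R).
Local Notation mu := (@lebesgue_rV R n).
Variables (sg T : R).
Hypotheses (sg01 : 0 < sg < 1) (T1 : 1 <= T).

Definition phi (x : V) : R := mix (weight sg) (fun t => heat (T * t)) x.

Let bw := weight_dominated sg.

Let bh := @heat_dominated R n T T1.

Let s20 := sqrt2X_ge0 R n.

Lemma integrable_phi_time (x : V) :
  leb.-integrable setT (EFin \o (fun t => weight sg t * heat (T * t) x)).
Proof.
exact: (integrable_mix_time sg01 T1 ler01 s20 (measurable_weight sg) bw (measurable_heat_scale T) bh).
Qed.

Lemma measurable_phi : measurable_fun setT phi.
Proof.
exact: (measurable_mix sg01 T1 (measurable_weight sg) bw (measurable_heat_scale T) bh).
Qed.

Lemma integral_phi_test (b : V -> R) B : measurable_fun setT b -> (forall x, `|b x| <= B) ->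
  \int[mu]_x (phi x * b x) = \int[leb]_t (weight sg t * \int[mu]_x (heat (T * t) x * b x)).
Proof.
exact: (integral_mix sg01 T1 ler01 s20 (measurable_weight sg) bw (measurable_heat_scale T) bh).
Qed.

Lemma phi_ge0 x : 0 <= phi x.
Proof. by apply: Rintegral_ge0 => t _; rewrite mulr_ge0 ?weight_ge0 ?heat_ge0. Qed.

Lemma phi_le x : phi x <= \int[leb]_t (weight sg t).
Proof.
apply: le_Rintegral => //; [exact: integrable_phi_time|exact: integrable_weight|].
move=> t _; have [t1|t1] := leP t 1; first by rewrite weight_le1// mul0r.
by rewrite ler_piMr ?weight_ge0// heat_le1//; have := T1; nra.
Qed.

Lemma integrable_phi : mu.-integrable setT (EFin \o phi).
Proof.
have I := integrable_mix2 sg01 T1 (measurable_weight sg) bw (measurable_heat_scale T) bh.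
apply: integrable_ge0_fin; [exact: measurable_phi|exact: phi_ge0|].
have mI := measurable_int _ I.
have := (integrable21ltyP leb mu mI).1 I.
rewrite (_ : (\int[mu]_x (phi x)%:E)%E = (\int[mu]_y \int[leb]_t
  `|(EFin \o (fun z : measurableTypeR R * V => (weight sg z.1 * heat (T * z.1) z.2)%R)) (t, y)|)%E)//.
apply: eq_integral => x _; rewrite /phi /mix EFin_Rintegral; last exact: integrable_phi_time.
apply: eq_integral => t _ /=.
by rewrite ger0_norm// mulr_ge0 ?weight_ge0 ?heat_ge0.
Qed.

(** The substitution [t -> t/2] undoes the doubling of time and leaves the weight [tailw (t/2)].
    This lives on [t > 2], where it equals [2^(1+sg) t^(-1-sg)] and the taper of [weight] costs a
    factor 2; the Jacobian returns a factor [1/2]. *)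
Lemma tail_le_phi x :
  \int[leb]_t (tailw sg t * heat (2 * T * t) x) <= 2 `^ (1 + sg) * phi x.
Proof.
have mf (a b : R) : measurable_fun setT (fun t => tailw sg (a * t) * heat (b * t) x).
  apply: measurable_funM.
    by apply: (measurableT_comp (measurable_tailw sg)); exact: measurable_funM.
  apply: (measurableT_comp (measurable_heat_scale b)
      (_ : measurable_fun setT (fun t : measurableTypeR R => (t, x)))).
  exact/measurable_fun_pair.
have f0 (a b t : R) : 0 <= tailw sg (a * t) * heat (b * t) x.
  by rewrite mulr_ge0 ?tailw_ge0 ?heat_ge0.
have wE t : tailw sg (2^-1 * t) <= 2 `^ (2 + sg) * weight sg t.
  have [t2|t2] := leP t 2; first by (have h : 2^-1 * t <= 1 by lra); rewrite tailw_le1// mulr_ge0 ?powR_ge0 ?weight_ge0.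
  rewrite tailw_gt1; last by lra.
  have t0 : 0 < t by lra.
  rewrite -opprD mulrC powR_half//.
  have -> : 2 `^ (2 + sg) = 2 * 2 `^ (1 + sg) :> R.
    by rewrite mul_powR//; congr (_ `^ _); ring.
  have := tailw_le_weight sg (ltW t2); rewrite tailw_gt1; last by lra.
  rewrite -opprD => H; have := powR_ge0 2 (1 + sg) => P; nra.
have It : leb.-integrable setT (EFin \o (fun t => 2 `^ (2 + sg) * (weight sg t * heat (T * t) x))).
  exact/integrableZR/integrable_phi_time.
rewrite -lee_fin.
have i1 : leb.-integrable setT (EFin \o (fun t => tailw sg (2^-1 * t) * heat (T * t) x)).
  apply: integrable_dom It; [exact: mf|move=> t].
  by rewrite ger0_norm// mulrA ler_wpM2r ?heat_ge0.
have E2 : (2%:E * \int[leb]_t (tailw sg t * heat (2 * T * t) x)%:E =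
    \int[leb]_t (tailw sg (2^-1 * t) * heat (T * t) x)%:E)%E.
  rewrite [RHS](ge0_integral_affine 0 (ltr0Sn R 1)).
  - congr (_ * _)%E; apply: eq_integral => t _; rewrite addr0 (mulrA 2^-1) mulVf// mul1r.
    by rewrite (mulrCA T) mulrA.
  - by apply/measurable_EFinP; exact: mf.
  - by move=> t; rewrite lee_fin.
have i2 : leb.-integrable setT (EFin \o (fun t => tailw sg t * heat (2 * T * t) x)).
  apply: integrable_ge0_fin.
  - by have := mf 1 (2 * T); under eq_fun do rewrite mul1r.
  - by move=> t; rewrite mulr_ge0 ?tailw_ge0 ?heat_ge0.
  suff : (\int[leb]_t (tailw sg t * heat (2 * T * t) x)%:E < +oo)%E by [].
  have -> : (\int[leb]_t (tailw sg t * heat (2 * T * t) x)%:E =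
      (2^-1)%:E * \int[leb]_t (tailw sg (2^-1 * t) * heat (T * t) x)%:E)%E.
    by rewrite -E2 muleA -EFinM mulVf// mul1e.
  by rewrite -EFin_Rintegral// -EFinM ltry.
rewrite lee_fin -(@ler_pM2l _ 2)// -lee_fin EFinM EFin_Rintegral// E2 -EFin_Rintegral// lee_fin.
apply: (@le_trans _ _ (\int[leb]_t (2 `^ (2 + sg) * (weight sg t * heat (T * t) x)))).
  apply: le_Rintegral => // t _.
  by rewrite mulrA ler_wpM2r ?heat_ge0.
rewrite RintegralZl//; last exact: integrable_phi_time.
rewrite mulrA mul_powR//.
by rewrite (_ : 1 + (1 + sg) = 2 + sg)//; ring.
Qed.

Lemma mix_le_phi (w : R -> R) (k : R -> V -> R) C K x : 0 <= C -> 0 <= K ->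
  measurable_fun setT w -> (forall t, `|w t| <= C * tailw sg t) ->
  measurable_fun setT (fun z : measurableTypeR R * V => k z.1 z.2) ->
  (forall t x, 1 < t -> `|k t x| <= K * heat (2 * T * t) x) ->
  `|mix w k x| <= C * K * 2 `^ (1 + sg) * phi x.
Proof.
move=> C0 K0 mw wC mk kK.
apply: le_trans (mix_le_tail sg01 T1 C0 K0 mw wC mk kK x) _.
by rewrite -[leRHS]mulrA ler_wpM2l ?mulr_ge0// tail_le_phi.
Qed.

Lemma phi_dom_in_Lp (f : V -> R) B : 0 <= B -> measurable_fun setT f ->
  (forall x, `|f x| <= B * phi x) -> in_Lp 1%:E f /\ in_Lp 2%:E f.
Proof.
move=> B0 mf fB; apply: (in_L12_dom (B := B * \int[leb]_t (weight sg t)) mf (integrableZR B integrable_phi)) => //.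
by move=> x; rewrite ler_wpM2l// phi_le.
Qed.

End phi.

(** The times [2 <= t <= 3] suffice. There [weight] is at least half of [3^(-1-sg)], since the taper
    is harmless from 2 on, and for [|x|^2 <= T] the kernel at time [T t] is at least
    [(12 pi T)^(-n/2) e^(-1)]. *)
Lemma phi_lower (R : realType) n (sg : R) : 0 < sg < 1 -> exists2 c : R, 0 < c &
  forall (T : R) (x : 'rV[R]_n), 1 <= T -> dot x x <= T -> c * (Num.sqrt T)^-1 ^+ n <= phi sg T x.
Proof.
move=> sg01; have /andP[sg0 sg1] := sg01.
pose a : R := (Num.sqrt (12 * pi))^-1 ^+ n * expR (-1).
have pi0 := @pi_gt0 R.
have a0 : 0 < a by rewrite mulr_gt0 ?expR_gt0// exprn_gt0// invr_gt0 sqrtr_gt0 mulr_gt0.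
pose d : R := 3 `^ (- (1 + sg)) / 2.
have d0 : 0 < d by rewrite divr_gt0 ?powR_gt0.
exists (d * a); first exact: mulr_gt0.
move=> T x T1 xT; have T0 : 0 < T := lt_le_trans ltr01 T1.
set b := d * a * _.
have b0 : 0 <= b by rewrite mulr_ge0 ?exprn_ge0 ?invr_ge0// mulr_ge0// ltW.
rewrite -lee_fin /phi /mix EFin_Rintegral; last exact: integrable_phi_time.
apply: (@le_trans _ _ (\int[@lebesgue_measure R]_s (b * \1_([set` `[2, 3]]) s)%:E)%E).
  under eq_integral do rewrite EFinM.
  rewrite ge0_integralZl//; last exact/measurable_EFinP.
  rewrite integral_indic//= setIT lebesgue_measure_itv/= lte_fin ltr_nat/= -EFinB.
  by rewrite -EFinM lee_fin (_ : 3 - 2 = 1) ?mulr1//; ring.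
apply: ge0_le_integral => //.
- by move=> s _; rewrite lee_fin mulr_ge0// indicE.
- by apply/measurable_EFinP; exact: measurable_funM.
- by have := measurable_int _ (integrable_phi_time sg01 T1 x).
- move=> t _; rewrite lee_fin indicE.
  have [/set_mem|_] := boolP (t \in _); last first.
    by rewrite mulr0 mulr_ge0 ?weight_ge0 ?heat_ge0.
  rewrite /= in_itv/= mulr1 => /andP[t2 t3].
  have t0 : 0 < t by lra.
  rewrite /b -[leLHS]mulrA ler_pM ?(ltW d0)//.
  + by rewrite mulr_ge0 ?(ltW a0)// exprn_ge0 ?invr_ge0.
  + have := tailw_le_weight sg t2; rewrite tailw_gt1; last by lra.
    have : 3 `^ (- (1 + sg)) <= t `^ (- (1 + sg)) by rewrite ler_powRN// addr_ge0// ltW.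
    by rewrite -opprD /d; move: (_ `^ _) (_ `^ _) => u v; lra.
  rewrite /a mulrAC /heat -exprMn ler_pM ?expR_ge0 ?exprn_ge0 ?mulr_ge0 ?invr_ge0//.
    apply: lerXn2r; rewrite ?nnegrE ?mulr_ge0 ?invr_ge0//.
    rewrite -invfM -sqrtrM ?mulr_ge0 ?(ltW pi0)// lef_pV2 ?posrE ?sqrtr_gt0 ?mulr_gt0//.
    rewrite ler_sqrt ?mulr_ge0 ?(ltW pi0) ?(ltW T0)//.
    rewrite (_ : 4 * pi * (T * t) = 4 * t * (pi * T)); last by ring.
    rewrite (_ : 12 * pi * T = 12 * (pi * T)); last by ring.
    by rewrite ler_wpM2r ?mulr_ge0 ?(ltW pi0) ?(ltW T0)//; lra.
  rewrite ler_expR lerN2 ler_pdivrMr ?mulr_gt0// mul1r (le_trans xT)//.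
  nra.
Qed.

(** * Fourier transforms of mixtures *)

Section fourier_of_mixtures.
Context {R : realType} {n : nat}.
Local Notation V := 'rV[R]_n.
Local Notation leb := (@lebesgue_measure R).
Local Notation mu := (@lebesgue_rV R n).

(** When [f] is already in L^1 and L^2, the constant sequence is an admissible approximation and
    both norms are zero. *)
Lemma is_fourier_integral (f : V -> R) (F : V -> R[i]) :
  in_Lp 1%:E f -> in_Lp 2%:E f ->
  in_Lp 2%:E (fun xi => complex.Re (F xi)) -> in_Lp 2%:E (fun xi => complex.Im (F xi)) ->
  (forall xi, fourier_integral f xi = F xi) -> is_fourier f F.
Proof.
move=> f1 f2 F1 F2 fF; split => //; exists (fun=> f); split => //.
  rewrite (_ : (fun _ => _) = cst 0%E); first exact: cvg_cst.
  apply/funext => k /=.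
  rewrite (_ : EFin \o _ = cst 0%E) ?Lnorm0 ?gt_eqF//.
  by apply/funext => x /=; rewrite subrr.
rewrite (_ : (fun _ => _) = cst 0%E); first exact: cvg_cst.
apply/funext => k /=.
rewrite (_ : _ \o (fourier_integral f \- F) = cst 0%E) ?Lnorm0 ?gt_eqF//.
apply/funext => x /=; rewrite fF subrr.
by rewrite Normc.normc0.
Qed.

Lemma gauss_heat (x : V) :
  expR (- (dot x x / 2)) = Num.sqrt (2 * pi) ^+ n * heat 2^-1 x.
Proof.
rewrite /heat mulrA.
have -> : 4 * pi * 2^-1 = 2 * pi :> R by lra.
have -> : 4 * 2^-1 = 2 :> R by lra.
rewrite -exprMn divff ?expr1n ?mul1r//.
by rewrite gt_eqF// sqrtr_gt0 mulr_gt0// pi_gt0.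
Qed.

(** Used on the frequency side: the Laplace transform of a weight carried by [t > 1] inherits
    Gaussian decay in [xi]. *)
Lemma gauss_dom_in_Lp (f : V -> R) B : 0 <= B -> measurable_fun setT f ->
  (forall x, `|f x| <= B * expR (- (dot x x / 2))) -> in_Lp 1%:E f /\ in_Lp 2%:E f.
Proof.
move=> B0 mf fB.
apply: (in_L12_dom (h := fun x => B * expR (- (dot x x / 2))) (B := B) mf) => //.
  rewrite (_ : (fun x : V => _) = (fun x : V => B * Num.sqrt (2 * pi) ^+ n * heat 2^-1 x)).
    by apply: integrableZR; apply: integrable_heat; rewrite invr_gt0.
  by apply/funext => x; rewrite gauss_heat mulrA.
by move=> x; rewrite ler_piMr// -expR0 ler_expR oppr_le0 divr_ge0 ?dot_ge0.
Qed.

(** By Fubini the kernel at time [T t] contributes [e^(-t T |xi|^2)], so the Fourier transform of a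
    mixture is the Laplace transform of its weight at [T |xi|^2]; the sine part vanishes. *)
Lemma fourier_mix (sg T C : R) (w : R -> R) (xi : V) :
  0 < sg < 1 -> 1 <= T -> 0 <= C -> measurable_fun setT w ->
  (forall t, `|w t| <= C * tailw sg t) ->
  fourier_integral (mix w (fun t => heat (T * t))) xi =
  Complex (\int[leb]_t (w t * expR (- (t * (T * dot xi xi))))) 0.
Proof.
move=> sg01 T1 C0 mw wC; have T0 : 0 < T := lt_le_trans ltr01 T1.
have w0 t : t <= 1 -> w t = 0.
  by move=> t1; have := wC t; rewrite tailw_le1// mulr0 normr_le0 => /eqP.
have s20 := sqrt2X_ge0 R n.
have bh := @heat_dominated R n T T1.
have IM := integral_mix sg01 T1 C0 s20 mw wC (measurable_heat_scale T) bh.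
have mcos : measurable_fun setT (fun x : V => cos (dot x xi)).
  exact: measurableT_comp (continuous_measurable_fun (@continuous_cos R)) (measurable_dotr xi).
have msin : measurable_fun setT (fun x : V => sin (dot x xi)).
  exact: measurableT_comp (continuous_measurable_fun (@continuous_sin R)) (measurable_dotr xi).
have bcos (x : V) : `|cos (dot x xi)| <= 1 :> R by rewrite ler_norml cos_geN1 cos_le1.
have bsin (x : V) : `|sin (dot x xi)| <= 1 :> R by rewrite ler_norml sin_geN1 sin_le1.
have FH t : 1 < t -> \int[mu]_x (heat (T * t) x * cos (dot x xi)) = expR (- (t * (T * dot xi xi))) /\
    \int[mu]_x (heat (T * t) x * sin (dot x xi)) = 0.
  move=> t1; have t0 : 0 < T * t by rewrite mulr_gt0// (lt_trans ltr01).
  have [hc hs] := fourier_heat xi t0; split.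
    rewrite mulrA [t * T]mulrC -hc; apply: eq_Rintegral => x _; exact: mulrC.
  by rewrite -hs; apply: eq_Rintegral => x _; exact: mulrC.
rewrite /fourier_integral (IM _ 1 mcos bcos) (IM _ 1 msin bsin); congr Complex.
  apply: eq_Rintegral => t _; have [t1|t1] := leP t 1; first by rewrite w0// !mul0r.
  by rewrite (FH _ t1).1.
rewrite (@eq_Rintegral _ _ _ _ _ (cst 0)); first by rewrite Rintegral_cst// mul0r oppr0.
move=> t _; have [t1|t1] := leP t 1; first by rewrite w0// !mul0r.
by rewrite (FH _ t1).2 mulr0.
Qed.

Definition laplace_weight (sg l : R) : R := \int[leb]_t (weight sg t * expR (- (t * l))).

Section laplace_weight.
Variable sg : R.
Hypothesis sg01 : 0 < sg < 1.

Lemma laplace_weight_ge0 l : 0 <= laplace_weight sg l.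
Proof. by apply: Rintegral_ge0 => t _; rewrite mulr_ge0 ?weight_ge0 ?expR_ge0. Qed.

Lemma integrable_laplace_weight l : 0 <= l ->
  leb.-integrable setT (EFin \o (fun t => weight sg t * expR (- (t * l)))).
Proof.
move=> l0; apply: integrable_exp => //; first exact: integrable_weight.
by move=> t t0; rewrite weight_le1// (le_trans t0).
Qed.

Lemma laplace_weight_le l : 0 <= l ->
  laplace_weight sg l <= (\int[leb]_t weight sg t) * expR (- l).
Proof.
move=> l0; rewrite /laplace_weight -RintegralZr//; last exact: integrable_weight.
apply: le_Rintegral => //.
- exact: integrable_laplace_weight.
- have := integrableZR (expR (- l)) (integrable_weight sg01).
  by under eq_fun do rewrite mulrC.
move=> t _; have [t1|t1] := leP t 1; first by rewrite weight_le1// !mul0r.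
by rewrite ler_wpM2l ?weight_ge0// ler_expR lerN2 ler_peMl// ltW.
Qed.

Lemma measurable_laplace_weight T :
  measurable_fun setT (fun xi : V => laplace_weight sg (T * dot xi xi)).
Proof.
pose G (z : measurableTypeR R * V) : \bar R :=
  (weight sg z.1 * expR (- (z.1 * (T * dot z.2 z.2))))%:E.
have mG : measurable_fun setT G.
  apply/measurable_EFinP; apply: measurable_funM.
    by apply: (measurableT_comp (measurable_weight sg)); exact: measurable_fst.
  apply: measurableT_comp => //; apply: measurableT_comp => //.
  apply: measurable_funM; first exact: measurable_fst.
  apply: measurable_funM => //.
  by apply: (measurableT_comp (@measurable_dot R n)); exact: measurable_snd.
have := @measurable_fun_fubini_tonelli_G _ _ _ _ _ leb G mG.
move=> /(_ (fun z => _)) H.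
have G0 z : (0 <= G z)%E by rewrite lee_fin mulr_ge0 ?weight_ge0 ?expR_ge0.
have {}H := measurableT_comp (@fine_measurable R setT measurableT) (H G0).
exact: H.
Qed.
End laplace_weight.

End fourier_of_mixtures.

(** Read [d] as [|xi|^2], [e] as [e^(-d/2)], [e'] as [e^(-T d)], [L] as the Laplace transform of the
    weight at [T d] and [W] as the mass of the weight. One of the two factors [e] absorbs
    [1 + d]. *)
Lemma laplace_weight_decay (R : realFieldType) (d W e e' L : R) : 0 <= d -> 0 <= W -> 0 <= e ->
  (1 + d / 2) * e <= 1 -> e' <= e * e -> L <= W * e' -> (1 + d) * L <= 2 * W * e.
Proof.
move=> d0 W0 e0 H1 H2 H3.
have H6 : L <= W * (e * e) by rewrite (le_trans H3)// ler_wpM2l.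
have H7 : (1 + d) * L <= (1 + d) * (W * (e * e)) by rewrite ler_wpM2l// addr_ge0.
have H8 : (1 + d) * e <= 2 by nra.
apply: (le_trans H7); rewrite (_ : _ * _ = W * e * ((1 + d) * e)); last by ring.
rewrite (_ : 2 * W * e = W * e * 2); last by ring.
by rewrite ler_wpM2l// mulr_ge0.
Qed.

(** * The fractional Laplacian of the test function *)

Section phi_operators.
Context {R : realType} {n : nat}.
Local Notation V := 'rV[R]_n.
Local Notation leb := (@lebesgue_measure R).
Local Notation mu := (@lebesgue_rV R n).
Variables (sg T : R).
Hypotheses (sg01 : 0 < sg < 1) (T1 : 1 <= T).

Let T0 : 0 < T := lt_le_trans ltr01 T1.
Let s20 := sqrt2X_ge0 R n.
Let W0 : 0 <= \int[leb]_t weight sg t.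
Proof. by apply: Rintegral_ge0 => t _; exact: weight_ge0. Qed.
Let bw := weight_dominated sg.
Let bh := @heat_dominated R n T T1.

Lemma phi_in_Lp : in_Lp 1%:E (@phi R n sg T) /\ in_Lp 2%:E (@phi R n sg T).
Proof.
apply: (phi_dom_in_Lp sg01 T1 ler01); first exact: measurable_phi.
by move=> x; rewrite ger0_norm ?phi_ge0// mul1r.
Qed.

Lemma enorm_powR (xi : V) : enorm xi `^ (2 * sg) = dot xi xi `^ sg.
Proof. by rewrite /enorm -powR12_sqrt ?dot_ge0// -powRrM mulrA mulVf// mul1r. Qed.

Lemma fourier_phi (xi : V) :
  fourier_integral (phi sg T) xi = Complex (laplace_weight sg (T * dot xi xi)) 0.
Proof. exact: (fourier_mix xi sg01 T1 ler01 (measurable_weight sg) bw). Qed.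

(** The Laplace transform of [dweight] at [T |xi|^2] carries the factor
    [levy_const T^sg |xi|^(2 sg)]. The prefactor cancels all but the multiplier, and its power
    [T^(-sg)] is the decay on which the argument rests. *)
Definition phi_fl (x : V) : R :=
  mix (fun t => T `^ (- sg) / levy_const sg * dweight sg t) (fun t => heat (T * t)) x.

Let cl0 : 0 <= T `^ (- sg) / levy_const sg.
Proof. by rewrite divr_ge0 ?powR_ge0// ltW// levy_const_gt0. Qed.

Let mdw : measurable_fun setT (fun t => T `^ (- sg) / levy_const sg * dweight sg t).
Proof. by apply: measurable_funM => //; exact: measurable_dweight. Qed.

Section bound.
Variable C : R.
Hypotheses (C0 : 0 <= C) (dC : forall t, `|dweight sg t| <= C * tailw sg t).

Let dC' t : `|T `^ (- sg) / levy_const sg * dweight sg t| <=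
  T `^ (- sg) / levy_const sg * C * tailw sg t.
Proof. by rewrite normrM (ger0_norm cl0) -mulrA ler_wpM2l. Qed.

Let C0' : 0 <= T `^ (- sg) / levy_const sg * C.
Proof. exact: mulr_ge0. Qed.

Lemma phi_fl_bound x : `|phi_fl x| <=
  T `^ (- sg) / levy_const sg * C * Num.sqrt 2 ^+ n * 2 `^ (1 + sg) * phi sg T x.
Proof. exact: (mix_le_phi sg01 T1 x C0' s20 mdw dC' (measurable_heat_scale T) bh). Qed.

Lemma measurable_phi_fl : measurable_fun setT phi_fl.
Proof. exact: (measurable_mix sg01 T1 mdw dC' (measurable_heat_scale T) bh). Qed.

Lemma fourier_phi_fl (xi : V) : fourier_integral phi_fl xi =
  Complex (dot xi xi `^ sg * laplace_weight sg (T * dot xi xi)) 0.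
Proof.
rewrite (fourier_mix xi sg01 T1 C0' mdw dC'); congr Complex.
have d0 := dot_ge0 xi; have Td0 : 0 <= T * dot xi xi by rewrite mulr_ge0// ltW.
transitivity (\int[leb]_t (T `^ (- sg) / levy_const sg * (dweight sg t * expR (- (t * (T * dot xi xi)))))).
  by apply: eq_Rintegral => t _; rewrite -[LHS]mulrA.
rewrite RintegralZl//; last first.
  apply: integrable_exp => //.
    apply: integrable_dom (integrableZR C (integrable_tailw sg01)) => //.
    exact: measurable_dweight.
  move=> t t0; have := dC t; rewrite tailw_le1 ?(le_trans t0)// mulr0.
  by rewrite normr_le0 => /eqP.
rewrite laplace_dweight// powRM ?(ltW T0)// -/(laplace_weight _ _).
have l0 := levy_const_gt0 sg01.
rewrite powRN; have := powR_gt0 sg T0; move: (T `^ sg) => a a0.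
by field; rewrite !gt_eqF.
Qed.

Lemma phi_fractional_laplacian : is_fractional_laplacian sg (phi sg T) phi_fl.
Proof.
have [phi1 phi2] := phi_in_Lp.
have [fl1 fl2] := phi_dom_in_Lp sg01 T1 (mulr_ge0 (mulr_ge0 C0' s20) (powR_ge0 2 (1 + sg)))
  measurable_phi_fl phi_fl_bound.
have zero2 : in_Lp 2%:E (fun _ : V => 0 : R).
  have z0 (x : V) : `|0 : R| <= 0 * expR (- (dot x x / 2)) by rewrite normr0 mul0r.
  by have [] := gauss_dom_in_Lp (lexx 0) (@measurable_cst _ _ V R setT 0) z0.
(* One bound for both transforms: [1 + |xi|^2] dominates 1 as well as the multiplier
   [|xi|^(2 sg)]. *)
have Lle (xi : V) : (1 + dot xi xi) * laplace_weight sg (T * dot xi xi) <=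
    2 * (\int[leb]_t weight sg t) * expR (- (dot xi xi / 2)).
  have d0 := dot_ge0 xi; have Td0 : 0 <= T * dot xi xi by rewrite mulr_ge0// ltW.
  have := laplace_weight_le sg01 Td0.
  have : expR (- (T * dot xi xi)) <= expR (- (dot xi xi / 2)) * expR (- (dot xi xi / 2)).
    by rewrite -expRD ler_expR; have := T1; nra.
  have : (1 + dot xi xi / 2) * expR (- (dot xi xi / 2)) <= 1.
    by rewrite expRN ler_pdivrMr ?expR_gt0// mul1r expR_ge1Dx.
  by move=> H1 H2 H3; exact: (laplace_weight_decay d0 W0 (expR_ge0 _) H1 H2 H3).
have mL := @measurable_laplace_weight R n sg T.
have W20 : 0 <= 2 * \int[leb]_t weight sg t by rewrite mulr_ge0.
have L0 (xi : V) : 0 <= laplace_weight sg (T * dot xi xi) by exact: laplace_weight_ge0.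
have F2 : in_Lp 2%:E (fun xi : V => laplace_weight sg (T * dot xi xi)).
  have [] // := gauss_dom_in_Lp W20 mL.
  move=> xi; apply: le_trans (Lle xi); rewrite ger0_norm//.
  by rewrite ler_peMl// lerDl dot_ge0.
have G2 : in_Lp 2%:E (fun xi : V => dot xi xi `^ sg * laplace_weight sg (T * dot xi xi)).
  have mG : measurable_fun setT (fun xi : V => dot xi xi `^ sg * laplace_weight sg (T * dot xi xi)).
    apply: measurable_funM => //.
    exact: measurableT_comp (measurable_powR sg) (@measurable_dot R n).
  have [] // := gauss_dom_in_Lp W20 mG.
  move=> xi; apply: le_trans (Lle xi); rewrite ger0_norm ?mulr_ge0 ?powR_ge0//.
  rewrite ler_wpM2r//; have d0 := dot_ge0 xi.
  have [d1|d1] := leP (dot xi xi) 1.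
    rewrite (@le_trans _ _ 1) ?lerDl//.
    rewrite (@le_trans _ _ (1 `^ sg))//; last by rewrite powR1.
    rewrite ge0_ler_powR ?nnegrE//.
    by case/andP: sg01 => /ltW.
  rewrite (@le_trans _ _ (dot xi xi `^ 1))//; last by rewrite powRr1// lerDr.
  by rewrite ler_powR ?(ltW d1)//; case/andP: sg01 => _ /ltW.
exists (fun xi : V => Complex (laplace_weight sg (T * dot xi xi)) 0).
  by apply: is_fourier_integral => //; exact: fourier_phi.
rewrite (_ : (fun xi : V => _) = (fun xi : V => Complex (dot xi xi `^ sg * laplace_weight sg (T * dot xi xi)) 0)).
  by apply: is_fourier_integral => //; exact: fourier_phi_fl.
apply/funext => xi; rewrite enorm_powR /real_complex_def.
by congr Complex; rewrite /= ?mulr0 ?mul0r ?subr0 ?addr0.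
Qed.
End bound.
End phi_operators.

(** No integrability is assumed: if the positive or the negative part has infinite integral, both
    extended integrals are infinite and [fine] sends them to 0. *)
Lemma RintegralN d (X : measurableType d) (R : realType) (m : {measure set X -> \bar R})
    (D : set X) (f : X -> R) :
  \int[m]_(x in D) (- f x) = - \int[m]_(x in D) f x.
Proof.
rewrite /Rintegral integralE [in RHS]integralE.
rewrite (_ : (fun x => (- f x)%:E) = (\- (EFin \o f))%E)//.
rewrite funeposN funenegN.
have := @integral_ge0 _ _ _ m D (EFin \o f)^\+%E (fun x _ => funepos_ge0 _ x).
have := @integral_ge0 _ _ _ m D (EFin \o f)^\-%E (fun x _ => funeneg_ge0 _ x).
case: (integral _ _ _) => [a||]//; case: (integral _ _ _) => [b||]// _ _; rewrite /= ?oppr0//.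
by rewrite opprB.
Qed.

(** * Weak derivatives and the Laplacian of the test function *)

Section phi_derivatives.
Context {R : realType} {n : nat}.
Local Notation V := 'rV[R]_n.
Local Notation leb := (@lebesgue_measure R).
Local Notation mu := (@lebesgue_rV R n).
Implicit Types psi : V -> R.

Lemma measurable_dheat_scale i c :
  measurable_fun setT (fun z : measurableTypeR R * V => dheat i (c * z.1) z.2).
Proof.
apply: measurable_funM; last exact: measurable_heat_scale.
apply: measurableT_comp => //; apply: measurable_funM.
  by apply: (measurableT_comp (measurable_coord_rV i)); exact: measurable_snd.
apply: (measurableT_comp (@measurable_inv R)).
by do 2 apply: measurable_funM => //; exact: measurable_fst.
Qed.

Lemma measurable_ddheat_scale i j c :
  measurable_fun setT (fun z : measurableTypeR R * V => ddheat i j (c * z.1) z.2).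
Proof.
have m1 : measurable_fun setT (fun z : measurableTypeR R * V => c * z.1).
  by apply: measurable_funM => //; exact: measurable_fst.
have m2 l : measurable_fun setT (fun z : measurableTypeR R * V => z.2 ord0 l).
  by apply: (measurableT_comp (measurable_coord_rV l)); exact: measurable_snd.
apply: measurable_funM; last exact: measurable_heat_scale.
apply: measurable_funB; apply: measurable_funM => //.
- exact: measurable_funM.
- apply: (measurableT_comp (@measurable_inv R)); apply: measurable_funM => //.
  exact: measurable_funX.
- by apply: (measurableT_comp (@measurable_inv R)); apply: measurable_funM.
Qed.

Lemma continuous_line_ddheat i j t (x e : V) l : 0 < t ->
  continuous (fun h : R => ddheat i j t (x + h *: (delta_mx ord0 l : V))).
Proof.
move=> t0 h.
have cc m : {for h, continuous (fun h : R => (x + h *: (delta_mx ord0 l : V)) ord0 m)}.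
  exact: (derive_continuous_line (fun y => is_derive_coord y (delta_mx ord0 l) m)).
apply: cvgM.
  apply: cvgB; last exact: cvg_cst.
  by apply: cvgM; [apply: cvgM; exact: cc|exact: cvg_cst].
exact: (derive_continuous_line (fun y => is_derive_heat l y t0)).
Qed.

Variables (sg T : R).
Hypotheses (sg01 : 0 < sg < 1) (T1 : 1 <= T).

Let T0 : 0 < T := lt_le_trans ltr01 T1.
Let s20 := sqrt2X_ge0 R n.
Let bw := weight_dominated sg.
Let bh := @heat_dominated R n T T1.
Let Tt t : 1 < t -> 1 <= T * t.
Proof. by have := T1; nra. Qed.

Let bdh i t (x : V) : 1 < t -> `|dheat i (T * t) x| <= 4 * Num.sqrt 2 ^+ n * heat (2 * T * t) x.
Proof. by move=> t1; rewrite -(mulrA 2 T t) dheat_bound// Tt. Qed.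

Let bddh i j t (x : V) : 1 < t ->
  `|ddheat i j (T * t) x| <= 2 / T * Num.sqrt 2 ^+ n * heat (2 * T * t) x.
Proof.
move=> t1; have t0 := lt_trans ltr01 t1.
rewrite -(mulrA 2 T t); apply: le_trans (ddheat_bound i j x (mulr_gt0 T0 t0)) _.
rewrite ler_wpM2r ?heat_ge0// ler_wpM2r// ler_wpM2l// lef_pV2 ?posrE ?mulr_gt0//.
by rewrite ler_peMr// ltW.
Qed.

Let s4 : 0 <= 4 * Num.sqrt 2 ^+ n :> R. Proof. by rewrite mulr_ge0. Qed.
Let s2T : 0 <= 2 / T * Num.sqrt 2 ^+ n. Proof. by rewrite mulr_ge0// divr_ge0// ltW. Qed.

Definition phi_d i := @mix R n (weight sg) (fun t => dheat i (T * t)).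
Definition phi_dd i j := @mix R n (weight sg) (fun t => ddheat i j (T * t)).

Lemma measurable_phi_dd i j : measurable_fun setT (phi_dd i j).
Proof. exact: (measurable_mix sg01 T1 (measurable_weight sg) bw (measurable_ddheat_scale i j T) (bddh i j)). Qed.

Lemma phi_d_in_Lp2 i : in_Lp 2%:E (phi_d i).
Proof.
have md := measurable_mix sg01 T1 (measurable_weight sg) bw (measurable_dheat_scale i T) (bdh i).
have B x := mix_le_phi sg01 T1 x ler01 s4 (measurable_weight sg) bw (measurable_dheat_scale i T) (bdh i).
by have [] := phi_dom_in_Lp sg01 T1 (mulr_ge0 (mulr_ge0 ler01 s4) (powR_ge0 2 (1 + sg))) md B.
Qed.

Lemma phi_dd_bound i j x :
  `|phi_dd i j x| <= 2 / T * Num.sqrt 2 ^+ n * 2 `^ (1 + sg) * phi sg T x.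
Proof.
have := mix_le_phi sg01 T1 x ler01 s2T (measurable_weight sg) bw (measurable_ddheat_scale i j T) (bddh i j).
by rewrite mul1r.
Qed.

Lemma phi_dd_in_Lp2 i j : in_Lp 2%:E (phi_dd i j).
Proof.
by have [] := phi_dom_in_Lp sg01 T1 (mulr_ge0 s2T (powR_ge0 2 (1 + sg)))
  (measurable_phi_dd i j) (phi_dd_bound i j).
Qed.

Let integral_mix_weight_test w (k : R -> V -> R) K psi : 0 <= K ->
  measurable_fun setT (fun z : measurableTypeR R * V => k z.1 z.2) ->
  (forall t x, 1 < t -> `|k t x| <= K * heat (2 * T * t) x) ->
  test_function psi -> w = weight sg ->
  \int[mu]_x (mix w k x * psi x) = \int[leb]_t (w t * \int[mu]_x (k t x * psi x)).
Proof.
move=> K0 mk kK tpsi ->; have [B _ HB] := test_function_bounded tpsi.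
apply: (integral_mix sg01 T1 ler01 K0 (measurable_weight sg) bw mk kK _ HB).
by apply: continuous_measurable_rV; exact: test_function_continuous.
Qed.

Let heat_by_parts i psi t : 0 < t -> test_function psi -> 1 <= t ->
  \int[mu]_x (heat t x * partial i psi x) = - \int[mu]_x (dheat i t x * psi x).
Proof.
move=> t0 tpsi t1; apply: integral_by_parts_test => //.
- exact: integrable_heat.
- have t20 : 0 < 2 * t by rewrite mulr_gt0.
  apply: integrable_dom (integrableZR (4 * Num.sqrt 2 ^+ n) (integrable_heat n t20)).
    have m : measurable_fun setT (fun x : V => (1 : measurableTypeR R, x)) by exact/measurable_fun_pair.
    have := measurableT_comp (measurable_dheat_scale i t) m.
    by rewrite /comp/= mulr1.
  by move=> x; exact: dheat_bound.
- by move=> x; exact: is_derive_heat.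
- by move=> x; exact: (derive_continuous_line (fun y => is_derive_dheat i i y t0)).
Qed.

Let dheat_by_parts i j psi t : 0 < t -> test_function psi -> 1 <= t ->
  \int[mu]_x (dheat i t x * partial j psi x) = - \int[mu]_x (ddheat i j t x * psi x).
Proof.
move=> t0 tpsi t1; have t20 : 0 < 2 * t by rewrite mulr_gt0.
have m : measurable_fun setT (fun x : V => (1 : measurableTypeR R, x)) by exact/measurable_fun_pair.
apply: integral_by_parts_test => //.
- apply: integrable_dom (integrableZR (4 * Num.sqrt 2 ^+ n) (integrable_heat n t20)).
    have := measurableT_comp (measurable_dheat_scale i t) m.
    by rewrite /comp/= mulr1.
  by move=> x; exact: dheat_bound.
- apply: integrable_dom (integrableZR (2 / t * Num.sqrt 2 ^+ n) (integrable_heat n t20)).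
    have := measurableT_comp (measurable_ddheat_scale i j t) m.
    by rewrite /comp/= mulr1.
  by move=> x; exact: ddheat_bound.
- by move=> x; exact: is_derive_dheat.
- by move=> x; exact: continuous_line_ddheat.
Qed.

Let weight_congr (f g : R -> R) : (forall t, 1 < t -> f t = g t) ->
  \int[leb]_t (weight sg t * f t) = \int[leb]_t (weight sg t * g t).
Proof.
move=> fg; apply: eq_Rintegral => t _.
have [t1|t1] := leP t 1; first by rewrite weight_le1// !mul0r.
by rewrite fg.
Qed.

(** Fubini moves the test function inside the time integral, where each kernel at time [T t > 1] is
    smooth and admits a classical integration by parts. *)
Lemma phi_weak_partial i : weak_partials [:: i] (phi sg T) (phi_d i).
Proof.
move=> psi tpsi; have tdpsi : test_function (partial i psi) := test_function_partials [:: i] tpsi.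
rewrite /= (integral_mix_weight_test s20 (measurable_heat_scale T) bh tdpsi)//.
rewrite (integral_mix_weight_test s4 (measurable_dheat_scale i T) (bdh i) tpsi)// expr1 mulN1r -RintegralN.
transitivity (\int[leb]_t (weight sg t * - \int[mu]_x (dheat i (T * t) x * psi x))).
  apply: weight_congr => t t1.
  by rewrite heat_by_parts ?Tt// (lt_le_trans ltr01 (Tt t1)).
by apply: eq_Rintegral => t _; rewrite mulrN.
Qed.

Lemma phi_weak_partial2 i j : weak_partials [:: i; j] (phi sg T) (phi_dd i j).
Proof.
move=> psi tpsi; have tdpsi : test_function (partial j psi) := test_function_partials [:: j] tpsi.
have tddpsi : test_function (partial i (partial j psi)) := test_function_partials [:: i; j] tpsi.
rewrite /= (integral_mix_weight_test s20 (measurable_heat_scale T) bh tddpsi)//.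
rewrite (integral_mix_weight_test s2T (measurable_ddheat_scale i j T) (bddh i j) tpsi)// sqrrN expr1n mul1r.
apply: weight_congr => t t1; have t0 := lt_le_trans ltr01 (Tt t1).
by rewrite heat_by_parts ?Tt// dheat_by_parts ?Tt// opprK.
Qed.

Lemma phi_in_H2 : in_H2 (@phi R n sg T).
Proof.
have [_ phi2] := @phi_in_Lp R n sg T sg01 T1; split => // -[_|i [_|j [_|//]]].
- by exists (phi sg T) => // psi _; rewrite expr0 mul1r.
- by exists (phi_d i); [exact: phi_d_in_Lp2|exact: phi_weak_partial].
- by exists (phi_dd i j); [exact: phi_dd_in_Lp2|exact: phi_weak_partial2].
Qed.

Definition phi_lap (x : V) : R := \sum_i phi_dd i i x.

Lemma measurable_phi_lap : measurable_fun setT phi_lap.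
Proof. by apply: measurable_sum => i; exact: measurable_phi_dd. Qed.

Lemma phi_laplacian : is_laplacian (phi sg T) phi_lap.
Proof.
exists (fun i => phi_dd i i); split.
- by move=> i; exact: phi_dd_in_Lp2.
- by move=> i; exact: phi_weak_partial2.
- exact: ae_eq_refl.
Qed.

Lemma phi_lap_bound x : `|phi_lap x| <=
  n%:R * (2 / T * Num.sqrt 2 ^+ n * 2 `^ (1 + sg)) * phi sg T x.
Proof.
apply: le_trans (ler_norm_sum _ _ _) _.
apply: (@le_trans _ _ (\sum_(i < n) 2 / T * Num.sqrt 2 ^+ n * 2 `^ (1 + sg) * phi sg T x)).
  by apply: ler_sum => i _; exact: phi_dd_bound.
by rewrite sumr_const card_ord -[leLHS]mulr_natl -[leRHS]mulrA.
Qed.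
End phi_derivatives.

(** The constant does not depend on [T]. The fractional Laplacian brings [T^(-sg)], the Laplacian
    [1/T], and [1/T <= T^(-sg)] because [T >= 1] and [sg < 1]. *)
Lemma phi_operators_bound (R : realType) n (sg : R) : 0 < sg < 1 ->
  exists2 C : R, 0 <= C & forall T : R, 1 <= T -> exists g l : 'rV[R]_n -> R,
    [/\ measurable_fun setT g, measurable_fun setT l,
        is_fractional_laplacian sg (phi sg T) g, is_laplacian (phi sg T) l &
        forall x, `|g x| <= C * T `^ (- sg) * phi sg T x /\
                  `|l x| <= C * T `^ (- sg) * phi sg T x].
Proof.
move=> sg01; have [D D0 HD] := dweight_bound sg01.
have l0 := levy_const_gt0 sg01.
have s20 : 0 <= Num.sqrt 2 ^+ n * 2 `^ (1 + sg) :> R by rewrite mulr_ge0 ?powR_ge0// exprn_ge0.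
pose C1 := D / levy_const sg * (Num.sqrt 2 ^+ n * 2 `^ (1 + sg)).
pose C2 : R := n%:R * 2 * (Num.sqrt 2 ^+ n * 2 `^ (1 + sg)).
have C10 : 0 <= C1 by rewrite mulr_ge0// divr_ge0// ltW.
have C20 : 0 <= C2 by rewrite mulr_ge0.
exists (C1 + C2); first exact: addr_ge0.
move=> T T1; have T0 : 0 < T := lt_le_trans ltr01 T1.
exists (phi_fl sg T), (phi_lap sg T); split.
- exact: (measurable_phi_fl sg01 T1 HD).
- exact: measurable_phi_lap.
- exact: (phi_fractional_laplacian sg01 T1 D0 HD).
- exact: phi_laplacian.
move=> x; have p0 := phi_ge0 sg T x; have Ts := powR_ge0 T (- sg); split.
  apply: le_trans (phi_fl_bound sg01 T1 D0 HD x) _.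
  rewrite ler_wpM2r//; apply: (@le_trans _ _ (C1 * T `^ (- sg))).
    by rewrite /C1 le_eqVlt; apply/orP; left; apply/eqP; ring.
  by rewrite ler_wpM2r// lerDl.
apply: le_trans (phi_lap_bound sg01 T1 x) _.
rewrite ler_wpM2r//; apply: (@le_trans _ _ (C2 * T^-1)).
  by rewrite /C2 le_eqVlt; apply/orP; left; apply/eqP; ring.
rewrite ler_pM ?invr_ge0 ?(ltW T0)//; first by rewrite lerDr.
rewrite -powR_inv1 ?(ltW T0)//; apply: ler_powR => //.
by rewrite lerN2; case/andP: sg01 => _ /ltW.
Qed.

(** * Young's inequality with a variable exponent, and power decay *)

Lemma measurable_powR_fun d (X : measurableType d) (R : realType) (f g : X -> R) :
  measurable_fun setT f -> measurable_fun setT g ->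
  measurable_fun setT (fun x => f x `^ g x).
Proof.
move=> mf mg; rewrite /powR.
have m0 (h : X -> R) : measurable_fun setT h -> measurable_fun setT (fun x => h x == 0).
  move=> mh; apply: (measurable_fun_bool true).
  rewrite (_ : _ @^-1` _ = h @^-1` [set 0]).
    exact: (mh measurableT [set 0] (measurable_set1 0)).
  by apply/seteqP; split => x /= /eqP.
apply: measurable_fun_ifT; first exact: m0.
  rewrite (_ : (fun t => _) = (fun t => if g t == 0 then 1 else 0 : R)); last first.
    by apply/funext => t; case: (g t == 0).
  by apply: measurable_fun_ifT => //; exact: m0.
apply: measurableT_comp => //; apply: measurable_funM => //.
exact: (measurableT_comp (@measurable_ln R)).
Qed.

(* Young's inequality with the exponent [p] replaced by its upper bound [P] in
   the remainder: if [2 A > y ^ (p - 1)] then [y < 1], so [y ^ (P - 1) <= 2 A]. *)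
Lemma young_below (R : realType) (A y p P : R) : 0 <= A -> 2 * A <= 1 -> 0 <= y ->
  1 <= p -> p <= P -> 1 < P ->
  A * y <= 2^-1 * y `^ p + (2 * A) `^ (P / (P - 1)).
Proof.
move=> A0 A1; rewrite le_eqVlt => /predU1P[<-|y0] p1 pP P1.
  by rewrite mulr0 addr_ge0// ?mulr_ge0 ?powR_ge0.
have yp : y `^ p = y * y `^ (p - 1) by rewrite mul_powR//; congr (_ `^ _); ring.
have [Ay|Ay] := leP (2 * A) (y `^ (p - 1)).
  rewrite (@le_trans _ _ (2^-1 * y `^ p)) ?lerDl ?powR_ge0// yp.
  by move: (y `^ _) Ay => z Ay; nra.
rewrite (@le_trans _ _ ((2 * A) `^ (P / (P - 1))))//; last first.
  by rewrite lerDr mulr_ge0 ?powR_ge0.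
have yp1 : y `^ (p - 1) < 1 := lt_le_trans Ay A1.
have y1 : y < 1.
  rewrite ltNge; apply: contraTN yp1 => y1; rewrite -leNgt.
  by rewrite -[leLHS](powRr0 y) ler_powR// subr_ge0.
have yP : y `^ (P - 1) <= 2 * A.
  apply: (le_trans _ (ltW Ay)); apply: ger_powR; first by rewrite y0 ltW.
  by rewrite lerD2r.
have P10 : 0 < P - 1 by rewrite subr_gt0.
have yA : y <= (2 * A) `^ (P - 1)^-1.
  have yE : y = (y `^ (P - 1)) `^ (P - 1)^-1.
    by rewrite -powRrM divff ?gt_eqF// powRr1// ltW.
  rewrite [leLHS]yE.
  apply: ge0_ler_powR => //; first by rewrite invr_ge0 ltW.
    by rewrite nnegrE powR_ge0.
  by rewrite nnegrE mulr_ge0.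
have A20 : 0 < 2 * A by apply: le_lt_trans Ay; exact: powR_ge0.
rewrite (_ : P / (P - 1) = 1 + (P - 1)^-1); last by field; rewrite gt_eqF.
rewrite -mul_powR//; apply: ler_pM => //; first exact: ltW.
lra.
Qed.

(** If [y > 0], any [T >= T0] with [T^d > K / y] contradicts the bound. *)
Lemma decay_eq0 (R : realType) (y K d T0 : R) : 0 <= y -> 0 < d ->
  (forall T, T0 <= T -> y <= K * T `^ (- d)) -> y = 0.
Proof.
move=> y0 d0 H; apply/eqP; move: y0; rewrite le_eqVlt => /predU1P[<-//|y0].
pose b := Num.max 0 (K / y) + 1.
have b0 : 0 < b by rewrite ltr_wpDl// le_max lexx.
pose T := Num.max T0 (b `^ d^-1).
have TT : T0 <= T by rewrite le_max lexx.
have Tb : b <= T `^ d.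
  rewrite -[leLHS](powRr1 (ltW b0)) -(mulVf (lt0r_neq0 d0)) powRrM.
  apply: ge0_ler_powR; rewrite ?nnegrE ?powR_ge0 ?(ltW d0)//.
    by rewrite le_max powR_ge0 orbT.
  by rewrite le_max lexx orbT.
have Td0 : 0 < T `^ d := lt_le_trans b0 Tb.
have := H T TT; rewrite powRN ler_pdivlMr// => yK.
have : K / y < b by rewrite ltr_pwDr// le_max lexx orbT.
rewrite ltr_pdivrMr// => Kb; have := ler_wpM2l (ltW y0) Tb; lra.
Qed.

Section phi_mass.
Context {R : realType} {n : nat}.
Local Notation mu := (@lebesgue_rV R n).

(** Each heat kernel has mass one, so the mass is independent of [T], and the remainder of Young's
    inequality integrates to a fixed multiple of [(2 A)^(P/(P-1))]. *)
Lemma integral_phi (sg T : R) : 0 < sg < 1 -> 1 <= T ->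
  \int[mu]_x phi sg T x = \int[@lebesgue_measure R]_t weight sg t.
Proof.
move=> sg01 T1; have T0 : 0 < T := lt_le_trans ltr01 T1.
have b1 (x : 'rV[R]_n) : `|cst 1 x : R| <= 1 by rewrite /= normr1.
have := integral_phi_test sg01 T1 (@measurable_cst _ _ 'rV[R]_n R setT 1) b1.
rewrite (@eq_Rintegral _ _ _ _ _ (phi sg T)); last by move=> x _; rewrite mulr1.
move=> ->; apply: eq_Rintegral => t _.
have [t1|t1] := leP t 1; first by rewrite weight_le1// mul0r.
rewrite (@eq_Rintegral _ _ _ _ _ (heat (T * t))); last by move=> x _; rewrite mulr1.
by rewrite /Rintegral integral_heat ?mulr1// mulr_gt0// (lt_trans ltr01).
Qed.
End phi_mass.

(** * The integral estimate and the vanishing of solutions *)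

Section vanishing.
Context {R : realType} {n : nat}.
Local Notation V := 'rV[R]_n.
Local Notation mu := (@lebesgue_rV R n).
Local Notation leb := (@lebesgue_measure R).
Variables (sg P : R) (u q : V -> R).
Hypotheses (sg01 : 0 < sg < 1) (P1 : 1 < P).
Hypotheses (u2 : u \in Lfun mu 2%:E) (mq : measurable_fun setT q).
Hypothesis q1P : forall x, 1 <= q x <= P.

Let mu_ : measurable_fun setT u.
Proof. by move: u2; rewrite inE => /andP[]; rewrite inE. Qed.

Let v x := `|u x| `^ q x.

Let mv : measurable_fun setT v.
Proof. by apply: measurable_powR_fun => //; exact: measurableT_comp. Qed.

Let v0 x : 0 <= v x. Proof. exact: powR_ge0. Qed.

Lemma Lfun2_phi_dom (T B : R) (f : V -> R) : 1 <= T -> 0 <= B -> measurable_fun setT f ->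
  (forall x, `|f x| <= B * phi sg T x) -> f \in Lfun mu 2%:E.
Proof.
move=> T1 B0 mf fB; apply: Lfun2_sqr => //.
apply: integrable_dom (integrableZR (B * (B * \int[leb]_t weight sg t)) (integrable_phi sg01 T1)).
  exact: measurable_funX.
move=> x; rewrite normrX expr2 mulrC; apply: (@le_trans _ _ ((B * \int[leb]_t weight sg t) * (B * phi sg T x))).
  rewrite ler_pM// (le_trans (fB x))// ler_wpM2l//; exact: phi_le.
by rewrite le_eqVlt; apply/orP; left; apply/eqP; ring.
Qed.

Lemma integrable_mul2 (f : V -> R) : f \in Lfun mu 2%:E ->
  mu.-integrable setT (EFin \o (fun x => u x * f x)).
Proof. by move=> f2; apply/Lfun1_integrable; exact: Lfun2_mul_Lfun1. Qed.

Let integrable_norm_phi T : 1 <= T -> mu.-integrable setT (EFin \o (fun x => `|u x| * phi sg T x)).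
Proof.
move=> T1.
have p2 : phi sg T \in Lfun mu 2%:E.
  apply: (Lfun2_phi_dom T1 ler01); first exact: measurable_phi.
  by move=> x; rewrite mul1r ger0_norm// phi_ge0.
have := integrable_normR (integrable_mul2 p2); apply: integrable_dom.
  by apply: measurable_funM; [exact: measurableT_comp|exact: measurable_phi].
by move=> x; rewrite !normrM normr_id.
Qed.

Lemma norm_Rintegral_mul_le (T B : R) (f : V -> R) : 1 <= T -> 0 <= B -> measurable_fun setT f ->
  (forall x, `|f x| <= B * phi sg T x) ->
  `|\int[mu]_x (u x * f x)| <= B * \int[mu]_x (`|u x| * phi sg T x).
Proof.
move=> T1 B0 mf fB; have i := integrable_mul2 (Lfun2_phi_dom T1 B0 mf fB).
rewrite -RintegralZl//; last exact: integrable_norm_phi.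
apply: le_trans (le_normr_Rintegral _ i) _ => //.
apply: le_Rintegral => //.
- exact: integrable_normR.
- exact/integrableZR/integrable_norm_phi.
- by move=> x _; rewrite normrM mulrCA ler_wpM2l.
Qed.

Lemma vphi_le (T A : R) : 1 <= T -> 0 <= A -> 2 * A <= 1 ->
  (\int[mu]_x (v x * phi sg T x)%:E <= (A * \int[mu]_x (`|u x| * phi sg T x))%:E)%E ->
  (\int[mu]_x (v x * phi sg T x)%:E <=
   (2 * (2 * A) `^ (P / (P - 1)) * \int[leb]_t weight sg t)%:E)%E.
Proof.
move=> T1 A0 A1 H.
have ip := integrable_phi sg01 T1.
have iu := integrable_norm_phi T1.
(* Finiteness comes from the hypothesis, whose right-hand side is a real number; it is what allows
   half of this integral to be subtracted below. *)
have iv : mu.-integrable setT (EFin \o (fun x => v x * phi sg T x)).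
  apply: integrable_ge0_fin.
  - by apply: measurable_funM => //; exact: measurable_phi.
  - by move=> x; rewrite mulr_ge0// phi_ge0.
  - by rewrite (le_lt_trans H)// ltry.
move: H; rewrite -EFin_Rintegral// !lee_fin => H.
set B := (2 * A) `^ _.
have : A * \int[mu]_x (`|u x| * phi sg T x) <=
    2^-1 * \int[mu]_x (v x * phi sg T x) + B * \int[leb]_t weight sg t.
  rewrite -(@integral_phi R n _ _ sg01 T1) -!RintegralZl//.
  rewrite -RintegralD//; [|exact: integrableZR|exact: integrableZR].
  apply: le_Rintegral => //; [exact: integrableZR|by apply: integrableDR; exact: integrableZR|].
  move=> x _; rewrite !mulrA -mulrDl ler_wpM2r ?phi_ge0//.
  by have /andP[q1 qP] := q1P x; exact: young_below.
move: H; rewrite -[2 * B * _]mulrA.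
by move: (\int[mu]_x (v x * _)) (A * _) (B * _) => X Y Z; lra.
Qed.

Lemma vanishing (A0 : R) : 0 <= A0 -> n%:R / 2 < sg * (P / (P - 1)) ->
  (forall T, 1 <= T -> (\int[mu]_x (v x * phi sg T x)%:E <=
     (A0 * T `^ (- sg) * \int[mu]_x (`|u x| * phi sg T x))%:E)%E) ->
  \forall x \ae mu, u x = 0.
Proof.
move=> A00 hd H.
have [c c0 Hc] := @phi_lower R n sg sg01.
have P10 : 0 < P - 1 by rewrite subr_gt0.
set P' := P / (P - 1) in hd *.
have P'0 : 0 < P' by rewrite divr_gt0// (lt_trans ltr01).
have sg0 : 0 < sg by case/andP: sg01.
pose d := sg * P' - n%:R / 2; have d0 : 0 < d by rewrite subr_gt0.
pose W := \int[leb]_t weight sg t.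
pose K (k : nat) := [set x : V | dot x x <= k%:R].
have mK k : measurable (K k).
  have := @measurable_dot R n measurableT _ (measurable_itv `]-oo, k%:R]).
  by rewrite setTI (_ : _ @^-1` _ = K k).
pose I k x := v x * \1_(K k) x.
have I0 k x : 0 <= I k x by rewrite mulr_ge0// indicE.
have mI k : measurable_fun setT (I k) by exact: measurable_funM.
(* Three demands on [T]: [T >= 1], the ball [K k] lies where the lower bound on [phi] holds, and
   [A = A0 T^(-sg)] satisfies [2 A <= 1], as Young's inequality asks. *)
pose T0 k := Num.max (Num.max 1 k%:R) ((2 * A0 + 1) `^ sg^-1) : R.
have Ibound k T : T0 k <= T ->
    (\int[mu]_x (I k x)%:E <= (2 * (2 * A0) `^ P' * W / c * T `^ (- d))%:E)%E.
  rewrite /T0 !ge_max => /andP[/andP[T1 Tk] TA].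
  have T00 : 0 < T := lt_le_trans ltr01 T1.
  have A10 : 0 <= A0 * T `^ (- sg) by rewrite mulr_ge0 ?powR_ge0.
  have Tsg : 2 * A0 + 1 <= T `^ sg.
    have A01 : 0 <= 2 * A0 + 1 by rewrite addr_ge0// mulr_ge0.
    rewrite (_ : 2 * A0 + 1 = ((2 * A0 + 1) `^ sg^-1) `^ sg).
      by apply: ge0_ler_powR; rewrite ?nnegrE ?powR_ge0 ?(ltW sg0) ?(ltW T00).
    by rewrite -powRrM mulVf ?gt_eqF// powRr1.
  have A11 : 2 * (A0 * T `^ (- sg)) <= 1.
    rewrite powRN mulrA ler_pdivrMr ?powR_gt0// mul1r.
    by apply: le_trans Tsg; rewrite lerDl.
  have := vphi_le T1 A10 A11 (H T T1); rewrite -/P' -/W => HB.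
  pose cT := c * (Num.sqrt T)^-1 ^+ n.
  have cT0 : 0 < cT by rewrite mulr_gt0// exprn_gt0// invr_gt0 sqrtr_gt0.
  have LB : (cT%:E * \int[mu]_x (I k x)%:E <= \int[mu]_x (v x * phi sg T x)%:E)%E.
    rewrite -ge0_integralZl//; last 3 first.
    - exact/measurable_EFinP.
    - by move=> x _; rewrite lee_fin.
    - by rewrite lee_fin ltW.
    apply: ge0_le_integral => //.
    - by move=> x _; rewrite lee_fin mulr_ge0// ltW.
    - by apply/measurable_EFinP; exact: measurable_funM.
    - by apply/measurable_EFinP; apply: measurable_funM => //; exact: measurable_phi.
    move=> x _; rewrite lee_fin /I indicE; have [/set_mem xK|_] := boolP (x \in K k).
      by rewrite mulr1 mulrC ler_wpM2l// Hc// (le_trans xK).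
    by rewrite !mulr0 mulr_ge0// phi_ge0.
  have E : cT = c * T `^ (- (n%:R / 2)).
    rewrite /cT exprVn -powR12_sqrt ?(ltW T00)// -powR_mulrn ?powR_ge0// -powRrM powRN.
    by rewrite [2^-1 * _]mulrC.
  have : (\int[mu]_x (I k x)%:E <= (cT^-1 * (2 * (2 * (A0 * T `^ (- sg))) `^ P' * W))%:E)%E.
    have := le_trans LB HB; move: (2 * _ `^ P' * W) => Z HZ.
    rewrite EFinM -[leLHS]mul1e -(mulVf (lt0r_neq0 cT0)) EFinM -muleA.
    by apply: lee_wpmul2l => //; rewrite lee_fin invr_ge0 ltW.
  move/le_trans; apply; rewrite lee_fin E invfM -powRN opprK.
  rewrite mulrA powRM ?mulr_ge0 ?powR_ge0// -powRrM.
  rewrite (_ : - d = n%:R / 2 + - sg * P'); last by rewrite /d; ring.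
  by rewrite powRDp// le_eqVlt; apply/orP; left; apply/eqP; ring.
have Iae k : \forall x \ae mu, I k x = 0.
  have Ifin : (\int[mu]_x (I k x)%:E \is a fin_num)%E.
    rewrite ge0_fin_numE; first exact: le_lt_trans (Ibound k _ (lexx _)) (ltry _).
    by apply: integral_ge0 => x _; rewrite lee_fin.
  have Y0 : fine (\int[mu]_x (I k x)%:E)%E = 0.
    apply: (@decay_eq0 _ _ (2 * (2 * A0) `^ P' * W / c) d (T0 k)) => //.
      by rewrite fine_ge0// integral_ge0// => x _; rewrite lee_fin.
    by move=> T TT; rewrite -lee_fin fineK//; exact: Ibound.
  have : (\int[mu]_x `|(EFin \o I k) x| = 0)%E.
    rewrite -[RHS](congr1 EFin Y0) fineK//.
    by apply: eq_integral => x _; rewrite /= ger0_norm.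
  have mEI : measurable_fun setT (EFin \o I k) by exact/measurable_EFinP.
  have [+ _] := @ae_eq_integral_abs _ _ _ mu _ measurableT _ mEI.
  move/[apply]; apply: filterS => x /(_ Logic.I)/= Ix; exact: EFin_inj Ix.
have := ae_foralln Iae; apply: filterS => x Ix.
have := Ix (Num.truncn (dot x x)).+1; rewrite /I indicE mem_set; last first.
  by rewrite /K /=; exact/ltW/truncnS_gt.
by rewrite mulr1 => /powR_eq0_eq0/eqP; rewrite normr_eq0 => /eqP.
Qed.
End vanishing.

(** Both cases amount to [n (P - 1) < alpha P]: for [n > alpha] this is [P < n / (n - alpha)]
    rearranged, and for [n <= alpha] it follows from [alpha > 0] and [P > 1]. *)
Lemma critical_exponent_lt (R : realType) (n : nat) (alpha P : R) : 0 < alpha -> 1 < P ->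
  (P%:E < critical_exponent n alpha)%E -> n%:R / 2 < alpha / 2 * (P / (P - 1)).
Proof.
move=> a0 P1; have P10 : 0 < P - 1 by rewrite subr_gt0.
rewrite /critical_exponent mulrA ltr_pdivlMr//; case: ifPn => [na _|].
  by move: (n%:R : R) na => m na; nra.
rewrite -ltNge => an; rewrite lte_fin ltr_pdivlMr ?subr_gt0//.
by move: (n%:R : R) an => m an H; lra.
Qed.

Theorem theorem1 (R : realType) (N : nat) (alpha lambda : R) (p : 'rV[R]_N -> R)
    (hN : (1 <= N)%N) (halpha : 0 < alpha < 2)
    (hp : forall x, 1 < p x) (mp : lebesgue_measurable p)
    (hpminus : (1 < ess_inf (lebesgue_rV N) (EFin \o p))%E)
    (hple : (ess_inf (lebesgue_rV N) (EFin \o p) <=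
             ess_sup (lebesgue_rV N) (EFin \o p))%E)
    (hpplus : (ess_sup (lebesgue_rV N) (EFin \o p) < +oo)%E)
    (hcrit : (ess_sup (lebesgue_rV N) (EFin \o p) <
              critical_exponent N alpha)%E) :
  forall u : 'rV[R]_N -> R,
    weak_solution alpha lambda p u <-> (\forall x \ae lebesgue_rV N, u x = 0).
Proof.
move=> u; set mu := lebesgue_rV N; split; last first.
  (* The converse: if [u] vanishes almost everywhere, all integrals in the inequality are zero, as
     powers of 0 with positive exponent vanish. *)
  move=> u0; have u0' : u = cst 0 %[ae mu] by apply: filterS u0 => x ux _.
  have int0 (f : 'rV[R]_N -> \bar R) : (\forall x \ae mu, u x = 0 -> f x = 0%E) -> (\int[mu]_x f x = 0)%E.
    move=> f0; rewrite (@ae_eq_integral_nomeas _ _ _ mu _ (cst 0%E)) ?integral0//.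
    by apply: filterS2 f0 u0 => x fx /fx.
  split.
  - exists (cst 0) => //; rewrite inE; apply/andP; split; rewrite inE/=; first exact: measurable_cst.
    by rewrite /finite_norm (_ : EFin \o cst 0 = cst 0%E)// Lnorm0// gt_eqF.
  - split; first by exists (cst 0).
    exists 1 => //; rewrite int0//; apply: nearW => x ->.
    by rewrite mulr0 normr0 powR0// gt_eqF// mulr_gt0// (lt_trans ltr01).
  move=> f g l _ _ _ _; rewrite !int0 ?mule0 ?adde0//; apply: nearW => x ->.
  - by rewrite mul0r.
  - by rewrite mul0r.
  - by rewrite normr0 powR0 ?mul0r// gt_eqF// (lt_trans ltr01).
move=> [[u' u'2 uu'] _ H].
have := lt_le_trans hpminus hple; have := ess_sup_ge mu (EFin \o p).
move: hpplus hcrit; case: (ess_sup _ _) => [P||]// _ hP pP; rewrite lte_fin => P1.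
have sg01 : 0 < alpha / 2 < 1 by lra.
have a0 : 0 < alpha by case/andP: halpha.
have hd := critical_exponent_lt a0 P1 hP.
have [p' mp' pp'] := mp.
(* A Borel version of the exponent, clamped so that the bounds [1 <= q <= P] hold everywhere and not
   just almost everywhere. *)
pose q x := Num.min (Num.max (p' x) 1) P.
have mq : measurable_fun setT q.
  by apply: measurable_minr => //; exact: measurable_maxr.
have q1P x : 1 <= q x <= P.
  by rewrite /q le_min ge_min lexx orbT le_max lexx orbT ltW.
have qp : \forall x \ae mu, q x = p x.
  apply: filterS2 pp' pP => x /(_ Logic.I) pE; rewrite /= lee_fin => pxP.
  by rewrite /q -pE max_l ?(ltW (hp x))// min_l.
have [C C0 HC] := @phi_operators_bound R N _ sg01.
have l0 := normr_ge0 lambda.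
(* From here on [u'], the Borel representative in L^2, replaces [u]. *)
suff u'0 : \forall x \ae mu, u' x = 0.
  by apply: filterS2 uu' u'0 => x /(_ Logic.I) ->.
apply: (@vanishing R N _ P u' q sg01 P1 u'2 mq q1P ((1 + `|lambda|) * C)) => //.
  by rewrite mulr_ge0// addr_ge0.
move=> T T1; have [g [l [mg ml fg fl gl]]] := HC T T1.
have phi0 : \forall x \ae mu, 0 <= phi (alpha / 2) T x by apply: nearW => x; exact: phi_ge0.
have := H _ _ _ (phi_in_H2 sg01 T1) phi0 fg fl.
rewrite (@ae_eq_integral_nomeas _ _ _ mu _ (fun x => (`|u' x| `^ q x * phi (alpha / 2) T x)%:E)); last first.
  by apply: filterS2 uu' qp => x /(_ Logic.I) -> ->.
rewrite (@ae_eq_integral_nomeas _ _ _ mu (fun x => (u x * g x)%:E) (fun x => (u' x * g x)%:E)); last first.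
  by apply: filterS uu' => x /(_ Logic.I) ->.
rewrite (@ae_eq_integral_nomeas _ _ _ mu (fun x => (u x * l x)%:E) (fun x => (u' x * l x)%:E)); last first.
  by apply: filterS uu' => x /(_ Logic.I) ->.
set B := C * T `^ _ in gl; have B0 : 0 <= B by rewrite mulr_ge0 ?powR_ge0.
have gB x : `|g x| <= B * phi (alpha / 2) T x by case: (gl x).
have lB x : `|l x| <= B * phi (alpha / 2) T x by case: (gl x).
have ig := integrable_mul2 u'2 (Lfun2_phi_dom sg01 T1 B0 mg gB).
have il := integrable_mul2 u'2 (Lfun2_phi_dom sg01 T1 B0 ml lB).
rewrite /mu -(EFin_Rintegral ig) -(EFin_Rintegral il) -EFinM -EFinD => /le_trans; apply.
rewrite lee_fin.
have hg := norm_Rintegral_mul_le sg01 u'2 T1 B0 mg gB.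
have hl := norm_Rintegral_mul_le sg01 u'2 T1 B0 ml lB.
(* The triangle inequality turns [lambda] into its absolute value, whence the constant
   [(1 + |lambda|) C] given to [vanishing]. *)
apply: le_trans (ler_norm _) _; apply: le_trans (ler_normD _ _) _; rewrite normrM.
apply: le_trans (lerD hg (ler_wpM2l l0 hl)) _.
by rewrite /B le_eqVlt; apply/orP; left; apply/eqP; ring.
Qed.
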